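(* Let $d\ge1$, $T>0$, $H\in(1/2,1)$, and let $\{v(\eta);\eta\in\mathcal D((0,T)\times\mathbb R^d)\}$, $v(\eta)=F(\eta*\tilde G)$, be the distribution-valued solution of the stochastic heat equation $v_t-\Delta v=\dot F$ in $(0,T)\times\mathbb R^d$, $v(0,\cdot)=0$. In order that there exists a jointly measurable and locally mean-square bounded process $Y=\{Y(t,x);t\in[0,T],x\in\mathbb R^d\}$ such that $$v(\eta)=\int_0^T\int_{\mathbb R^d}Y(t,x)\eta(t,x)\,dx\,dt\quad\forall\eta\in\mathcal D((0,T)\times\mathbb R^d)\quad\text{a.s.},$$ it is necessary and sufficient that $H>d/4$. In this case, $Y$ is a modification of the process $v=\{v(t,x);t\in[0,T],x\in\mathbb R^d\}$ defined by $v(t,x)=F(g_{tx})$.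
   Context: $\mathcal D(U)$ is the space of infinitely differentiable functions with compact support contained in the open set $U$. $\mathcal F_{0,T}\varphi(\tau,x)=\int_0^T e^{-i\tau t}\varphi(t,x)\,dt$. Put $\alpha_H=H(2H-1)$ and $c_H=[2^{2(1-H)}\pi^{1/2}]^{-1}\Gamma(H-1/2)/\Gamma(1-H)$. $\mathcal H$ is the completion of $\mathcal D((0,T)\times\mathbb R^d)$ with respect to the inner product $$\langle\varphi,\psi\rangle_{\mathcal H}=\alpha_H\int_0^T\!\int_0^T\!\int_{\mathbb R^d}\varphi(u,x)|u-v|^{2H-2}\psi(v,x)\,dx\,dv\,du=\alpha_Hc_H\int_{\mathbb R}\int_{\mathbb R^d}\mathcal F_{0,T}\varphi(\tau,x)\overline{\mathcal F_{0,T}\psi(\tau,x)}\,|\tau|^{-(2H-1)}dx\,d\tau .$$ A function is said to be in $\mathcal H$ if it is identified with an element of this completion, i.e. is a limit of elements of $\mathcal D((0,T)\times\mathbb R^d)$ in the norm given by the same formula. Noise (fractional in time, white in space): $F=\{F(\varphi);\varphi\in\mathcal D((0,T)\times\mathbb R^d)\}$ is a zero-mean Gaussian process with covariance $E(F(\varphi)F(\psi))=\langle\varphi,\psi\rangle_{\mathcal H}$; the isometry $\varphi\mapsto F(\varphi)\in L^2(\Omega)$ is extended to all of $\mathcal H$, and $F(\varphi)=\int_0^T\int_{\mathbb R^d}\varphi(t,x)F(dt,dx)$ denotes the extension. $G(t,x)=(4\pi t)^{-d/2}\exp(-|x|^2/(4t))$ for $t>0$ and $G(t,x)=0$ for $t\le0$.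 $g_{tx}(s,y)=G(t-s,x-y)$; $\tilde G(s,y)=G(-s,-y)$; for $\eta\in\mathcal D((0,T)\times\mathbb R^d)$ (extended by $0$), $(\eta*\tilde G)(t,x)=\int_0^\infty\int_{\mathbb R^d}\eta(t+s,x+y)G(s,y)\,dy\,ds$. The distribution-valued solution is $v(\eta)=F(\eta*\tilde G)$, defined when $\eta*\tilde G\in\mathcal H$. The process solution is $v(t,x)=F(g_{tx})=\int_0^T\int_{\mathbb R^d}G(t-s,x-y)F(ds,dy)$, defined when $g_{tx}\in\mathcal H$. When $H>d/4$, $\eta*\tilde G$ and $g_{tx}$ belong to $\mathcal H$ for all $\eta$ and all $(t,x)\in[0,T]\times\mathbb R^d$. ''Locally mean-square bounded'' means $\sup_{(t,x)\in K}E|Y(t,x)|^2<\infty$ for every compact $K\subset[0,T]\times\mathbb R^d$.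
   Formalization: ''Y is a modification of v'' fails for arbitrary Y (change Y at one point); it is stated instead as: some such Y is a modification at every (t,x), and every such Y satisfies Y(t,x)=v(t,x) a.s. for Lebesgue-almost every (t,x). *)

(* Defs.v *)
From HB Require Import structures.
From mathcomp Require Import all_boot all_order all_algebra.
From mathcomp Require Import all_classical all_reals all_analysis.

Set Implicit Arguments.
Unset Strict Implicit.
Unset Printing Implicit Defensive.

Import Order.TTheory GRing.Theory Num.Theory.
Import numFieldNormedType.Exports.

Local Open Scope classical_set_scope.
Local Open Scope ring_scope.

(* The sigma-algebra on row vectors is generated by the coordinates, as the
   library does for n.-tuple T. *)
Definition measure_rV_display : measure_display -> measure_display.
Proof. exact. Qed.

Section measurable_rV.
Context {d} {T : sigmaRingType d}.
Variable n : nat.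

Let coors : 'I_n -> 'rV[T]_n -> T := fun i x => x ord0 i.

Let rV_set0 : g_sigma_preimage coors set0.
Proof. exact: sigma_algebra0. Qed.

Let rV_setC A : g_sigma_preimage coors A -> g_sigma_preimage coors (~` A).
Proof. exact: sigma_algebraC. Qed.

Let rV_bigcup (F : _^nat) : (forall i, g_sigma_preimage coors (F i)) ->
  g_sigma_preimage coors (\bigcup_i (F i)).
Proof. exact: sigma_algebra_bigcup. Qed.

HB.instance Definition _ := @isMeasurable.Build (measure_rV_display d)
  ('rV[T]_n) (g_sigma_preimage coors) rV_set0 rV_setC rV_bigcup.

End measurable_rV.

Section measurable_fun_rV.
Context d d' (T : measurableType d) (S : measurableType d').

Lemma measurable_coord n (i : 'I_n) :
  measurable_fun [set: 'rV[T]_n] (fun x : 'rV[T]_n => x ord0 i).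
Proof.
case: n i => [[]//|n] i _ A mA; rewrite setTI; apply: sub_sigma_algebra.
rewrite -bigcup_mkord_ord; exists i; first exact: (ltn_ord i).
by exists A => //; rewrite setTI inord_val.
Qed.

Lemma measurable_fun_rVP n (f : S -> 'rV[T]_n) :
  (forall i, measurable_fun setT (fun s => f s ord0 i)) ->
  measurable_fun setT f.
Proof.
case: n f => [|n] f mf; apply: (measurability (_ : set (set 'rV[T]__))) => //.
  by move=> _ [B + <-]; rewrite big_ord0.
move=> _ [B + <-].
rewrite -bigcup_mkord_ord => -[i Ii [A mA <-]].
by rewrite setTI; exact: (mf (inord i) measurableT A mA).
Qed.

End measurable_fun_rV.

(* The library's own instance is shadowed by its sub-probability one. *)
Lemma product_measure_sigma_finite d1 d2 (T1 : measurableType d1)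
    (T2 : measurableType d2) (R : realType)
    (m1 : {sigma_finite_measure set T1 -> \bar R})
    (m2 : {sigma_finite_measure set T2 -> \bar R}) :
  sigma_finite setT (m1 \x m2)%E.
Proof.
have /sigma_finiteP[F [TF ndF Foo]] := sigma_finiteT m1.
have /sigma_finiteP[G [TG ndG Goo]] := sigma_finiteT m2.
exists (fun n => F n `*` G n).
  rewrite -setXTT TF TG predeqE => -[x y]; split.
    move=> [/= [n _ Fnx] [k _ Gky]]; exists (maxn n k) => //; split.
    - by move: x Fnx; exact/subsetPset/ndF/leq_maxl.
    - by move: y Gky; exact/subsetPset/ndG/leq_maxr.
  by move=> [n _ []/= ? ?]; split; exists n.
move=> k; have [? ?] := Foo k; have [? ?] := Goo k.
split; first exact: measurableX.
by rewrite product_measure1E// lte_mul_pinfty// ge0_fin_numE.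
Qed.

Section lebesgue_rV.
Variable R : realType.

Definition rV_cons n (p : measurableTypeR R * 'rV[R]_n) : 'rV[R]_n.+1 :=
  row_mx (p.1)%:M p.2 : 'rV[R]_(1 + n).

Definition rV_uncons n (x : 'rV[R]_n.+1) : measurableTypeR R * 'rV[R]_n :=
  (x ord0 ord0, \row_i x ord0 (lift ord0 i)).

Lemma rV_consK n : cancel (@rV_cons n) (@rV_uncons n).
Proof.
move=> [a v]; rewrite /rV_cons /rV_uncons; congr pair.
  rewrite (_ : ord0 = lshift n (ord0 : 'I_1)); last exact: val_inj.
  by rewrite (row_mxEl a%:M) mxE eqxx.
apply/rowP => i; rewrite mxE (_ : lift ord0 i = rshift 1 i); last exact: val_inj.
by rewrite (row_mxEr a%:M).
Qed.

Lemma measurable_rV_cons n : measurable_fun setT (@rV_cons n).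
Proof.
apply: measurable_fun_rVP => i.
have := splitP (i : 'I_(1 + n)); case=> j ij.
  rewrite (_ : (fun s => _) = fst); first exact: measurable_fst.
  apply/funext => -[a v]; rewrite /rV_cons.
  rewrite (_ : i = lshift n j); last exact: val_inj.
  by rewrite (row_mxEl a%:M) mxE (ord1 j).
rewrite (_ : (fun s => _) = (fun x : 'rV[R]_n => x ord0 j) \o snd).
  by apply: measurableT_comp; [exact: measurable_coord|exact: measurable_snd].
apply/funext => -[a v]; rewrite /rV_cons /=.
rewrite (_ : i = rshift 1 j); last exact: val_inj.
by rewrite (row_mxEr a%:M).
Qed.

Lemma measurable_rV_uncons n : measurable_fun setT (@rV_uncons n).
Proof.
apply: measurable_fun_pair; first exact: measurable_coord.
apply: measurable_fun_rVP => i.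
under eq_fun do rewrite mxE.
exact: measurable_coord.
Qed.

Section push.
Variables (n : nat) (m : {sigma_finite_measure set 'rV[R]_n -> \bar R}).

Definition push_rV_cons : set 'rV[R]_n.+1 -> \bar R :=
  pushforward (@lebesgue_measure R \x m)%E (@rV_cons n).

Let push0 : push_rV_cons set0 = 0%E.
Proof. by apply: measure0; exact: measurable_rV_cons. Qed.

Let push_ge0 A : (0 <= push_rV_cons A)%E.
Proof. by apply: measure_ge0; exact: measurable_rV_cons. Qed.

Let push_sigma_additive : semi_sigma_additive push_rV_cons.
Proof.
by apply: measure_semi_sigma_additive; exact: measurable_rV_cons.
Qed.

HB.instance Definition _ := isMeasure.Build _ _ _ push_rV_cons
  push0 push_ge0 push_sigma_additive.

Let push_sigma_finite : sigma_finite setT push_rV_cons.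
Proof.
have [F FT mF] := product_measure_sigma_finite (@lebesgue_measure R) m.
exists (fun k => @rV_uncons n @^-1` F k).
  by rewrite -preimage_bigcup -FT preimage_setT.
move=> k; have [mFk Fk] := mF k; split.
  by rewrite -[X in measurable X]setTI; exact: measurable_rV_uncons.
rewrite /push_rV_cons /pushforward -comp_preimage.
rewrite (_ : _ \o _ = id); first by rewrite preimage_id.
by apply/funext => p; exact: rV_consK.
Qed.

HB.instance Definition _ :=
  Measure_isSigmaFinite.Build _ _ _ push_rV_cons push_sigma_finite.

End push.

(* Lebesgue measure on R^n: the n-fold product of the Lebesgue measure on R,
   transported to row vectors. *)
Fixpoint lebesgue_rV n : {sigma_finite_measure set 'rV[R]_n -> \bar R} :=
  if n is n'.+1 then push_rV_cons (lebesgue_rV n')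
  else \d_(0 : 'rV[R]_0).

End lebesgue_rV.

(* Points of R x R^d are pairs (time, space). *)
Section spacetime.
Variables (R : realType) (d : nat).

Definition spacetime_measure :
    set (measurableTypeR R * 'rV[R]_d)%type -> \bar R :=
  (@lebesgue_measure R \x lebesgue_rV R d)%E.

HB.instance Definition _ := Measure.on spacetime_measure.

HB.instance Definition _ := Measure_isSigmaFinite.Build _ _ _ spacetime_measure
  (product_measure_sigma_finite _ _).

(* The measure du dv dx on R x R x R^d. *)
Definition time2space_measure :
    set ((measurableTypeR R * measurableTypeR R) * 'rV[R]_d)%type -> \bar R :=
  ((@lebesgue_measure R \x @lebesgue_measure R) \x lebesgue_rV R d)%E.

HB.instance Definition _ := Measure.on time2space_measure.

End spacetime.
Arguments spacetime_measure : clear implicits.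
Arguments time2space_measure : clear implicits.

Section test_functions.
Variables (R : realType) (d : nat).
Local Notation E := (R * 'rV[R]_d)%type.

(* Every iterated directional derivative exists everywhere and is
   continuous. *)
Definition smooth (f : E -> R) : Prop :=
  forall vs : seq E, let g := foldr (fun v h => 'D_v h) f vs in
    continuous g /\ forall z v, derivable g z v.

(* The space D(U), each function being extended by 0 outside U. *)
Definition test_function (U : set E) (f : E -> R) : Prop :=
  [/\ smooth f, compact (closure [set z | f z != 0]) &
      closure [set z | f z != 0] `<=` U].

Definition open_strip (T : R) : set E := `]0, T[ `*` setT.
Definition closed_strip (T : R) : set E := `[0, T] `*` setT.

End test_functions.

Section space_H.
Variables (R : realType) (d : nat) (T H : R).
Local Notation E := (R * 'rV[R]_d)%type.
Local Notation D := (test_function (@open_strip R d T)).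

Definition H_kernel (f g : E -> R) (w : (R * R) * 'rV[R]_d) : R :=
  f (w.1.1, w.2) * `|w.1.1 - w.1.2| `^ (2 * H - 2) * g (w.1.2, w.2).

Definition H_domain : set ((R * R) * 'rV[R]_d) :=
  (`]0, T[ `*` `]0, T[) `*` setT.

Definition H_inner (f g : E -> R) : R :=
  H * (2 * H - 1) *
  \int[time2space_measure R d]_(w in H_domain) H_kernel f g w.

(* The integral defining H_inner f f converges absolutely (Rintegral is a
   junk value otherwise). *)
Definition H_finite (f : E -> R) : Prop :=
  measurable_fun (@open_strip R d T) f /\
  (time2space_measure R d).-integrable H_domain (EFin \o H_kernel f f).

Definition H_approx (phi : nat -> E -> R) (f : E -> R) : Prop :=
  [/\ forall n, D (phi n),
      forall n, H_finite (phi n \- f) &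
      H_inner (phi n \- f) (phi n \- f) @[n --> \oo] --> 0].

(* f is identified with an element of the completion of D. *)
Definition in_H (f : E -> R) : Prop := exists phi, H_approx phi f.

End space_H.

Section noise.
Context {R : realType} {d : nat} {dO : measure_display}
        {Omega : measurableType dO}.
Variables (T H : R) (P : probability Omega R).
Local Notation E := (R * 'rV[R]_d)%type.
Local Notation D := (test_function (@open_strip R d T)).

(* X is normally distributed, possibly with variance 0. *)
Definition gaussian (X : Omega -> R) : Prop :=
  exists m s : R, forall A, measurable A ->
    P (X @^-1` A) = if s == 0 then \d_m A else normal_prob m s A.

(* F is only constrained on D. *)
Definition fractional_noise (F : (E -> R) -> {RV P >-> R}) : Prop :=
  [/\ forall n (phi : 'I_n -> E -> R) (a : 'I_n -> R),
        (forall i, D (phi i)) ->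
        gaussian (fun w => \sum_(i < n) a i * F (phi i) w),
      forall phi, D phi -> ('E_P[F phi] = 0)%E &
      forall phi psi, D phi -> D psi ->
        ('E_P[fun w => (F phi w * F psi w)%R] = (H_inner T H phi psi)%:E)%E].

Variable F : (E -> R) -> {RV P >-> R}.

(* X is a version of F(f), the value at f of the extension to H of the
   isometry phi |-> F(phi) in L^2(Omega). *)
Definition is_noise_integral (f : E -> R) (X : {RV P >-> R}) : Prop :=
  exists2 phi, H_approx T H phi f &
    ('E_P[fun w => ((F (phi n) w - X w) ^+ 2)%R])%E @[n --> \oo] --> 0%E.

(* A version of F(f); meaningful when in_H T H f. *)
Definition noise_integral (f : E -> R) : {RV P >-> R} :=
  xget (cst 0 : {mfun Omega >-> R}) (is_noise_integral f).

End noise.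

Section heat_equation.
Context {R : realType} {d : nat}.
Local Notation E := (R * 'rV[R]_d)%type.

Definition sqnorm (x : 'rV[R]_d) : R := \sum_(i < d) x ord0 i ^+ 2.

Definition heat_kernel (z : E) : R :=
  if 0 < z.1 then
    (4 * pi * z.1) `^ (- (d%:R / 2)) * expR (- sqnorm z.2 / (4 * z.1))
  else 0.

(* g_{tx}(s, y) = G(t - s, x - y) *)
Definition heat_kernel_at (z : E) : E -> R :=
  fun w => heat_kernel (z.1 - w.1, z.2 - w.2).

(* The convolution of eta with the reflected heat kernel. *)
Definition heat_conv (eta : E -> R) : E -> R :=
  fun z => \int[spacetime_measure R d]_(w in `]0, +oo[ `*` setT)
             (eta (z.1 + w.1, z.2 + w.2) * heat_kernel w).

Context {dO : measure_display} {Omega : measurableType dO}.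
Variables (T H : R) (P : probability Omega R).
Variable F : (E -> R) -> {RV P >-> R}.

Definition dist_solution (eta : E -> R) : {RV P >-> R} :=
  noise_integral T H F (heat_conv eta).

Definition process_solution (z : E) : {RV P >-> R} :=
  noise_integral T H F (heat_kernel_at z).

Definition jointly_measurable (Y : E -> Omega -> R) : Prop :=
  measurable_fun (@closed_strip R d T `*` [set: Omega])
    (fun p : E * Omega => Y p.1 p.2).

Definition locally_ms_bounded (Y : E -> Omega -> R) : Prop :=
  forall K : set E, compact K -> K `<=` @closed_strip R d T ->
    (ereal_sup [set 'E_P[fun w => (`|Y z w| ^+ 2)%R] | z in K] < +oo)%E.

(* The equality in \bar R forces the right-hand side to be an absolutely
   convergent integral. *)
Definition represents (Y : E -> Omega -> R) : Prop :=
  forall eta, test_function (@open_strip R d T) eta ->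
    in_H T H (heat_conv eta) /\
    {ae P, forall w, (dist_solution eta w)%:E =
       (\int[spacetime_measure R d]_(z in closed_strip T) (Y z w * eta z)%:E)%E}.

Definition solution_process (Y : E -> Omega -> R) : Prop :=
  [/\ jointly_measurable Y, locally_ms_bounded Y & represents Y].

Definition is_version_at (Y : E -> Omega -> R) (z : E) : Prop :=
  in_H T H (heat_kernel_at z) /\
  {ae P, forall w, Y z w = process_solution z w}.

Definition is_modification (Y : E -> Omega -> R) : Prop :=
  forall z, closed_strip T z -> is_version_at Y z.

(* All that can be said of an arbitrary Y: solution_process still holds after
   setting Y to 0 at a single point (t, x). *)
Definition is_ae_modification (Y : E -> Omega -> R) : Prop :=
  {ae spacetime_measure R d, forall z, closed_strip T z -> is_version_at Y z}.

End heat_equation.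

(* Main.v *)
Require Import Defs.
From HB Require Import structures.
From mathcomp Require Import all_boot all_order all_algebra.
From mathcomp Require Import all_classical all_reals all_analysis.
From mathcomp Require Import measurable_realfun ring lra.

Set Implicit Arguments.
Unset Strict Implicit.
Unset Printing Implicit Defensive.

Import Order.TTheory GRing.Theory Num.Theory.
Import numFieldNormedType.Exports.

Local Open Scope classical_set_scope.
Local Open Scope ring_scope.

(** The energy of the heat kernel with pole (t, x), as a function of its second
argument, is finite exactly when H > d/4. Indeed, integrating in space first,
the semigroup property turns this energy into the integral of
|u - v|^(2H-2) (4 pi (u + v))^(-d/2) over 0 < u, v < t, which is comparable to
the integral of u^(2H-1-d/2) over ]0, t[ ([energy_heat], [energy_heat_le],
[energy_heat_infty]).

If H > d/4, the heat kernel is a limit of combinations of bumps with rational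
data. Choosing the approximants measurably among countably many of them, and
letting their noise integrals converge almost surely, produces a jointly
measurable process Y whose value at every point is a version of the noise
integral of the heat kernel ([measurable_version]). Given a test function eta,
let X be the noise integral of the convolution of eta with the reflected heat
kernel, and I the average of Y against eta. The energy form commutes with
averages of the heat kernel over its pole ([heat_conv_inner]), so that X - I is
orthogonal to the noise of every test function, hence to all noise integrals,
in particular to X and to the values of Y; but then it is orthogonal to I as
well, and X - I vanishes ([solution_exists]).

Conversely, let Y be a solution whose second moment is bounded by C on a compact
set. For a nonnegative eta living there, the second moment of the average of Y
against eta is at most C times the square of the integral of eta, while it is
also a multiple of the energy of the convolution. Taking for eta normalized
bumps that shrink to an interior point, the convolutions tend to the heat
kernel with this pole, and Fatou's lemma shows that its energy is finite
([solution_necessary]).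

Two solutions have almost surely the same averages against countably many
bumps, whose combinations are dense among square-integrable functions; they
therefore agree almost everywhere, which Fubini's theorem turns into an almost
sure equality at almost every point ([solution_unique]).

Three analytic facts support the argument. The kernel |u - v|^(2H-2) is positive,
being a superposition of products of indicators of intervals ([riesz_young]), so
that the energy form is a semi-inner product ([H_semi_inner]). The Schur test
bounds the energy by the mean square ([energy_L2]), so that mean square
approximation suffices. And rational combinations of bumps are dense in the mean
square sense ([L2_approximable]). *)

(** * Integrals of powers *)

Section power_integrals.
Context {R : realType}.
Local Notation mu := (@lebesgue_measure R).

Lemma ereal_cvg_unique (u : (\bar R)^nat) (a b : \bar R) :
  u @ \oo --> a -> u @ \oo --> b -> a = b.
Proof. by move=> ua ub; apply: (cvg_unique _ ua ub). Qed.

Lemma FTC2_pos (f F : R -> R) (a b : R) : 0 < a -> a < b ->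
  (forall x : R, 0 < x -> is_derive x 1 F (f x)) ->
  (forall x : R, 0 < x -> derivable f x 1) ->
  (\int[mu]_(x in `[a, b]) (f x)%:E = (F b)%:E - (F a)%:E)%E.
Proof.
move=> a0 ab dF df.
have cF : forall x : R, 0 < x -> {for x, continuous F}.
  move=> x x0; apply/differentiable_continuous/derivable1_diffP.
  by have [] := dF _ x0.
apply: continuous_FTC2 => //.
- apply: derivable_within_continuous => x; rewrite in_itv/= => /andP[ax _].
  exact/df/(lt_le_trans a0).
- split.
  + move=> x; rewrite in_itv/= => /andP[ax _].
    by have [] := dF x (lt_trans a0 ax).
  + exact/cvg_at_right_filter/cF.
  + exact/cvg_at_left_filter/cF/(lt_trans a0).
- move=> x; rewrite in_itv/= => /andP[ax _].
  by rewrite derive1E; have [_ ->] := dF x (lt_trans a0 ax).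
Qed.

Lemma integral_0oc_cvg (f : R -> \bar R) (x : R) : 0 < x ->
  measurable_fun `]0, x] f -> (forall y : R, 0 < y -> (0 <= f y)%E) ->
  (\int[mu]_(y in `[(x / n.+2%:R)%R, x]) f y)%E @[n --> \oo] -->
  (\int[mu]_(y in `]0%R, x]) f y)%E.
Proof.
move=> x0 mf f0.
have sub n : `[x / n.+2%:R, x] `<=` `]0, x].
  move=> y/=; rewrite !in_itv/= => /andP[h ->]; rewrite andbT.
  by rewrite (lt_le_trans _ h)// divr_gt0.
rewrite (_ : `]0, x]%classic = \bigcup_n `[x / n.+2%:R, x]%classic); last first.
  apply/seteqP; split => [y/=|y [n _]]; last exact: sub.
  rewrite in_itv/= => /andP[y0 yx].
  exists (Num.truncn (x / y)) => //=; rewrite in_itv/= yx andbT.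
  rewrite ler_pdivrMr// mulrC -ler_pdivrMr//.
  have := truncnS_gt (x / y); move=> /ltW/le_trans; apply.
  by rewrite ler_nat.
apply: (ge0_nondecreasing_set_cvg_integral (mu := mu)) => //.
- apply/nondecreasing_seqP => n; rewrite subsetEset => y/=.
  rewrite !in_itv/= => /andP[h ->]; rewrite andbT (le_trans _ h)//.
  by rewrite ler_pM2l// lef_pV2 ?posrE// ler_nat.
- by move=> n; exact: measurable_funS (sub n) _.
- move=> n y /sub/=; rewrite in_itv/= => /andP[y0 _]; exact: f0.
Qed.

Lemma integral_powR0 (p x : R) : -1 < p -> 0 < x ->
  (\int[mu]_(y in `]0%R, x]) (y `^ p)%:E = (x `^ (p + 1) / (p + 1))%:E)%E.
Proof.
move=> p1 x0; have q0 : 0 < p + 1 by lra.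
have ml : measurable_fun `]0, x] (EFin \o (fun y => y `^ p)).
  by apply/measurable_EFinP; apply: measurable_funTS; exact: measurable_powR.
have := integral_0oc_cvg x0 ml.
move=> /= H; have {}H := H (fun y _ => powR_ge0 y p).
apply: (ereal_cvg_unique H).
have E n : (\int[mu]_(y in `[(x / n.+2%:R)%R, x]) (y `^ p)%:E =
    (x `^ (p + 1) / (p + 1) - (x / n.+2%:R) `^ (p + 1) / (p + 1))%:E)%E.
  have dv (y : R) : 0 < y -> is_derive y 1 (fun z => z `^ (p + 1) / (p + 1)) (y `^ p).
    move=> y0; have := @is_derive1_powR R (p + 1) y y0 => D.
    have -> : (fun z : R => z `^ (p + 1) / (p + 1)) = (fun z => (p + 1)^-1 *: (z `^ (p + 1))).
      by apply/funext => z; rewrite mulrC.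
    apply: is_derive_eq; rewrite addrK /GRing.scale/= mulrA mulVf ?mul1r//.
    by rewrite gt_eqF.
  rewrite (@FTC2_pos _ (fun z => z `^ (p + 1) / (p + 1))) ?EFinB//.
  - by rewrite divr_gt0.
  - by rewrite ltr_pdivrMr// ltr_pMr// ltr1n.
  - by move=> y y0; apply: derivable_powR; rewrite in_itv/= y0.
under eq_fun do rewrite E.
apply: cvg_EFin; first exact: nearW.
rewrite -[X in _ --> X]subr0; apply: cvgB; first exact: cvg_cst.
rewrite -(mul0r (p + 1)^-1); apply: cvgMr_tmp.
have := @powR_cvg0 R (p + 1) q0.
move=> /cvg_at_rightP; apply; split => [n|]; first by rewrite divr_gt0.
rewrite -(mulr0 x); apply: cvgMl_tmp.
by have := @cvg_harmonic R; rewrite -cvg_shiftS.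
Qed.

Lemma integral_powR0_infty (p x : R) : p <= -1 -> 0 < x ->
  (\int[mu]_(y in `]0%R, x]) (y `^ p)%:E = +oo)%E.
Proof.
move=> p1 x0; pose m := Num.min x 1.
have m0 : 0 < m by rewrite lt_min x0 ltr01.
have m1 : m <= 1 by rewrite ge_min lexx orbT.
have mx : m <= x by rewrite ge_min lexx.
have mpow (q : R) : measurable_fun setT (EFin \o (fun y => y `^ q)).
  by apply/measurable_EFinP; exact: measurable_powR.
apply/eqyP => A A0.
pose n := Num.truncn (A / m); pose q : R := n.+1%:R^-1.
have q0 : 0 < q by rewrite invr_gt0.
have q1 : q <= 1 by rewrite invf_le1// ler1n.
(* The exponents q - 1 are integrable, but their integrals are of order 1 / q. *)
apply: (@le_trans _ _ (\int[mu]_(y in `]0%R, m]) (y `^ (q - 1))%:E)%E).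
  rewrite integral_powR0 ?subrK//; last by lra.
  rewrite lee_fin /q invrK.
  apply: (@le_trans _ _ (m * n.+1%:R)).
    by rewrite mulrC -ler_pdivrMr//; exact/ltW/truncnS_gt.
  rewrite ler_pM2r// -[leLHS]powRr1 ?(ltW m0)//.
  by apply: ger_powR => //; rewrite m0.
apply: (@le_trans _ _ (\int[mu]_(y in `]0%R, m]) (y `^ p)%:E)%E).
  apply: ge0_le_integral => //.
  - by move=> y _; rewrite lee_fin powR_ge0.
  - exact: (measurable_funTS (mpow _)).
  - exact: (measurable_funTS (mpow _)).
  - move=> y/=; rewrite in_itv/= => /andP[y0 ym].
    by rewrite lee_fin; apply: ger_powR; rewrite ?y0 ?(le_trans ym)//; lra.
apply: ge0_subset_integral => //.
- exact: (measurable_funTS (mpow _)).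
- by move=> y _; rewrite lee_fin powR_ge0.
- move=> y/=; rewrite !in_itv/= => /andP[-> ym]; exact: le_trans mx.
Qed.

(** The total weight of the intervals that contain two points at distance D,
when intervals of length y have density y^(-a-2). *)
Lemma integral_powR_tail (a D : R) : 0 < a -> 0 < D ->
  (\int[mu]_(y in `[D, +oo[) (y `^ (- a - 2) * (y - D))%:E =
   (D `^ (- a) / (a * (a + 1)))%:E)%E.
Proof.
move=> a0 D0.
pose F (y : R) : R := - a^-1 * y `^ (- a) + D * ((a + 1)^-1 * y `^ (- a - 1)).
have dF (y : R) : 0 < y -> is_derive y 1 F (y `^ (- a - 2) * (y - D)).
  move=> y0; have D1 := @is_derive1_powR R (- a) y y0.
  have D2 := @is_derive1_powR R (- a - 1) y y0.
  rewrite /F; apply: is_derive_eq.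
  rewrite /GRing.scale/= (_ : - a - 1 - 1 = - a - 2); last by lra.
  have -> : y `^ (- a - 1) = y `^ (- a - 2) * y.
    rewrite -[X in _ * X]powRr1 ?(ltW y0)// -powRD ?(gt_eqF y0) ?implybT//.
    by congr (_ `^ _); lra.
  by field; rewrite !gt_eqF//; lra.
have cpow (q y : R) : 0 < y -> {for y, continuous (fun z : R => z `^ q)}.
  move=> y0; apply/differentiable_continuous/derivable1_diffP.
  by apply: derivable_powR; rewrite in_itv/= y0.
have pow0 (q : R) : q < 0 -> y `^ q @[y --> +oo] --> (0 : R).
  move=> q0; apply/cvgrPdist_le => /= e e0.
  near=> y; have y0 : 0 < y.
    by near: y; apply: nbhs_pinfty_gt; rewrite num_real.
  rewrite sub0r normrN ger0_norm ?powR_ge0//.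
  rewrite -[q]opprK powRN -(invrK e) lef_pV2 ?posrE ?powR_gt0 ?invr_gt0//.
  have -> : e^-1 = (e^-1 `^ (- q)^-1) `^ (- q).
    by rewrite -powRrM mulVf ?powRr1 ?invr_ge0 ?(ltW e0)//; lra.
  apply: ge0_ler_powR; rewrite ?nnegrE ?powR_ge0 ?oppr_ge0 ?(ltW q0) ?(ltW y0)//.
have cF y : 0 < y -> {for y, continuous F}.
  move=> y0; apply: cvgD; [|apply: cvgMl_tmp]; by apply: cvgMl_tmp; exact: cpow.
rewrite (@ge0_continuous_FTC2y _ _ F _ 0) ?sub0e -?EFinN.
- congr EFin; rewrite /F.
  have -> : D `^ (- a) = D `^ (- a - 1) * D.
    rewrite -[X in _ * X]powRr1 ?(ltW D0)// -powRD ?(gt_eqF D0) ?implybT//.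
    by congr (_ `^ _); lra.
  by field; rewrite !gt_eqF//; lra.
- by move=> y Dy; rewrite mulr_ge0 ?powR_ge0 ?subr_ge0.
- apply: continuous_in_subspaceT => y; rewrite inE/= in_itv/= andbT => Dy.
  apply: cvgM; first exact/cpow/(lt_le_trans D0).
  by apply: cvgB => //; exact: cvg_cst.
- rewrite -[X in _ --> X](_ : - a^-1 * 0 + D * ((a + 1)^-1 * 0) = 0); last first.
    by rewrite !mulr0 addr0.
  by apply: cvgD; [|apply: cvgMl_tmp]; apply: cvgMl_tmp; apply: pow0; lra.
- by move=> y Dy; have [] := dF _ (lt_trans D0 Dy).
- exact/cvg_at_right_filter/cF.
- move=> y; rewrite in_itv/= andbT => Dy.
  by rewrite derive1E; have [_ ->] := dF _ (lt_trans D0 Dy).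
Unshelve. all: by end_near. Qed.

End power_integrals.

(** * Measurability of composite expressions *)

Lemma measurable_invr (R : realType) : measurable_fun setT (fun x : R => x^-1).
Proof.
have -> : (fun x : R => x^-1) =
    (fun x => if 0 <= x then x `^ (- 1) else - ((- x) `^ (- 1))).
  apply/funext => x; case: ifPn => [x0|]; first by rewrite powR_inv1.
  by rewrite -ltNge => x0; rewrite powR_inv1 ?oppr_ge0 ?(ltW x0)// invrN opprK.
apply: measurable_fun_ifT; first exact: measurable_fun_ler.
  exact: measurable_powR.
by apply: measurable_funN; apply: (measurableT_comp (@measurable_powR _ _)).
Qed.

(** Proves that a composite function is measurable by following the shape of its
body. The clauses before the last two are for operators partially applied to a
constant, which appear when an abstraction is eta-reduced. *)
Ltac mfun1 := first
  [ assumption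
  | exact: measurable_cst
  | exact: measurable_id
  | exact: measurable_fst
  | exact: measurable_snd
  | exact: measurable_coord
  | exact: pair1_measurable
  | exact: pair2_measurable
  | match goal with H : is_true ?b |- is_true ?b => exact: H end
  | match goal with |- measurable_fun _ (fun x => pair _ _) => apply: measurable_fun_pair end
  | match goal with |- measurable_fun _ (fun x => @GRing.add _ _ (@GRing.opp _ _)) => apply: measurable_funB end
  | match goal with |- measurable_fun _ (fun x => @GRing.add _ _ _) => apply: measurable_funD end
  | match goal with |- measurable_fun _ (fun x => @GRing.opp _ _) => apply: measurable_funN end
  | match goal with |- measurable_fun _ (fun x => @GRing.mul _ _ _) => apply: measurable_funM end
  | match goal with |- measurable_fun _ (fun x => @GRing.exp _ _ _) => apply: measurable_funX end
  | match goal with |- measurable_fun _ (fun x => @GRing.inv _ _) => apply: (measurableT_comp (@measurable_invr _)) end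
  | match goal with |- measurable_fun _ (fun x => bigop.body _ _ _) => apply: measurable_sum => ? end
  | match goal with |- measurable_fun _ (fun x => if _ then _ else _) => apply: measurable_fun_ifT end
  | match goal with |- measurable_fun _ (fun x => andb _ _) => apply: measurable_and end
  | match goal with |- measurable_fun _ (fun x => (_ < _)%R) => apply: measurable_fun_ltr end
  | match goal with |- measurable_fun _ (fun x => (_ <= _)%R) => apply: measurable_fun_ler end
  | match goal with |- measurable_fun _ (fun x => Order.max _ _) => apply: measurable_maxr end
  | match goal with |- measurable_fun _ (fun x => EFin _) => apply/measurable_EFinP; rewrite /comp end
  | match goal with |- measurable_fun _ (EFin \o _) => apply/measurable_EFinP end
  | match goal with |- measurable_fun _ (fun x => @Num.norm _ _ _) => apply: (measurableT_comp (@normr_measurable _ setT)) end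
  | match goal with |- measurable_fun _ (fun x => expR _) => apply: (measurableT_comp (@measurable_expR _)) end
  | match goal with |- measurable_fun _ (fun x => powR _ ?p) => apply: (measurableT_comp (@measurable_powR _ p)) end
  | match goal with |- measurable_fun _ (fun x => @fst ?A ?B _) =>
      apply: (measurableT_comp (@measurable_fst _ _ _ _)) end
  | match goal with |- measurable_fun _ (fun x => @snd ?A ?B _) =>
      apply: (measurableT_comp (@measurable_snd _ _ _ _)) end
  | match goal with |- measurable_fun _ (fun x => @fun_of_matrix _ _ _ _ ord0 ?i) =>
      apply: (measurableT_comp (@measurable_coord _ _ _ i)) end
  | match goal with |- measurable_fun ?D (@Order.lt _ _ ?c0) =>
      apply: (@measurable_fun_ltr _ _ _ D (cst c0) id) end
  | match goal with |- measurable_fun ?D (@Order.le _ _ ?c0) =>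
      apply: (@measurable_fun_ler _ _ _ D (cst c0) id) end
  | match goal with |- measurable_fun ?D (@GRing.add _ ?c0) =>
      apply: (@measurable_funD _ _ _ D (cst c0) id) end
  | match goal with |- measurable_fun ?D (@GRing.mul _ ?c0) =>
      apply: (@measurable_funM _ _ _ D (cst c0) id) end
  | match goal with |- measurable_fun ?D (@GRing.opp _) => exact: oppr_measurable end
  | match goal with H : measurable_fun _ ?f |- measurable_fun _ (fun x => ?f _) =>
      apply: (measurableT_comp H) end
  ].
Ltac mfun := repeat mfun1.

(** * Positivity of the Riesz kernel *)

Section sigma_finite_product.
Context d1 d2 (T1 : measurableType d1) (T2 : measurableType d2) (R : realType).
Variables (m1 : {sigma_finite_measure set T1 -> \bar R})
  (m2 : {sigma_finite_measure set T2 -> \bar R}).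

(** The product measure under a name of its own, for which sigma-finiteness
can be inferred. *)
Definition sfprod : set (T1 * T2) -> \bar R := (m1 \x m2)%E.

HB.instance Definition _ := Measure.on sfprod.

HB.instance Definition _ := Measure_isSigmaFinite.Build _ _ _ sfprod
  (product_measure_sigma_finite _ _).

End sigma_finite_product.

Section kernel_young.
Local Open Scope ereal_scope.
Context d1 d2 (X : measurableType d1) (S : measurableType d2) (R : realType).
Variables (mu : {sigma_finite_measure set X -> \bar R})
  (nu : {sigma_finite_measure set S -> \bar R}).
Variable k : X * S -> R.
Hypotheses (mk : measurable_fun setT k) (k0 : forall z, (0 <= k z)%R).

Lemma integral_prod_sep (f g : X -> R) :
  measurable_fun setT f -> measurable_fun setT g ->
  (forall x, (0 <= f x)%R) -> (forall x, (0 <= g x)%R) ->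
  \int[mu \x mu]_z (f z.1 * g z.2)%:E =
  (\int[mu]_x (f x)%:E) * (\int[mu]_x (g x)%:E).
Proof.
move=> mf mg f0 g0.
rewrite fubini_tonelli1/=; last 2 first.
- by mfun.
- by move=> z; rewrite lee_fin mulr_ge0.
rewrite /fubini_F/=.
transitivity (\int[mu]_x ((f x)%:E * \int[mu]_y (g y)%:E)).
  apply: eq_integral => x _; rewrite -ge0_integralZl//; first by mfun.
    by move=> y _; rewrite lee_fin.
  by rewrite lee_fin.
rewrite ge0_integralZr//; first by mfun.
- by move=> y _; rewrite lee_fin.
- by apply: integral_ge0 => y _; rewrite lee_fin.
Qed.

Let rep (f g : X -> R) := \int[mu \x mu]_z \int[nu]_s
  (f z.1 * k (z.1, s) * (g z.2 * k (z.2, s)))%:E.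

Let repE (f g : X -> R) :
  measurable_fun setT f -> measurable_fun setT g ->
  (forall x, (0 <= f x)%R) -> (forall x, (0 <= g x)%R) ->
  rep f g = \int[nu]_s ((\int[mu]_x (f x * k (x, s))%:E) *
                        (\int[mu]_x (g x * k (x, s))%:E)).
Proof.
move=> mf mg f0 g0; rewrite /rep.
rewrite (fubini_tonelli (m1 := sfprod mu mu) (m2 := nu)
   (fun w => (f w.1.1 * k (w.1.1, w.2) * (g w.1.2 * k (w.1.2, w.2)))%:E))/=.
- apply: eq_integral => s _; rewrite /fubini_G/=.
  apply: (@integral_prod_sep (fun x => f x * k (x, s))%R
    (fun x => g x * k (x, s))%R).
  + by mfun.
  + by mfun.
  + by move=> x; rewrite mulr_ge0.
  + by move=> x; rewrite mulr_ge0.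
- by mfun.
- by move=> w; rewrite lee_fin !mulr_ge0.
Qed.

Let ge0_sq (f : X -> R) s : (forall x, (0 <= f x)%R) ->
  0 <= \int[mu]_x (f x * k (x, s))%:E.
Proof. by move=> f0; apply: integral_ge0 => x _; rewrite lee_fin mulr_ge0. Qed.

Lemma mule_le_sqr (a b : \bar R) : 0 <= a -> 0 <= b ->
  a * b + a * b <= a * a + b * b.
Proof.
move=> a0 b0.
have [->|ay] := eqVneq a +oo; first by rewrite mulyy addye ?leey// gt_eqF// (lt_le_trans _ (mule_ge0 b0 b0)) ?ltNyr.
have [->|bY] := eqVneq b +oo; first by rewrite mulyy addey ?leey// gt_eqF// (lt_le_trans _ (mule_ge0 a0 a0)) ?ltNyr.
rewrite -(@fineK _ a) ?ge0_fin_numE ?ltey// -(@fineK _ b) ?ge0_fin_numE ?ltey//.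
by rewrite -!EFinM -!EFinD lee_fin; have := sqr_ge0 (fine a - fine b); nra.
Qed.

Definition kernel_form (K : X * X -> R) (f g : X -> R) :=
  \int[mu \x mu]_z (f z.1 * K z * g z.2)%:E.

Lemma kernel_form_sym (K : X * X -> R) (f g : X -> R) :
  measurable_fun setT f -> measurable_fun setT g -> measurable_fun setT K ->
  (forall z, (0 <= K z)%R) -> (forall x y, K (x, y) = K (y, x)) ->
  (forall x, (0 <= f x)%R) -> (forall x, (0 <= g x)%R) ->
  kernel_form K f g = kernel_form K g f.
Proof.
move=> mf mg mK K0 Ks f0 g0; rewrite /kernel_form.
transitivity (\int[mu]_x \int[mu]_y (f x * K (x, y) * g y)%:E).
  apply: (fubini_tonelli1 (fun z => (f z.1 * K z * g z.2)%:E)); first by mfun.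
  by move=> z; rewrite lee_fin !mulr_ge0.
transitivity (\int[mu]_x \int[mu]_y (g y * K (y, x) * f x)%:E); last first.
  apply/esym; apply: (fubini_tonelli2 (fun z => (g z.1 * K z * f z.2)%:E)).
    by mfun.
  by move=> z; rewrite lee_fin !mulr_ge0.
apply: eq_integral => u _; apply: eq_integral => v _.
by congr EFin; rewrite /= Ks; ring.
Qed.

(** If K(x, y) is the integral of k(x, s) k(y, s) over s, then the form of f and g
is the integral over s of a product of averages, and 2ab <= a^2 + b^2 applies. *)
Lemma kernel_young (f g : X -> R) (K : X * X -> R) :
  measurable_fun setT f -> measurable_fun setT g -> measurable_fun setT K ->
  (forall x, (0 <= f x)%R) -> (forall x, (0 <= g x)%R) ->
  (forall z, (0 <= K z)%R) ->
  {ae (mu \x mu), forall z, (K z)%:E = \int[nu]_s (k (z.1, s) * k (z.2, s))%:E} ->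
  kernel_form K f g + kernel_form K f g <= kernel_form K f f + kernel_form K g g.
Proof.
move=> mf mg mK f0 g0 K0 KE; set B := kernel_form K.
have BE (a b : X -> R) : measurable_fun setT a -> measurable_fun setT b ->
    (forall x, (0 <= a x)%R) -> (forall x, (0 <= b x)%R) ->
    B a b = \int[nu]_s ((\int[mu]_x (a x * k (x, s))%:E) *
                        (\int[mu]_x (b x * k (x, s))%:E)).
  move=> ma mb a0 b0; rewrite -repE// /B /kernel_form /rep.
  apply: ge0_ae_eq_integral => //.
  - by mfun.
  - have := @measurable_fun_fubini_tonelli_F _ _ _ _ _ nu
      (fun w : (X * X) * S => (a w.1.1 * k (w.1.1, w.2) * (b w.1.2 * k (w.1.2, w.2)))%:E).
    by apply; [mfun|move=> w; rewrite lee_fin !mulr_ge0].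
  - by move=> z _; rewrite lee_fin !mulr_ge0.
  - by move=> z _; apply: integral_ge0 => s _; rewrite lee_fin !mulr_ge0.
  - apply: filterS KE => z Kz _.
    rewrite mulrAC EFinM Kz -ge0_integralZl//.
    + by apply: eq_integral => s _; rewrite -EFinM; congr EFin; ring.
    + by mfun.
    + by move=> s _; rewrite lee_fin mulr_ge0.
    + by rewrite lee_fin mulr_ge0.
have mI (a : X -> R) : measurable_fun setT a -> (forall x, (0 <= a x)%R) ->
    measurable_fun setT (fun s => \int[mu]_x (a x * k (x, s))%:E).
  move=> ma a0.
  have := @measurable_fun_fubini_tonelli_G _ _ _ _ _ mu
      (fun w : X * S => (a w.1 * k w)%:E).
  by apply; [mfun|move=> w; rewrite lee_fin !mulr_ge0].
pose I (a : X -> R) s := \int[mu]_x (a x * k (x, s))%:E.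
have mII (a b : X -> R) : measurable_fun setT a -> measurable_fun setT b ->
    (forall x, (0 <= a x)%R) -> (forall x, (0 <= b x)%R) ->
    measurable_fun setT (fun s => I a s * I b s).
  by move=> ma mb a0 b0; apply: emeasurable_funM; exact: mI.
have I0 (a b : X -> R) : (forall x, (0 <= a x)%R) -> (forall x, (0 <= b x)%R) ->
    forall s, setT s -> 0 <= I a s * I b s.
  by move=> a0 b0 s _; rewrite mule_ge0// ge0_sq.
rewrite (BE f g mf mg f0 g0) (BE f f mf mf f0 f0) (BE g g mg mg g0 g0).
have mfg := mII _ _ mf mg f0 g0; have mff := mII _ _ mf mf f0 f0.
have mgg := mII _ _ mg mg g0 g0.
have E1 := ge0_integralD nu measurableT (I0 _ _ f0 g0) mfg (I0 _ _ f0 g0) mfg.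
have E2 := ge0_integralD nu measurableT (I0 _ _ f0 f0) mff (I0 _ _ g0 g0) mgg.
refine (eq_rect _ (fun t => is_true (t <= _)) _ _ E1).
refine (eq_rect _ (fun t => is_true (_ <= t)) _ _ E2).
apply: ge0_le_integral => //.
- by move=> s _; rewrite adde_ge0// I0.
- exact: emeasurable_funD.
- exact: emeasurable_funD.
- by move=> s _; apply: mule_le_sqr; exact: ge0_sq.
Qed.

End kernel_young.

Section riesz_kernel.
Context {R : realType}.
Local Notation leb := (@lebesgue_measure R).
Variable a : R.
Hypothesis a0 : 0 < a.

(** With s = (l, r), this is a multiple of the indicator of u < r < u + l. A pair
(u, v) belongs to two such intervals for r in an interval of length
l - |u - v|; the power of l is dictated by scaling. *)
Definition tent (z : R * (R * R)) : R :=
  if [&& 0 < z.2.1, z.1 < z.2.2 & z.2.2 < z.1 + z.2.1]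
  then (a * (a + 1)) `^ 2^-1 * z.2.1 `^ (- (a + 2) / 2) else 0.

Lemma tent_ge0 z : 0 <= tent z.
Proof. by rewrite /tent; case: ifP => // _; rewrite mulr_ge0 ?powR_ge0. Qed.

Lemma measurable_tent : measurable_fun setT tent.
Proof. by rewrite /tent; mfun. Qed.

Lemma tent_rep u v : u != v ->
  (\int[leb \x leb]_s (tent (u, s) * tent (v, s))%:E = (`|u - v| `^ (- a))%:E)%E.
Proof.
wlog uv : u v / u < v.
  move=> H uv; have [|vu|e] := ltgtP u v; first by move=> /H; apply.
    rewrite distrC -H// 1?eq_sym//; apply: eq_integral => s _.
    by rewrite mulrC.
  by rewrite e eqxx in uv.
move=> _; pose c := a * (a + 1).
have c0 : 0 < c by rewrite /c mulr_gt0// addr_gt0.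
have D0 : 0 < v - u by lra.
have E (l r : R) : tent (u, (l, r)) * tent (v, (l, r)) =
    (c * (if 0 < l then l `^ (- a - 2) else 0)) * \1_(`]v, (u + l)[) r.
  rewrite /tent/= indicE mem_setE in_itv/=.
  have [l0|] := ltP 0 l; last by rewrite !mulr0 !mul0r.
  have [vr|] := ltP v r; last by rewrite andbF !mulr0.
  rewrite (lt_trans uv vr)/=.
  have [ru|] := ltP r (u + l); last by rewrite !mul0r mulr0.
  have -> : r < v + l by lra.
  rewrite mulr1 mulrACA -!powRD ?(gt_eqF l0) ?(gt_eqF c0) ?implybT//.
  rewrite (_ : 2^-1 + 2^-1 = 1); last by lra.
  by rewrite powRr1 ?(ltW c0)//; congr (_ * _ `^ _); lra.
rewrite (@fubini_tonelli1 _ _ (measurableTypeR R) (measurableTypeR R) R leb leb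
  (fun s => (tent (u, s) * tent (v, s))%:E))/=; last 2 first.
- have mt := measurable_tent; mfun.
- by move=> s; rewrite lee_fin mulr_ge0 ?tent_ge0.
rewrite distrC (gtr0_norm D0).
rewrite /fubini_F.
transitivity (\int[leb]_(l in `[(v - u)%R, +oo[) (c%:E * (l `^ (- a - 2) * (l - (v - u)))%:E))%E; last first.
  rewrite ge0_integralZl//; last 3 first.
  - by apply: measurable_funTS; mfun.
  - by move=> l/=; rewrite in_itv/= andbT => h; rewrite lee_fin mulr_ge0 ?powR_ge0 ?subr_ge0.
  - by rewrite lee_fin ltW.
  rewrite integral_powR_tail// -EFinM; congr EFin.
  by rewrite -/c mulrC divfK// gt_eqF.
rewrite [RHS]integral_mkcond/=.
apply: eq_integral => l _.
under eq_integral do rewrite E EFinM.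
rewrite ge0_integralZl//; last 2 first.
- by apply/measurable_EFinP; exact: measurable_indic.
- by rewrite lee_fin mulr_ge0 ?(ltW c0)//; case: ifP => // _; exact: powR_ge0.
rewrite integral_indic// setIT.
have := @lebesgue_measure_itv R `]v, (u + l)[ => /= ->; rewrite lte_fin.
rewrite patchE mem_setE in_itv/= andbT.
have [h|h] := leP (v - u) l.
- rewrite (lt_le_trans D0 h).
  have [h'|h'] := ltP v (u + l).
    rewrite -EFinD -!EFinM; congr EFin; ring.
  have -> : l - (v - u) = 0 by lra.
  by rewrite mulr0 !mule0.
- have /negbTE -> : ~~ (v < u + l) by rewrite -leNgt; lra.
  by rewrite mule0.
Qed.

Lemma diagonal_null : (leb \x leb)%E [set z : R * R | z.1 = z.2] = 0%E.
Proof.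
rewrite /product_measure1/=; apply: integral0_eq => u _.
rewrite /= (_ : xsection _ u = [set u]) ?lebesgue_measure_set1//.
apply/seteqP; split => v; rewrite /xsection/= in_setE/=; first by move=> ->.
by [].
Qed.

Definition riesz (z : R * R) : R := `|z.1 - z.2| `^ (- a).

Lemma measurable_riesz : measurable_fun setT riesz.
Proof. by rewrite /riesz; mfun. Qed.

Lemma riesz_young (f g : R -> R) :
  measurable_fun setT f -> measurable_fun setT g ->
  (forall x, 0 <= f x) -> (forall x, 0 <= g x) ->
  (kernel_form leb riesz f g + kernel_form leb riesz f g <=
   kernel_form leb riesz f f + kernel_form leb riesz g g)%E.
Proof.
move=> mf mg f0 g0; have mK := measurable_riesz.
apply: (@kernel_young _ _ (measurableTypeR R) _ R leb (sfprod leb leb) tent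
  measurable_tent tent_ge0 f g riesz mf mg mK f0 g0).
- by move=> z; exact: powR_ge0.
exists [set z : R * R | z.1 = z.2]; split.
- rewrite (_ : mkset _ = (fun z : R * R => z.1 - z.2) @^-1` [set 0]); last first.
    apply/seteqP; split => z /=; first by move=> ->; rewrite subrr.
    by move=> /eqP; rewrite subr_eq0 => /eqP.
  rewrite -[X in measurable X]setTI.
  suff : measurable_fun setT (fun z : R * R => z.1 - z.2) by apply; [|exact: measurable_set1].
  by mfun.
- exact: diagonal_null.
- move=> z/=; have [->//|zz] := eqVneq z.1 z.2.
  by move=> []; rewrite /riesz -tent_rep.
Qed.

End riesz_kernel.

(** * The energy form on space-time functions *)

Section energy.
Context {R : realType} {d : nat}.
Variables (T H : R).
Hypothesis hH : 2^-1 < H < 1.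
Local Notation E := (R * 'rV[R]_d)%type.
Local Notation leb := (@lebesgue_measure R).
Local Notation strip := (@open_strip R d T).
Local Notation t2s := (time2space_measure R d).

Lemma measurable_open_strip : measurable (strip : set (measurableTypeR R * 'rV[R]_d)).
Proof. by apply: measurableX. Qed.

Lemma measurable_H_domain :
  measurable (H_domain T : set ((measurableTypeR R * measurableTypeR R) * 'rV[R]_d)).
Proof. by apply: measurableX => //; apply: measurableX. Qed.

(** The energy form of |f| and |g|, with values in the extended reals, so that it
can be handled without finiteness assumptions. *)
Definition energy (f g : E -> R) : \bar R :=
  (\int[t2s]_(w in H_domain T) `|(H_kernel H f g w)%:E|)%E.

Definition abs_ext (f : E -> R) (z : E) : R :=
  if (0 < z.1) && (z.1 < T) then `|f z| else 0.

Lemma abs_ext_ge0 f z : 0 <= abs_ext f z.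
Proof. by rewrite /abs_ext; case: ifP. Qed.

Lemma abs_ext_in f z : strip z -> abs_ext f z = `|f z|.
Proof. by move=> [/=]; rewrite in_itv/= /abs_ext => -> _. Qed.

Lemma measurable_abs_ext f : measurable_fun strip f ->
  measurable_fun setT (abs_ext f).
Proof.
move=> mf; have -> : abs_ext f = (fun z => `|(f \_ strip) z|).
  apply/funext => z; rewrite /abs_ext patchE.
  have [zs|zs] := boolP (z \in strip).
    by move: zs; rewrite inE => -[/=]; rewrite in_itv/= => ->.
  rewrite normr0; case: ifP => // h; move: zs; rewrite notin_setE => /(_ _)[].
  by split => //=; rewrite in_itv.
apply: measurableT_comp => //.
by apply/(measurable_restrictT f) => //; exact: measurable_open_strip.
Qed.

Lemma energy_fubini f g : measurable_fun strip f -> measurable_fun strip g ->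
  energy f g = (\int[lebesgue_rV R d]_x
    kernel_form leb (riesz (2 - 2 * H)) (fun u => abs_ext f (u, x))
                                        (fun u => abs_ext g (u, x)))%E.
Proof.
move=> mf mg; rewrite /energy integral_mkcond.
have mf' := measurable_abs_ext mf; have mg' := measurable_abs_ext mg.
have mr := @measurable_riesz R (2 - 2 * H).
transitivity (\int[t2s]_w (abs_ext f (w.1.1, w.2) * riesz (2 - 2 * H) w.1 *
     abs_ext g (w.1.2, w.2))%:E)%E.
  apply: eq_integral => w _; rewrite patchE.
  have [wD|wD] := boolP (w \in H_domain T).
    move: wD; rewrite inE => -[[/= w1 w2] _].
    rewrite !abs_ext_in// /H_kernel /riesz/= !normrM.
    rewrite (ger0_norm (powR_ge0 _ _)); congr ((_ * _ `^ _ * _)%:E); lra.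
  have [h1|h1] := boolP ((0 < w.1.1) && (w.1.1 < T)); last first.
    by rewrite /abs_ext/= (negbTE h1) !mul0r.
  have [h2|h2] := boolP ((0 < w.1.2) && (w.1.2 < T)); last first.
    by rewrite /abs_ext/= (negbTE h2) !mulr0.
  move: wD; rewrite notin_setE => /(_ _)[].
  by split => //=; split => /=; rewrite in_itv.
rewrite (@fubini_tonelli2 _ _ _ _ R (sfprod leb leb) (lebesgue_rV R d)
  (fun w => (abs_ext f (w.1.1, w.2) * riesz (2 - 2 * H) w.1 *
     abs_ext g (w.1.2, w.2))%:E)%E)//.
- by mfun.
- by move=> w; rewrite lee_fin !mulr_ge0 ?abs_ext_ge0 ?powR_ge0.
Qed.

Let a0 : 0 < 2 - 2 * H. Proof. by move: hH => /andP[]; lra. Qed.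

Lemma measurable_kernel_form_ext f g :
  measurable_fun strip f -> measurable_fun strip g ->
  measurable_fun setT (fun x : 'rV[R]_d => kernel_form leb (riesz (2 - 2 * H))
    (fun u => abs_ext f (u, x)) (fun u => abs_ext g (u, x))).
Proof.
move=> mf mg.
have mf' := measurable_abs_ext mf; have mg' := measurable_abs_ext mg.
have mr := @measurable_riesz R (2 - 2 * H).
apply: (@measurable_fun_fubini_tonelli_G _ _ _ _ R (sfprod leb leb)
  (fun w : (measurableTypeR R * measurableTypeR R) * 'rV[R]_d =>
    (abs_ext f (w.1.1, w.2) * riesz (2 - 2 * H) w.1 *
     abs_ext g (w.1.2, w.2))%:E)%E).
- by mfun.
- by move=> w; rewrite lee_fin !mulr_ge0 ?abs_ext_ge0 ?powR_ge0.
Qed.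

Lemma kernel_form_ge0 (a : R) (f g : R -> R) : (forall x, 0 <= f x) -> (forall x, 0 <= g x) ->
  (0 <= kernel_form leb (riesz a) f g)%E.
Proof.
by move=> f0 g0; apply: integral_ge0 => z _; rewrite lee_fin !mulr_ge0// powR_ge0.
Qed.

(** The form is nonnegative at |f| - |g|. *)
Lemma energy_young f g : measurable_fun strip f -> measurable_fun strip g ->
  (energy f g + energy f g <= energy f f + energy g g)%E.
Proof.
move=> mf mg.
rewrite (energy_fubini mf mg) (energy_fubini mf mf) (energy_fubini mg mg).
have k0 (a b : E -> R) (x : 'rV[R]_d) : setT x -> (0 <= kernel_form leb (riesz (2 - 2 * H))
    (fun u => abs_ext a (u, x)) (fun u => abs_ext b (u, x)))%E.
  by move=> _; apply: kernel_form_ge0 => u; exact: abs_ext_ge0.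
have mfg := measurable_kernel_form_ext mf mg.
have mff := measurable_kernel_form_ext mf mf.
have mgg := measurable_kernel_form_ext mg mg.
have E1 := ge0_integralD (lebesgue_rV R d) measurableT (k0 f g) mfg (k0 f g) mfg.
have E2 := ge0_integralD (lebesgue_rV R d) measurableT (k0 f f) mff (k0 g g) mgg.
refine (eq_rect _ (fun t => is_true (t <= _)%E) _ _ E1).
refine (eq_rect _ (fun t => is_true (_ <= t)%E) _ _ E2).
apply: ge0_le_integral => //.
- by move=> x _; rewrite adde_ge0// k0.
- exact: emeasurable_funD.
- exact: emeasurable_funD.
- have mf' := measurable_abs_ext mf; have mg' := measurable_abs_ext mg.
  move=> x _; apply: riesz_young => //; try by move=> u; exact: abs_ext_ge0.
  + by mfun.
  + by mfun.
Qed.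



Lemma measurable_H_kernel (f g : E -> R) : measurable_fun strip f -> measurable_fun strip g ->
  measurable_fun (H_domain T) (H_kernel H f g).
Proof.
move=> mf mg; rewrite /H_kernel.
have mp (h : E -> R) (i : (R * R) * 'rV[R]_d -> E) : measurable_fun strip h ->
    measurable_fun setT i -> i @` H_domain T `<=` strip ->
    measurable_fun (H_domain T) (fun w => h (i w)).
  move=> mh mi iD; apply: (measurable_comp measurable_open_strip iD mh).
  exact: measurable_funTS.
have mi1 : measurable_fun setT (fun w : (R * R) * 'rV[R]_d => (w.1.1, w.2)) by mfun.
have mi2 : measurable_fun setT (fun w : (R * R) * 'rV[R]_d => (w.1.2, w.2)) by mfun.
apply: measurable_funM; [apply: measurable_funM|].
- by apply: (mp f _ mf mi1) => _ [w [[/= w1 w2] _] <-]; split.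
- apply: measurable_funTS.
  have : measurable_fun setT (fun w : (R * R) * 'rV[R]_d => `|w.1.1 - w.1.2| `^ (2 * H - 2)).
    by mfun.
  by [].
- by apply: (mp g _ mg mi2) => _ [w [[/= w1 w2] _] <-]; split.
Qed.

Lemma H_kernel_integrable_energy (f g : E -> R) : measurable_fun strip f -> measurable_fun strip g ->
  (energy f g < +oo)%E <-> t2s.-integrable (H_domain T) (EFin \o H_kernel H f g).
Proof.
move=> mf mg; split.
  move=> h; apply/integrableP; split => //.
  by apply/measurable_EFinP; exact: measurable_H_kernel.
by move=> /integrableP[].
Qed.

Lemma H_finiteP (f : E -> R) :
  H_finite T H f <-> measurable_fun strip f /\ (energy f f < +oo)%E.
Proof.
by split => -[mf]; rewrite H_kernel_integrable_energy.
Qed.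

Lemma energy_ge0 (f g : E -> R) : (0 <= energy f g)%E.
Proof. by apply: integral_ge0 => w _; rewrite lee_fin. Qed.

Lemma H_kernel_integrable (f g : E -> R) : H_finite T H f -> H_finite T H g ->
  t2s.-integrable (H_domain T) (EFin \o H_kernel H f g).
Proof.
move=> /H_finiteP[mf ff] /H_finiteP[mg gg].
apply/H_kernel_integrable_energy => //.
apply: (@le_lt_trans _ _ (energy f g + energy f g)%E).
  by rewrite leeDl// energy_ge0.
apply: le_lt_trans (energy_young mf mg) _.
by rewrite lte_add_pinfty.
Qed.

Lemma H_finite_comb (c : R) (f g : E -> R) : H_finite T H f -> H_finite T H g ->
  H_finite T H (fun z => f z + c * g z).
Proof.
move=> Hf Hg; split.
  apply: measurable_funD; first by case: Hf.
  by apply: measurable_funM => //; case: Hg.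
have i1 := H_kernel_integrable Hf Hf; have i2 := H_kernel_integrable Hf Hg.
have i3 := H_kernel_integrable Hg Hf; have i4 := H_kernel_integrable Hg Hg.
have mD := measurable_H_domain.
have := integrableD mD (integrableD mD i1 (integrableZl mD c i2))
  (integrableD mD (integrableZl mD c i3) (integrableZl mD (c ^+ 2) i4)).
apply: eq_integrable => // w _.
by rewrite /= /H_kernel /= -!EFinM -!EFinD; congr EFin; ring.
Qed.

Lemma H_finiteB (f g : E -> R) : H_finite T H f -> H_finite T H g -> H_finite T H (f \- g).
Proof.
move=> Hf Hg; have := H_finite_comb (-1) Hf Hg.
by congr H_finite; apply/funext => z /=; ring.
Qed.

Lemma H_inner_combl (c : R) (f g h : E -> R) : H_finite T H f -> H_finite T H g -> H_finite T H h ->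
  H_inner T H (fun z => f z + c * g z) h = H_inner T H f h + c * H_inner T H g h.
Proof.
move=> Hf Hg Hh.
have i1 := H_kernel_integrable Hf Hh; have i2 := H_kernel_integrable Hg Hh.
have mD := measurable_H_domain.
rewrite /H_inner [c * _]mulrCA -mulrDr; congr (_ * _).
rewrite -RintegralZl// -RintegralD//; last exact: (integrableZl mD c i2).
by apply: eq_Rintegral => w _; rewrite /H_kernel/=; ring.
Qed.

Lemma H_inner_combr (c : R) (f g h : E -> R) : H_finite T H f -> H_finite T H g -> H_finite T H h ->
  H_inner T H h (fun z => f z + c * g z) = H_inner T H h f + c * H_inner T H h g.
Proof.
move=> Hf Hg Hh.
have i1 := H_kernel_integrable Hh Hf; have i2 := H_kernel_integrable Hh Hg.
have mD := measurable_H_domain.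
rewrite /H_inner [c * _]mulrCA -mulrDr; congr (_ * _).
rewrite -RintegralZl// -RintegralD//; last exact: (integrableZl mD c i2).
by apply: eq_Rintegral => w _; rewrite /H_kernel/=; ring.
Qed.

Lemma alphaH_gt0 : 0 < H * (2 * H - 1).
Proof. by move: hH => /andP[h1 h2]; rewrite mulr_gt0//; lra. Qed.

Lemma H_inner_energy (f g : E -> R) : (forall z, 0 <= f z) -> (forall z, 0 <= g z) ->
  H_inner T H f g = H * (2 * H - 1) * fine (energy f g).
Proof.
move=> f0 g0; rewrite /H_inner /Rintegral /energy; congr (_ * fine _).
by apply: eq_integral => w _; rewrite gee0_abs// lee_fin /H_kernel !mulr_ge0 ?powR_ge0.
Qed.

Lemma energy_sym (f g : E -> R) : measurable_fun strip f -> measurable_fun strip g ->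
  energy f g = energy g f.
Proof.
move=> mf mg; rewrite (energy_fubini mf mg) (energy_fubini mg mf).
have mf' := measurable_abs_ext mf; have mg' := measurable_abs_ext mg.
have mr := @measurable_riesz R (2 - 2 * H).
apply: eq_integral => x _.
apply: (@kernel_form_sym _ (measurableTypeR R) R leb) => //.
- by mfun.
- by mfun.
- by move=> z; exact: powR_ge0.
- by move=> u v; rewrite /riesz distrC.
- by move=> u; exact: abs_ext_ge0.
- by move=> u; exact: abs_ext_ge0.
Qed.

Lemma H_finite_norm (f g : E -> R) : measurable_fun strip f -> H_finite T H g ->
  (forall z, `|f z| <= `|g z|) -> H_finite T H f.
Proof.
move=> mf [mg ig] fg; split => //.
apply: le_integrable ig => //; first exact: measurable_H_domain.
  by apply/measurable_EFinP; exact: measurable_H_kernel.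
move=> w _; rewrite /= lee_fin /H_kernel !normrM.
by rewrite ler_pM ?mulr_ge0// ler_pM// fg.
Qed.

Lemma H_finite_pos (f : E -> R) : H_finite T H f -> H_finite T H (fun z => Num.max (f z) 0).
Proof.
move=> Hf; apply: H_finite_norm (Hf) _; first by apply: measurable_maxr => //; case: Hf.
by move=> z; rewrite /Num.max; case: ifPn => // _; rewrite normr0.
Qed.

Lemma H_finite_neg (f : E -> R) : H_finite T H f -> H_finite T H (fun z => Num.max (- f z) 0).
Proof.
move=> Hf; apply: H_finite_norm (Hf) _.
  by apply: measurable_maxr => //; apply: measurable_funN; case: Hf.
by move=> z; rewrite /Num.max; case: ifPn; rewrite ?normr0 ?normrN.
Qed.

Lemma pos_neg_decomp (f : E -> R) : f = fun z => Num.max (f z) 0 + (-1) * Num.max (- f z) 0 :> R.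
Proof.
apply/funext => z; rewrite /Num.max; by case: ltP => ?; case: ltP => ?; lra.
Qed.

Let nneg0 (f : E -> R) : forall z, 0 <= Num.max (f z) 0.
Proof. by move=> z; rewrite le_max lexx orbT. Qed.

Lemma H_inner_sym (f g : E -> R) : H_finite T H f -> H_finite T H g ->
  H_inner T H f g = H_inner T H g f.
Proof.
move=> Hf Hg.
have s0 (a b : E -> R) : H_finite T H a -> H_finite T H b ->
   (forall z, 0 <= a z) -> (forall z, 0 <= b z) ->
   H_inner T H a b = H_inner T H b a.
  by move=> [ma _] [mb _] a0' b0; rewrite !H_inner_energy// energy_sym.
have fp := H_finite_pos Hf; have fn := H_finite_neg Hf.
have gp := H_finite_pos Hg; have gn := H_finite_neg Hg.
rewrite (pos_neg_decomp f) (pos_neg_decomp g).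
have Hf' := H_finite_comb (-1) fp fn; have Hg' := H_finite_comb (-1) gp gn.
rewrite !H_inner_combl// !H_inner_combr//.
have := s0 _ _ fp gp (nneg0 _) (nneg0 _); have := s0 _ _ fp gn (nneg0 _) (nneg0 _).
have := s0 _ _ fn gp (nneg0 _) (nneg0 _); have := s0 _ _ fn gn (nneg0 _) (nneg0 _).
by move=> -> -> -> ->; ring.
Qed.

(** On the positive and negative parts of f this is [energy_young]. *)
Lemma H_inner_ge0 (f : E -> R) : H_finite T H f -> 0 <= H_inner T H f f.
Proof.
move=> Hf; rewrite (pos_neg_decomp f).
have := H_finite_pos Hf; have := H_finite_neg Hf.
set p := fun z => Num.max (f z) 0; set n := fun z => Num.max (- f z) 0.
have p0 : forall z, 0 <= p z by exact: nneg0.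
have n0 : forall z, 0 <= n z by exact: nneg0.
move=> Hn Hp; have Hf' := H_finite_comb (-1) Hp Hn.
rewrite !H_inner_combl// !H_inner_combr// (H_inner_sym Hn Hp) !H_inner_energy//.
move/H_finiteP : (Hp) => [mp ep]; move/H_finiteP : (Hn) => [mn en].
have := energy_young mp mn.
have epn : (energy p n < +oo)%E.
  by apply/H_kernel_integrable_energy => //; exact: H_kernel_integrable.
have F a b : (energy a b < +oo)%E -> energy a b = (fine (energy a b))%:E.
  by move=> h; rewrite fineK// ge0_fin_numE// energy_ge0.
rewrite (F _ _ ep) (F _ _ en) (F _ _ epn) -!EFinD lee_fin.
have := alphaH_gt0; move: (fine _) (fine _) (fine _) (H * _) => A B C al al0 h.
rewrite /=; have -> : al * B + -1 * (al * C) + -1 * (al * C + -1 * (al * A)) = al * (B + A - (C + C)).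
  by ring.
by rewrite mulr_ge0 ?(ltW al0)// subr_ge0.
Qed.

End energy.

(** * Smooth bumps *)

Section flat_function.
Context {R : realType}.

(** A family containing exp(-1/x) that is stable under differentiation, up to
linear combinations. *)
Definition flat (k : nat) (x : R) : R :=
  if 0 < x then x^-1 ^+ k * expR (- x^-1) else 0.

Lemma flat_ge0 k x : 0 <= flat k x.
Proof.
rewrite /flat; case: ifPn => // x0.
by rewrite mulr_ge0 ?expR_ge0// exprn_ge0// invr_ge0 ltW.
Qed.

Lemma flat_le (k : nat) (x : R) : flat k x <= k.+1%:R ^+ k.+1 * `|x|.
Proof.
rewrite /flat; case: ifPn => [x0|_]; last by rewrite mulr_ge0// exprn_ge0.
rewrite (gtr0_norm x0); set y := x^-1; have y0 : 0 < y by rewrite invr_gt0.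
set K : R := k.+1%:R; have k0 : 0 < K by [].
rewrite expRN ler_pdivrMr ?expR_gt0//.
have -> : expR y = expR (y / K) ^+ k.+1.
  by rewrite -expRM_natl mulrC divfK ?gt_eqF.
have {1}-> : y ^+ k = K ^+ k.+1 * x * (y / K) ^+ k.+1.
  rewrite expr_div_n mulrAC [_ * (_ / _)]mulrC divfK ?expf_neq0 ?gt_eqF//.
  by rewrite exprSr -mulrA mulVf ?mulr1 ?gt_eqF.
rewrite ler_pM2l ?mulr_gt0 ?exprn_gt0//.
apply: lerXn2r; rewrite ?nnegrE ?expR_ge0 ?divr_ge0 ?(ltW y0)//.
by apply: le_trans (expR_ge1Dx _); rewrite lerDr.
Qed.

Lemma is_derive_flat k (x : R) :
  is_derive x 1 (flat k) (- k%:R * flat k.+1 x + flat k.+2 x).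
Proof.
have [x0|x0|->] := ltgtP x 0.
- rewrite /flat [0 < x]ltNge (ltW x0)/= mulr0 addr0.
  apply: (@near_eq_is_derive _ _ _ (cst 0)).
  near=> y; rewrite /= ltNge.
  suff -> : y <= 0 by [].
  by apply: ltW; near: y; exact: lt_nbhsl.
- rewrite /flat x0/=.
  apply: (@near_eq_is_derive _ _ _ (fun y : R => y^-1 ^+ k * expR (- y^-1))).
  + near=> y; suff -> : 0 < y by [].
    by near: y; exact: lt_nbhsr.
  + have xn : x != 0 by rewrite gt_eqF.
    have D := @is_deriveV R id x 1 1 xn (is_derive_id _ _).
    have DX := is_deriveX k D.
    have De : is_derive x 1 (expR \o (fun y : R => - y^-1)) (expR (- x^-1) * (- (- x ^- 2 *: 1))).
      by apply: is_derive1_comp; apply: is_deriveN.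
    have -> : (fun y : R => y^-1 ^+ k * expR (- y^-1)) =
        (fun y : R => y^-1) ^+ k * (expR \o (fun y : R => - y^-1)).
      by rewrite exprfctE.
    apply: (is_derive_eq (is_deriveM DX De)); rewrite exprfctE.
    rewrite /GRing.scale/= mulr1; case: k {DX} => [|k].
      by rewrite !mul0r mulr0 addr0 oppr0 mul0r add0r mul1r opprK -exprVn mulrC expr2.
    by rewrite -!exprVn /= !exprSr; ring.
- have f0 j : flat j 0 = 0 by rewrite /flat ltxx.
  rewrite !f0 mulr0 addr0.
  have F : (h^-1 *: ((flat k \o shift 0) (h *: 1) - flat k 0)) @[h --> 0^'] --> (0 : R).
    apply/cvgrPdist_le => /= e e0.
    pose K : R := k.+2%:R ^+ k.+2.
    have K0 : 0 < K by rewrite exprn_gt0.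
    near=> h; rewrite /= addr0 /GRing.scale/= mulr1 sub0r normrN.
    rewrite f0 subr0.
    have -> : h^-1 * flat k h = flat k.+1 h.
      rewrite /flat; case: ifPn => h0; last by rewrite mulr0.
      by rewrite exprS mulrA.
    rewrite (ger0_norm (flat_ge0 _ _)); apply: le_trans (flat_le _ _) _.
    rewrite -/K -ler_pdivlMl// mulrC.
    near: h; apply: dnbhs0_le; by rewrite divr_gt0.
  apply: DeriveDef; last exact/cvg_lim.
  by apply/cvg_ex; exists 0.
Unshelve. all: by end_near. Qed.

Lemma continuous_flat k : continuous (flat k).
Proof.
move=> x; apply/differentiable_continuous/derivable1_diffP.
by have [] := is_derive_flat k x.
Qed.

Lemma flat_gt0 k x : (0 < flat k x) = (0 < x).
Proof.
rewrite /flat; case: ifPn => x0; last by rewrite ltxx.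
by rewrite mulr_gt0 ?expR_gt0// exprn_gt0// invr_gt0.
Qed.

Lemma flat0_le1 x : flat 0 x <= 1.
Proof.
rewrite /flat; case: ifPn => // x0; rewrite expr0 mul1r -expR0 ler_expR.
by rewrite oppr_le0 invr_ge0 ltW.
Qed.

Lemma flat0_cvg (x : R) : flat 0 (n.+1%:R * x) @[n --> \oo] --> ((0 < x)%R%:R : R).
Proof.
have [x0|x0] := ltP 0 x; last first.
  apply: (@cvg_trans _ (cst (0 : R) @ \oo)); last exact: cvg_cst.
  apply: near_eq_cvg; near=> n; rewrite /flat/= ltNge.
  by rewrite (_ : _ * x <= 0)// mulr_ge0_le0.
rewrite (_ : (fun n => _) = fun n => expR (- (n.+1%:R^-1 * x^-1))); last first.
  by apply/funext => n; rewrite /flat mulr_gt0// expr0 mul1r invfM.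
have L : - (n.+1%:R^-1 * x^-1) @[n --> \oo] --> (0 : R).
  rewrite -[X in _ --> X]oppr0; apply: cvgN; rewrite -(mul0r x^-1).
  by apply: cvgMr_tmp; exact: cvg_harmonic.
have := cvg_comp _ _ L (@continuous_expR R 0).
by rewrite expR0.
Unshelve. all: by end_near. Qed.

End flat_function.

Section bumps.
Context {R : realType} {d : nat}.
Local Notation E := (R * 'rV[R]_d)%type.

(** A function all of whose directional derivatives of order at most n exist
and are continuous; unlike [smooth], this is amenable to induction on n. *)
Fixpoint diff_upto (n : nat) (f : E -> R) : Prop :=
  [/\ continuous f, forall z v, derivable f z v &
    if n is m.+1 then forall v, diff_upto m ('D_v f) else True].

Lemma diff_upto_cont n f : diff_upto n f -> continuous f.
Proof. by case: n => [|n] []. Qed.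

Lemma diff_upto_der n f : diff_upto n f -> forall z v, derivable f z v.
Proof. by case: n => [|n] []. Qed.

Lemma diff_upto_derive n f v : diff_upto n.+1 f -> diff_upto n ('D_v f).
Proof. by move=> [_ _]; apply. Qed.

Lemma diff_upto0 f : continuous f -> (forall z v, derivable f z v) -> diff_upto 0 f.
Proof. by []. Qed.

Lemma diff_uptoS n f : diff_upto 0 f -> (forall v, diff_upto n ('D_v f)) ->
  diff_upto n.+1 f.
Proof. by case. Qed.

Lemma diff_upto_smooth f : (forall n, diff_upto n f) -> smooth f.
Proof.
move=> hf vs.
have h n : diff_upto n (foldr (fun v h => 'D_v h) f vs).
  by elim: vs n => [//|v vs IH] n; exact/diff_upto_derive/IH.
by split; [exact: diff_upto_cont (h 0%N)|exact: diff_upto_der (h 0%N)].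
Qed.

Lemma diff_uptoW n f : diff_upto n.+1 f -> diff_upto n f.
Proof.
elim: n f => [|n IH] f hf; first by case: hf.
apply: diff_uptoS; first by case: hf.
by move=> v; apply: IH; exact: diff_upto_derive.
Qed.

Lemma diff_upto_cst n (c : R) : diff_upto n (cst c).
Proof.
have h0 (b : R) : diff_upto 0 (cst b).
  by apply: diff_upto0 => [z|z v]; [exact: cvg_cst|exact: derivable_cst].
elim: n c => [//|n IH] c; apply: diff_uptoS => // v.
by rewrite (_ : 'D_v _ = cst 0)//; apply/funext => z; exact: derive_cst.
Qed.

Lemma diff_uptoD n f g : diff_upto n f -> diff_upto n g -> diff_upto n (f \+ g).
Proof.
have h0 k a b : diff_upto k a -> diff_upto k b -> diff_upto 0 (a \+ b).
  move=> ha hb; apply: diff_upto0 => [z|z v].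
    by apply: cvgD; [exact: (diff_upto_cont ha)|exact: (diff_upto_cont hb)].
  by apply: derivableD; [exact: (diff_upto_der ha)|exact: (diff_upto_der hb)].
elim: n f g => [|n IH] f g hf hg; first exact: (h0 0%N).
apply: diff_uptoS; first exact: h0 hf hg.
move=> v; rewrite (_ : 'D_v _ = 'D_v f \+ 'D_v g).
  by apply: IH; exact: diff_upto_derive.
by apply/funext => z; apply: deriveD; [exact: (diff_upto_der hf)|exact: (diff_upto_der hg)].
Qed.

Lemma diff_uptoM n f g : diff_upto n f -> diff_upto n g ->
  diff_upto n (fun z => f z * g z).
Proof.
have h0 k a b : diff_upto k a -> diff_upto k b -> diff_upto 0 (fun z => a z * b z).
  move=> ha hb; apply: diff_upto0 => [z|z v].
    by apply: cvgM; [exact: (diff_upto_cont ha)|exact: (diff_upto_cont hb)].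
  by apply: derivableM; [exact: (diff_upto_der ha)|exact: (diff_upto_der hb)].
elim: n f g => [|n IH] f g hf hg; first exact: (h0 0%N).
apply: diff_uptoS; first exact: h0 hf hg.
move=> v; rewrite (_ : 'D_v _ = (fun z => f z * 'D_v g z) \+ (fun z => g z * 'D_v f z)).
  by apply: diff_uptoD; apply: IH; try exact: diff_upto_derive; exact: diff_uptoW.
by apply/funext => z; apply: deriveM; [exact: (diff_upto_der hf)|exact: (diff_upto_der hg)].
Qed.

Lemma diff_upto_prod n (I : Type) (s : seq I) (F : I -> E -> R) :
  (forall i, diff_upto n (F i)) -> diff_upto n (fun z => \prod_(i <- s) F i z).
Proof.
move=> hF; elim: s => [|i s IH].
  rewrite (_ : (fun z => _) = cst 1); first exact: diff_upto_cst.
  by apply/funext => z; rewrite big_nil.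
rewrite (_ : (fun z => _) = fun z => F i z * \prod_(j <- s) F j z).
  exact: diff_uptoM.
by apply/funext => z; rewrite big_cons.
Qed.

(** The time coordinate has index None. *)
Definition coord (i : option 'I_d) (z : E) : R :=
  if i is Some j then z.2 ord0 j else z.1.

Lemma coordD i (z w : E) : coord i (z + w) = coord i z + coord i w.
Proof. by case: i => [j|]//=; rewrite mxE. Qed.

Lemma coordZ i (c : R) (z : E) : coord i (c *: z) = c * coord i z.
Proof. by case: i => [j|]//=; rewrite mxE. Qed.

Lemma continuous_coord i : continuous (coord i).
Proof.
case: i => [j|] z /=; last exact: cvg_fst.
apply: (@continuous_comp _ _ _ snd (fun M : 'rV[R]_d => M ord0 j)).
  exact: cvg_snd.
exact: coord_continuous.
Qed.

Lemma measurable_coordE i : measurable_fun setT (coord i).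
Proof. by case: i => [j|]; rewrite /coord; mfun. Qed.

Lemma is_derive_flat_coord (c b : R) i k (z v : E) :
  is_derive z v (fun z => flat k (c * coord i z + b))
   (c * coord i v * (- k%:R * flat k.+1 (c * coord i z + b) + flat k.+2 (c * coord i z + b))).
Proof.
set x := c * coord i z + b; set m := c * coord i v.
have D1 := is_derive_flat k x.
have E1 : (fun h : R => h^-1 *: (((fun z => flat k (c * coord i z + b)) \o shift z) (h *: v)
      - flat k x)) = (fun h : R => h^-1 *: ((flat k \o shift x) (h *: m) - flat k x)).
  apply/funext => h; congr (_ *: (flat k _ - _)).
  by rewrite /= coordD coordZ /x /m /GRing.scale/=; ring.
have dm : derivable (flat k) x m.
  by apply: diff_derivable; apply/derivable1_diffP; case: D1.
have Dm : 'D_m (flat k) x = m * (- k%:R * flat k.+1 x + flat k.+2 x).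
  have df : differentiable (flat k) x by apply/derivable1_diffP; case: D1.
  have [_ <-] := D1; rewrite !deriveE//.
  by rewrite -[m in LHS]mulr1 -[m * 1]/(m *: (1 : R^o)) linearZ.
apply: DeriveDef.
- by move: dm; rewrite /derivable E1.
- by move: Dm; rewrite /derive E1.
Qed.

Lemma diff_upto_flat n (c b : R) i k : diff_upto n (fun z => flat k (c * coord i z + b)).
Proof.
have h0 j : diff_upto 0 (fun z => flat j (c * coord i z + b)).
  apply: diff_upto0 => [z|z v]; last by have [] := is_derive_flat_coord c b i j z v.
  apply: (@continuous_comp _ _ _ (fun z => c * coord i z + b) (flat j)).
    by apply: cvgD; [apply: cvgMl_tmp; exact: continuous_coord|exact: cvg_cst].
  exact: continuous_flat.
elim: n k => [//|n IH] k; apply: diff_uptoS => //.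
move=> v; rewrite (_ : 'D_v _ = (fun z => c * coord i v * ((- k%:R) * flat k.+1 (c * coord i z + b)
   + flat k.+2 (c * coord i z + b)))).
  apply: diff_uptoM; first exact: diff_upto_cst.
  apply: diff_uptoD => //.
  by apply: diff_uptoM => //; exact: diff_upto_cst.
by apply/funext => z; have [_ ->] := is_derive_flat_coord c b i k z v.
Qed.

Definition box (l u : option 'I_d -> R) : set E :=
  [set z | forall i, l i < coord i z < u i].

Definition closed_box (l u : option 'I_d -> R) : set E :=
  [set z | forall i, l i <= coord i z <= u i].

(** Increases to the indicator of the box as n grows. *)
Definition bump (n : nat) (l u : option 'I_d -> R) (z : E) : R :=
  \prod_(i : option 'I_d) (flat 0 (n.+1%:R * (coord i z - l i)) *
                           flat 0 (n.+1%:R * (u i - coord i z))).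

Lemma bump_ge0 n l u z : 0 <= bump n l u z.
Proof. by apply: prodr_ge0 => i _; rewrite mulr_ge0// flat_ge0. Qed.

Lemma bump_le1 n l u z : bump n l u z <= 1.
Proof.
apply: prodr_ile1 => i _; rewrite mulr_ge0 ?flat_ge0//=.
by rewrite mulr_ile1 ?flat_ge0 ?flat0_le1.
Qed.

Lemma bump_gt0 n l u z : box l u z -> 0 < bump n l u z.
Proof.
move=> bz; apply: prodr_gt0 => i _; have /andP[h1 h2] := bz i.
by rewrite mulr_gt0// flat_gt0 mulr_gt0// subr_gt0.
Qed.

Lemma bump_eq0 n l u z : ~ box l u z -> bump n l u z = 0.
Proof.
move=> bz; apply/eqP/prodf_eq0; apply: contrapT => h; apply: bz => i.
apply: contrapT => hi; apply: h; exists i => //.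
move/negP: hi; rewrite negb_and -!leNgt => /orP[h|h].
  rewrite (_ : flat 0 (n.+1%:R * (coord i z - l i)) = 0) ?mul0r//.
  by rewrite /flat ltNge mulr_ge0_le0// subr_le0.
rewrite (_ : flat 0 (n.+1%:R * (u i - coord i z)) = 0) ?mulr0//.
by rewrite /flat ltNge mulr_ge0_le0// subr_le0.
Qed.

Lemma diff_upto_bump k n l u : diff_upto k (bump n l u).
Proof.
apply: diff_upto_prod => i; apply: diff_uptoM.
  rewrite (_ : (fun z => _) = fun z => flat 0 (n.+1%:R * coord i z + (- (n.+1%:R * l i)))).
    exact: diff_upto_flat.
  by apply/funext => z; congr (flat 0 _); ring.
rewrite (_ : (fun z => _) = fun z => flat 0 (- n.+1%:R * coord i z + n.+1%:R * u i)).
  exact: diff_upto_flat.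
by apply/funext => z; congr (flat 0 _); ring.
Qed.

Lemma smooth_bump n l u : smooth (bump n l u).
Proof. by apply: diff_upto_smooth => k; exact: diff_upto_bump. Qed.

Lemma closed_box_compact l u : compact (closed_box l u).
Proof.
have -> : closed_box l u = `[l None, u None]%classic `*`
    [set v : 'rV[R]_d | forall i, `[l (Some i), u (Some i)]%classic (v ord0 i)].
  apply/seteqP; split => [z bz|z [/= b1 b2] [j|]].
  - split => /=; first by have := bz None; rewrite in_itv/=.
    by move=> i; have := bz (Some i); rewrite /= in_itv/=.
  - by have := b2 j; rewrite /= in_itv/=.
  - by move: b1; rewrite in_itv/=.
apply: compact_setX; first exact: segment_compact.
apply: (@rV_compact R d (fun i => `[l (Some i), u (Some i)]%classic)) => i.
exact: segment_compact.
Qed.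

Lemma closed_closed_box l u : closed (closed_box l u).
Proof.
have -> : closed_box l u = \bigcap_(i in setT) (coord i @^-1` `[l i, u i]%classic).
  apply/seteqP; split => [z bz i _|z bz i]; first by rewrite /= in_itv/=; exact: bz.
  by have := bz i I; rewrite /= in_itv.
apply: closed_bigI => i _; apply: closed_comp => [z _|]; first exact: continuous_coord.
exact: itv_closed.
Qed.

Lemma bump_support n l u : closure [set z | bump n l u z != 0] `<=` closed_box l u.
Proof.
rewrite [X in _ `<=` X](_ : _ = closure (closed_box l u)).
  apply: closure_subset => z /= bz i.
  have [h|h] := pselect (box l u z); last by rewrite bump_eq0 ?eqxx in bz.
  by have /andP[/ltW -> /ltW ->] := h i.
by apply/closure_id; exact: closed_closed_box.
Qed.

Lemma test_function_bump (T : R) n (l u : option 'I_d -> R) : 0 < l None -> u None < T ->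
  test_function (@open_strip R d T) (bump n l u).
Proof.
move=> l0 uT; split; first exact: smooth_bump.
- apply: (@subclosed_compact _ _ (closed_box l u)).
  + exact: closed_closure.
  + exact: closed_box_compact.
  + exact: bump_support.
- move=> z /bump_support bz; split => //=.
  have /andP[/= h1 h2] := bz None.
  by rewrite in_itv/= (lt_le_trans l0 h1) (le_lt_trans h2 uT).
Qed.

Lemma bump_cvg l u z : bump n l u z @[n --> \oo] --> (\1_(box l u) z : R).
Proof.
have -> : (\1_(box l u) z : R) = \prod_(i : option 'I_d) ((0 < coord i z - l i)%R%:R * (0 < u i - coord i z)%R%:R).
  rewrite indicE; have [bz|bz] := boolP (z \in box l u).
    rewrite big1// => i _; move: bz; rewrite inE => /(_ i)/andP[h1 h2].
    by rewrite !subr_gt0 h1 h2 mulr1.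
  apply/esym/eqP/prodf_eq0; apply: contrapT => h; move: bz; rewrite notin_setE; apply => i.
  apply/negPn/negP => hi; apply: h; exists i => //; move: hi.
  by rewrite !subr_gt0 mulf_eq0 !pnatr_eq0 !eqb0 negb_and.
rewrite /bump; elim: (index_enum _) => [|i s IH].
  under eq_fun do rewrite big_nil.
  by rewrite big_nil; exact: cvg_cst.
under eq_fun do rewrite big_cons.
rewrite big_cons; apply: cvgM => //.
by apply: cvgM; exact: flat0_cvg.
Qed.

End bumps.

(** * The Borel structure of space-time *)

Section borel_spacetime.
Context {R : realType} {d : nat}.
Local Notation E := (R * 'rV[R]_d)%type.
Local Notation mE := (measurableTypeR R * 'rV[R]_d)%type.
Local Notation leb := (@lebesgue_measure R).

Lemma measurable_box (l u : option 'I_d -> R) : measurable (box l u : set mE).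
Proof.
have -> : box l u = \bigcap_(i in [set: option 'I_d]) (coord i @^-1` `]l i, u i[%classic).
  apply/seteqP; split => [z bz i _|z bz i]; first by rewrite /= in_itv/=; exact: bz.
  by have := bz i I; rewrite /= in_itv.
apply: fin_bigcap_measurable => //.
move=> i _; rewrite -[X in measurable X]setTI; exact: (@measurable_coordE R d i).
Qed.

Definition boxes : set (set E) := [set A | exists l u, A = box l u].

Lemma boxes_setI : setI_closed boxes.
Proof.
move=> _ _ [l [u ->]] [l' [u' ->]].
exists (fun i => Num.max (l i) (l' i)), (fun i => Num.min (u i) (u' i)).
apply/seteqP; split => [z [b1 b2] i|z bz].
  have /andP[h1 h2] := b1 i; have /andP[h3 h4] := b2 i.
  by rewrite gt_max lt_min h1 h2 h3 h4.
by split => i; have := bz i; rewrite gt_max lt_min => /andP[/andP[h1 h2] /andP[h3 h4]]; apply/andP.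
Qed.

Lemma measurable_coord_boxes i :
  measurable_fun setT (coord i : g_sigma_algebraType boxes -> R).
Proof.
apply: (@measurability _ _ (g_sigma_algebraType boxes) (measurableTypeR R) setT
  (coord i) _ (RGenOpens.measurableE R)).
move=> _ [_ [a [b ->]] <-]; rewrite setTI.
have -> : coord i @^-1` `]a, b[ = \bigcup_n (box
    (fun j => if j == i then a else - n%:R) (fun j => if j == i then b else n%:R)).
  apply/seteqP; split => [z /=|z [n _ bz]].
    rewrite in_itv/= => zab.
    pose M := \sum_j `|coord j z|.
    exists (Num.truncn M).+1 => // j; case: eqP => [->//|_].
    rewrite -ltr_norml; apply: le_lt_trans (truncnS_gt M).
    rewrite /M (bigD1 j)//= lerDl; exact: sumr_ge0.
  by have := bz i; rewrite eqxx /= in_itv.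
apply: bigcupT_measurable => n; apply: sub_sigma_algebra.
by do 2 eexists; reflexivity.
Qed.

(** The boxes form a pi-system, to which Dynkin's theorem will be applied. *)
Lemma measurable_spacetimeE : @measurable _ mE = <<s boxes >>.
Proof.
apply/seteqP; split; last first.
  apply: smallest_sub; first exact: sigma_algebra_measurable.
  by move=> _ [l [u ->]]; exact: measurable_box.
move=> A mA.
have : measurable_fun setT (id : g_sigma_algebraType boxes -> mE).
  apply/measurable_fun_pairP; split; first exact: (measurable_coord_boxes None).
  by apply: measurable_fun_rVP => i; exact: (measurable_coord_boxes (Some i)).
by move=> /(_ measurableT A mA); rewrite setTI preimage_id.
Qed.

Definition qbox (c : {ffun option 'I_d -> rat} * {ffun option 'I_d -> rat}) : set E :=
  box (fun i => ratr (c.1 i)) (fun i => ratr (c.2 i)).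

(** Countably many boxes form a base of the topology, so that the sigma-algebra,
which is defined from coordinates, contains the open sets. *)
Lemma nbhs_qbox (z : E) (U : set E) : nbhs z U ->
  exists c, qbox c z /\ qbox c `<=` U.
Proof.
move=> /nbhs_ballP[e /= e0 zU].
have ratl (x : R) : exists q : rat, x - e < ratr q < x.
  have [|q] := @rat_in_itvoo R (x - e) x; first by rewrite ltrBlDr ltrDl.
  by rewrite in_itv/= => h; exists q.
have ratu (x : R) : exists q : rat, x < ratr q < x + e.
  have [|q] := @rat_in_itvoo R x (x + e); first by rewrite ltrDl.
  by rewrite in_itv/= => h; exists q.
pose l := [ffun i => xchoose (ratl (coord i z))].
pose u := [ffun i => xchoose (ratu (coord i z))].
exists (l, u); split.
  move=> i; rewrite /= !ffunE.
  have /andP[_ ->] := xchooseP (ratl (coord i z)).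
  by have /andP[-> _] := xchooseP (ratu (coord i z)).
move=> w bw; apply: zU.
have h i : `|coord i z - coord i w| < e.
  have := bw i; rewrite /= !ffunE => /andP[h1 h2].
  have /andP[h3 _] := xchooseP (ratl (coord i z)).
  have /andP[_ h4] := xchooseP (ratu (coord i z)).
  by rewrite ltr_norml; apply/andP; split; lra.
split; first exact: (h None).
by split => // i j; rewrite (ord1 i); exact: (h (Some j)).
Qed.

Lemma open_measurable_spacetime (U : set E) : open U -> measurable (U : set mE).
Proof.
move=> oU.
have -> : U = \bigcup_c (if `[< qbox c `<=` U >] then qbox c else set0).
  apply/seteqP; split => [z Uz|z [c _]]; last by case: asboolP => // cU /cU.
  have [c [cz cU]] := nbhs_qbox (open_nbhs_nbhs (conj oU Uz)).
  by exists c => //; case: asboolP.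
apply: countable_bigcupT_measurable => // c.
by case: ifP => // _; exact: measurable_box.
Qed.

Lemma continuous_measurable_spacetime (f : E -> R) : continuous f ->
  measurable_fun (setT : set mE) f.
Proof.
move=> cf; apply: (@measurability _ _ mE (measurableTypeR R) setT f _ (RGenOpens.measurableE R)).
move=> _ [_ [a [b ->]] <-]; rewrite setTI.
apply: open_measurable_spacetime; apply: open_comp => [z _|]; first exact: cf.
exact: interval_open.
Qed.

Lemma closed_measurable_spacetime (K : set E) : closed K -> measurable (K : set mE).
Proof.
by move=> cK; rewrite -[K]setCK; apply: measurableC; apply: open_measurable_spacetime; exact: closed_openC.
Qed.

Definition cube n (M : R) : set 'rV[R]_n := [set v | forall i, `|v ord0 i| < M].

Lemma measurable_cube n M : measurable (@cube n M).
Proof.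
case: n => [|n].
  by rewrite (_ : cube M = setT)//; apply/seteqP; split => // v _ [].
have -> : @cube n.+1 M = \bigcap_(i in [set: 'I_n.+1])
    ((fun v : 'rV[R]_n.+1 => `|v ord0 i|) @^-1` `]-oo, M[%classic).
  apply/seteqP; split => [z bz i _|z bz i]; first by rewrite /= in_itv/=; exact: bz.
  by have := bz i I; rewrite /= in_itv.
apply: fin_bigcap_measurable => //.
move=> i _; rewrite -[X in measurable X]setTI.
have : measurable_fun setT (fun v : 'rV[R]_n.+1 => `|v ord0 i|) by mfun.
by apply => //; exact: measurable_itv.
Qed.

Lemma lebesgue_rV_cube n M : 0 < M ->
  lebesgue_rV R n (@cube n M) = ((2 * M) ^+ n)%:E.
Proof.
move=> M0; elim: n => [|n IH].
  have -> : lebesgue_rV R 0 (@cube 0 M) = dirac (0 : 'rV[R]_0) (@cube 0 M) by [].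
  by rewrite diracE mem_set// => -[].
have -> : lebesgue_rV R n.+1 (@cube n.+1 M) =
  (leb \x lebesgue_rV R n)%E (@rV_cons R n @^-1` @cube n.+1 M) by [].
rewrite (_ : _ @^-1` _ = `]-M, M[%classic `*` @cube n M); last first.
  apply/seteqP; split => -[a v]/=.
    move=> h; have [e1 e2] : a = rV_cons (a, v) ord0 ord0 /\
        forall i, v ord0 i = rV_cons (a, v) ord0 (lift ord0 i).
      have := rV_consK (a, v); rewrite /rV_uncons => -[h1 h2].
      by split => [|i]; [rewrite h1|rewrite -[in LHS]h2 mxE].
    split; first by rewrite in_itv/= -ltr_norml e1; exact: h.
    by move=> i; rewrite e2; exact: h.
  have := rV_consK (a, v); rewrite /rV_uncons => -[h1 h2].
  move=> [ha hv] i; have [->|] := eqVneq i ord0.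
    by rewrite h1 ltr_norml; rewrite in_itv/= in ha.
  case: (unliftP ord0 i) => [j ->|->]; last by rewrite eqxx.
  by move=> _; have := hv j; rewrite -[in X in X -> _]h2 mxE.
rewrite product_measure1E//; last exact: measurable_cube.
rewrite IH exprS EFinM; congr (_ * _)%E.
have := @lebesgue_measure_itv R `]-M, M[ => /= ->.
by rewrite lte_fin gtrN// -EFinB opprK mulr_natl.
Qed.

Lemma spacetime_box_fin (l u : option 'I_d -> R) :
  (spacetime_measure R d (box l u) < +oo)%E.
Proof.
pose M := 1 + \sum_i (`|l i| + `|u i|).
have hM i : - M < l i /\ u i < M.
  have : `|l i| + `|u i| < M.
    rewrite /M (bigD1 i)//= addrCA ltrDl ltr_pwDl//.
    by apply: sumr_ge0 => j _; rewrite addr_ge0.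
  have h1 : - `|l i| <= l i by rewrite lerNl -normrN ler_norm.
  have h2 := ler_norm (u i); have h3 := normr_ge0 (l i); have h4 := normr_ge0 (u i).
  by move=> h; split; lra.
apply: (@le_lt_trans _ _ (spacetime_measure R d (`]-M, M[%classic `*` @cube d M))).
  apply: le_measure; rewrite ?inE.
  - exact: measurable_box.
  - by apply: measurableX; [exact: measurable_itv|exact: measurable_cube].
  move=> z bz; split => /=.
    by have := bz None; have := hM None; rewrite in_itv/= => -[? ?] /andP[? ?]; apply/andP; split; lra.
  move=> i; have := bz (Some i); have := hM (Some i); rewrite /= ltr_norml => -[? ?] /andP[? ?].
  by apply/andP; split; lra.
rewrite /spacetime_measure product_measure1E//; last exact: measurable_cube.
rewrite lte_mul_pinfty//.
- by have := @lebesgue_measure_itv R `]-M, M[ => /= ->; case: ifP.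
- rewrite lebesgue_rV_cube ?ltry// /M ltr_pwDl//.
  by apply: sumr_ge0 => i _; rewrite addr_ge0.
Qed.

End borel_spacetime.

(** * Mean-square distance *)

Section mean_square.
Local Open Scope ereal_scope.
Context d (X : measurableType d) (R : realType) (mu : {measure set X -> \bar R}).
Variables (D : set X) (mD : measurable D).
Implicit Types f g h : X -> R.

Definition sqd f g := \int[mu]_(z in D) ((f z - g z) ^+ 2)%:E.

Lemma sqd_ge0 f g : 0 <= sqd f g.
Proof. by apply: integral_ge0 => z _; rewrite lee_fin sqr_ge0. Qed.

Lemma sqdC f g : sqd f g = sqd g f.
Proof. by apply: eq_integral => z _; rewrite -sqrrN opprB. Qed.

Lemma sqd0r f : sqd f (cst 0%R) = \int[mu]_(z in D) ((f z) ^+ 2)%:E.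
Proof. by apply: eq_integral => z _; rewrite subr0. Qed.

Lemma sqd_meas f g : measurable_fun D f -> measurable_fun D g ->
  measurable_fun D (fun z => ((f z - g z) ^+ 2)%:E).
Proof.
move=> mf mg; apply/measurable_EFinP; apply: measurable_funX.
exact: measurable_funB.
Qed.

Lemma sqd_triangle f g h : measurable_fun D f -> measurable_fun D g ->
  measurable_fun D h -> sqd f h <= 2%:E * sqd f g + 2%:E * sqd g h.
Proof.
move=> mf mg mh.
rewrite -!ge0_integralZl//; try exact: sqd_meas; try by [|move=> z _; rewrite lee_fin sqr_ge0].
rewrite -ge0_integralD//; try by move=> z _; rewrite -EFinM lee_fin mulr_ge0// sqr_ge0.
2-3: by apply: measurable_funeM; exact: sqd_meas.
apply: ge0_le_integral => //.
- by move=> z _; rewrite lee_fin sqr_ge0.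
- exact: sqd_meas.
- by apply: emeasurable_funD; apply: measurable_funeM; exact: sqd_meas.
- move=> z _; rewrite -!EFinM -EFinD lee_fin.
  have := sqr_ge0 (f z - 2 * g z + h z)%R; nra.
Qed.

Lemma integral_sqr_comb f g (c : R) : measurable_fun D f -> measurable_fun D g ->
  \int[mu]_(z in D) ((f z + c * g z) ^+ 2)%:E <=
  2%:E * \int[mu]_(z in D) ((f z) ^+ 2)%:E +
  (2 * c ^+ 2)%:E * \int[mu]_(z in D) ((g z) ^+ 2)%:E.
Proof.
move=> mf mg.
have m1 : measurable_fun D (fun z => ((f z) ^+ 2)%:E).
  by apply/measurable_EFinP; apply: measurable_funX.
have m2 : measurable_fun D (fun z => ((g z) ^+ 2)%:E).
  by apply/measurable_EFinP; apply: measurable_funX.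
have c0 : 0 <= (2 * c ^+ 2)%:E by rewrite lee_fin mulr_ge0// sqr_ge0.
have s0 (a : X -> R) z : D z -> 0 <= (a z ^+ 2)%:E.
  by move=> _; rewrite lee_fin sqr_ge0.
rewrite -(ge0_integralZl _ _ _ (s0 f))// -(ge0_integralZl _ _ _ (s0 g))//.
rewrite -ge0_integralD//; try by move=> z Dz; rewrite mule_ge0// s0.
2-3: exact: measurable_funeM.
apply: ge0_le_integral => //.
- by move=> z _; rewrite lee_fin sqr_ge0.
- apply/measurable_EFinP; apply: measurable_funX.
  by apply: measurable_funD => //; exact: measurable_funM.
- by apply: emeasurable_funD; exact: measurable_funeM.
- move=> z _; rewrite -!EFinM -EFinD lee_fin.
  have := sqr_ge0 (f z - c * g z); nra.
Qed.

Lemma sqd_dominated (f_ : nat -> X -> R) f h :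
  (forall n, measurable_fun D (f_ n)) -> measurable_fun D f -> measurable_fun D h ->
  (forall z, D z -> f_ n z @[n --> \oo] --> f z) ->
  (forall n z, D z -> (`|f_ n z| <= h z)%R) ->
  \int[mu]_(z in D) ((h z) ^+ 2)%:E < +oo ->
  sqd f (f_ n) @[n --> \oo] --> 0.
Proof.
move=> mf_ mf mh cf fh ih.
have mh2 : measurable_fun D (fun z => (4 * (h z) ^+ 2)%:E).
  by apply/measurable_EFinP; apply: measurable_funM => //; exact: measurable_funX.
have := @dominated_cvg _ _ _ mu D mD (fun n z => ((f z - f_ n z) ^+ 2)%:E) (cst 0)
  (fun z => (4 * (h z) ^+ 2)%:E).
rewrite (_ : \int[mu]_(x in D) cst 0 x = 0); last exact: integral0.
apply => //.
- by move=> n; exact: sqd_meas.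
- move=> z Dz; apply: cvg_EFin; first exact: nearW.
  rewrite (_ : 0%R = (f z - f z) ^+ 2)%R; last by rewrite subrr expr0n.
  apply: (@cvg_comp _ _ _ (fun n => (f z - f_ n z)%R) (fun x => x ^+ 2)%R).
    by apply: cvgB; [exact: cvg_cst|exact: cf].
  exact: exprn_continuous.
- apply/integrableP; split => //.
  rewrite (eq_integral (fun z => 4%:E * ((h z) ^+ 2)%:E)); last first.
    by move=> z _; rewrite gee0_abs ?EFinM// lee_fin mulr_ge0// sqr_ge0.
  rewrite ge0_integralZl//; last by move=> z _; rewrite lee_fin sqr_ge0.
    by rewrite lte_mul_pinfty.
  by apply/measurable_EFinP; exact: measurable_funX.
- move=> n z Dz; rewrite gee0_abs ?lee_fin ?sqr_ge0//.
  have h1 := fh n z Dz.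
  have h2 : (`|f z| <= h z)%R.
    apply: (@closed_cvg _ _ \oo _ (fun n => `|f_ n z|)%R (fun x => x <= h z)%R).
    - exact: closed_le.
    - by apply: nearW => k; exact: fh.
    - by apply: cvg_norm; exact: cf.
  rewrite -(real_normK (num_real (f z - f_ n z)%R)).
  have h3 := ler_normB (f z) (f_ n z).
  have h4 := normr_ge0 (f z - f_ n z)%R.
  nra.
Qed.

End mean_square.

Lemma cvge0_lt (R : realType) (u : (\bar R)^nat) (e : R) : 0 < e ->
  u n @[n --> \oo] --> 0%E -> \forall n \near \oo, (u n < e%:E)%E.
Proof.
move=> e0 cu.
apply: (cu [set x | (x < e%:E)%E]); apply: open_nbhs_nbhs.
by split; [exact: open_ereal_lt_ereal|rewrite /= lte_fin].
Qed.

(** * Density of the bumps with rational data *)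

Section density.
Context {R : realType} {d : nat}.
Local Notation E := (R * 'rV[R]_d)%type.
Local Notation mE := (measurableTypeR R * 'rV[R]_d)%type.
Local Notation mu := (spacetime_measure R d).
Local Notation qpoint := {ffun option 'I_d -> rat}.

Definition qcode : Type := seq (rat * (nat * (qpoint * qpoint))).
HB.instance Definition _ := Countable.on qcode.

Definition qreal (q : qpoint) : option 'I_d -> R := fun i => ratr (q i).

Definition qcomb (c : qcode) (z : E) : R :=
  \sum_(x <- c) ratr x.1 * bump x.2.1 (qreal x.2.2.1) (qreal x.2.2.2) z.

Variables l u : option 'I_d -> R.
Local Notation B := (box l u).

Definition qcode_in (c : qcode) : Prop :=
  forall x, x \in c -> forall i, l i <= qreal x.2.2.1 i /\ qreal x.2.2.2 i <= u i.

Lemma measurable_bump n (a b : option 'I_d -> R) :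
  measurable_fun (setT : set mE) (bump n a b).
Proof.
apply: continuous_measurable_spacetime.
by have /(_ [::])[] := smooth_bump n a b.
Qed.

Lemma measurable_qcomb c : measurable_fun (setT : set mE) (qcomb c).
Proof.
apply: measurable_sum => x; apply: measurable_funM => //.
exact: measurable_bump.
Qed.

Lemma qcomb_out c z : qcode_in c -> ~ B z -> qcomb c z = 0.
Proof.
move=> cB Bz; rewrite /qcomb big_seq big1// => x xc.
rewrite bump_eq0 ?mulr0// => bz; apply: Bz => i.
have [h1 h2] := cB x xc i; have /andP[h3 h4] := bz i.
by rewrite (le_lt_trans h1 h3) (lt_le_trans h4 h2).
Qed.

Lemma qcomb_bounded c : exists M, forall z, `|qcomb c z| <= M.
Proof.
exists (\sum_(x <- c) `|ratr x.1 : R|) => z.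
apply: le_trans (ler_norm_sum _ _ _) _; apply: ler_sum => x _.
by rewrite normrM ler_piMr// ger0_norm ?bump_ge0 ?bump_le1.
Qed.

Definition approximable (f : mE -> R) : Prop := measurable_fun setT f /\
  forall e : R, 0 < e -> exists2 c, qcode_in c & (sqd mu B f (qcomb c) < e%:E)%E.

Let mB : measurable (B : set mE). Proof. exact: measurable_box. Qed.
Let mT (f : mE -> R) : measurable_fun setT f -> measurable_fun B f.
Proof. exact: measurable_funTS. Qed.
Let Bfin : (mu B < +oo)%E. Proof. exact: spacetime_box_fin. Qed.

Lemma approximable_lim (f : mE -> R) : measurable_fun setT f ->
  (forall e : R, 0 < e -> exists2 g, approximable g & (sqd mu B f g < e%:E)%E) ->
  approximable f.
Proof.
move=> mf hf; split => // e e0.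
have e4 : 0 < e / 4 by rewrite divr_gt0.
have [g [mg hg] fg] := hf _ e4; have [c cB gc] := hg _ e4.
exists c => //.
apply: (le_lt_trans (sqd_triangle mu mB (mT mf) (mT mg) (mT (measurable_qcomb c)))).
rewrite (_ : e%:E = 2%:E * (e / 4)%:E + 2%:E * (e / 4)%:E)%E.
  by apply: lteD; rewrite lte_pmul2l.
by rewrite -!EFinM -EFinD; congr EFin; lra.
Qed.

(** Every density step below is an instance of dominated convergence. *)
Lemma approximable_dominated (f_ : nat -> mE -> R) (f h : mE -> R) :
  (forall n, approximable (f_ n)) -> measurable_fun setT f -> measurable_fun setT h ->
  (forall z, B z -> f_ n z @[n --> \oo] --> f z) ->
  (forall n z, B z -> `|f_ n z| <= h z) ->
  (\int[mu]_(z in B) ((h z) ^+ 2)%:E < +oo)%E -> approximable f.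
Proof.
move=> af mf mh cf fh ih; apply: approximable_lim => // e e0.
have := sqd_dominated mB (fun n => mT (af n).1) (mT mf) (mT mh) cf fh ih.
move=> /(cvge0_lt e0)[n _ hn].
by exists (f_ n) => //; apply: hn => /=.
Qed.

Lemma approximable_eq (f g : mE -> R) : measurable_fun setT g ->
  (forall z, B z -> f z = g z) -> approximable f -> approximable g.
Proof.
move=> mg fg [mf hf]; split => // e e0; have [c cB fc] := hf e e0.
exists c => //; move: fc; congr (_ < _)%E.
by apply: eq_integral => z; rewrite inE => /fg ->.
Qed.

Lemma integral_bounded_fin (f : mE -> R) (M : R) : measurable_fun setT f ->
  (forall z, `|f z| <= M) -> (\int[mu]_(z in B) ((f z) ^+ 2)%:E < +oo)%E.
Proof.
move=> mf fM; apply: (@le_lt_trans _ _ (\int[mu]_(z in B) (cst (M ^+ 2)%:E z))%E).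
  apply: ge0_le_integral => //.
  - by move=> z _; rewrite lee_fin sqr_ge0.
  - by apply/measurable_EFinP; apply: measurable_funX; exact: mT.
  - move=> z _; rewrite lee_fin -[f z ^+ 2](real_normK (num_real _)).
    by rewrite lerXn2r ?nnegrE// (le_trans _ (fM z)).
by rewrite integral_cst// lte_mul_pinfty// lee_fin sqr_ge0.
Qed.

Lemma approximable_L2 (f : mE -> R) : approximable f ->
  (\int[mu]_(z in B) ((f z) ^+ 2)%:E < +oo)%E.
Proof.
move=> [mf hf]; have [c _ fc] := hf 1 ltr01.
have [M hM] := qcomb_bounded c.
have := sqd_triangle mu mB (mT mf) (mT (measurable_qcomb c)) (measurable_cst (0 : R)).
rewrite !sqd0r =>  /le_lt_trans; apply; apply: lte_add_pinfty.
  by rewrite lte_mul_pinfty// (lt_trans fc)// ltry.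
by rewrite lte_mul_pinfty//; apply: (integral_bounded_fin (measurable_qcomb c) hM).
Qed.

Lemma approximable0 : approximable (cst 0).
Proof.
split => // e e0; exists [::]; first by [].
rewrite /sqd (eq_integral (cst 0%E)); first by rewrite integral0 lte_fin.
by move=> z _; rewrite /qcomb big_nil subrr expr0n.
Qed.

Lemma approximable_qcomb c : qcode_in c -> approximable (qcomb c).
Proof.
move=> cB; split => [|e e0]; first exact: measurable_qcomb.
exists c => //.
rewrite /sqd (eq_integral (cst 0%E)); first by rewrite integral0 lte_fin.
by move=> z _; rewrite subrr expr0n.
Qed.

Let approximable_ratr (q : rat) (f g : mE -> R) : approximable f -> approximable g ->
  approximable (fun z => f z + ratr q * g z).
Proof.
move=> [mf hf] [mg hg]; split.
  by apply: measurable_funD => //; apply: measurable_funM.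
move=> e e0; pose k := (2 + 2 * (ratr q : R) ^+ 2).
have k0 : 0 < k by rewrite /k ltr_wpDr// mulr_ge0// sqr_ge0.
have ek : 0 < e / 2 / k by rewrite !divr_gt0.
have [c cB fc] := hf _ ek; have [c' cB' gc] := hg _ ek.
pose c2 : qcode := c ++ [seq (q * x.1, x.2) | x <- c'].
have c2E z : qcomb c2 z = qcomb c z + ratr q * qcomb c' z.
  rewrite /qcomb big_cat/= big_map mulr_sumr; congr (_ + _).
  by apply: eq_bigr => x _ /=; rewrite rmorphM/= mulrA.
exists c2.
  move=> x; rewrite mem_cat => /orP[/cB//|/mapP[y /cB' h ->]]; exact: h.
rewrite /sqd.
rewrite (eq_integral (fun z => (((f z - qcomb c z) + ratr q * (g z - qcomb c' z)) ^+ 2)%:E)); last first.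
  by move=> z _; rewrite c2E; congr ((_ ^+ 2)%:E); ring.
apply: (le_lt_trans (integral_sqr_comb mu mB (ratr q)
  (mT (measurable_funB mf (measurable_qcomb c)))
  (mT (measurable_funB mg (measurable_qcomb c'))))).
apply: (@le_lt_trans _ _ (e / 2)%:E); last by rewrite lte_fin ltr_pdivrMr// ltr_pMr// ltr1n.
rewrite (_ : (e / 2)%:E = 2%:E * (e / 2 / k)%:E + (2 * (ratr q) ^+ 2)%:E * (e / 2 / k)%:E)%E.
  apply: leeD; first by rewrite lee_pmul// ?sqd_ge0 ?ltW.
  by apply: lee_wpmul2l; [rewrite lee_fin mulr_ge0// sqr_ge0|exact: ltW].
by rewrite -!EFinM -EFinD -mulrDl; congr EFin; rewrite -/k [RHS]mulrC divfK// gt_eqF.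
Qed.

Lemma approximable_comb (c : R) (f g : mE -> R) : approximable f -> approximable g ->
  approximable (fun z => f z + c * g z).
Proof.
move=> af ag.
have rat_near n : exists q : rat, c < ratr q < c + n.+1%:R^-1.
  have [|q] := @rat_in_itvoo R c (c + n.+1%:R^-1); first by rewrite ltrDl invr_gt0.
  by rewrite in_itv/= => h; exists q.
(* The coefficients of the approximants are rational, those of f and g real. *)
pose q n : rat := xchoose (rat_near n).
have qc : (ratr (q n) : R) @[n --> \oo] --> c.
  apply: (@squeeze_cvgr _ _ _ _ (cst c) (fun n => c + n.+1%:R^-1)).
  - by apply: nearW => n; have /andP[/ltW -> /ltW ->] := xchooseP (rat_near n).
  - exact: cvg_cst.
  - rewrite -[X in _ --> X]addr0; apply: cvgD; first exact: cvg_cst.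
    exact: cvg_harmonic.
have qb n : `|ratr (q n) : R| <= `|c| + 1.
  have /andP[h1 h2] := xchooseP (rat_near n).
  have h3 : n.+1%:R^-1 <= (1 : R) by rewrite invf_le1// ler1n.
  have h4 := ler_norm c; have h5 : - `|c| <= c by rewrite lerNl -normrN ler_norm.
  move: h1 h2 h3; rewrite -/(q n).
  move: (n.+1%:R^-1) (ratr (q n)) h4 h5 => w v h4 h5 h1 h2 h3.
  by rewrite ler_norml; apply/andP; split; lra.
have [mf _] := af; have [mg _] := ag.
pose h z := `|f z| + (`|c| + 1) * `|g z|.
have mfn : measurable_fun setT (fun z => `|f z|) by exact: measurableT_comp.
have mgn : measurable_fun setT (fun z => `|g z|) by exact: measurableT_comp.
apply: (@approximable_dominated (fun n z => f z + ratr (q n) * g z) _ h).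
- by move=> n; exact: approximable_ratr.
- by apply: measurable_funD => //; apply: measurable_funM.
- by apply: measurable_funD => //; apply: measurable_funM.
- by move=> z _; apply: cvgD; [exact: cvg_cst|apply: cvgMr_tmp].
- move=> n z _; rewrite /h (le_trans (ler_normD _ _))// lerD2l normrM.
  by rewrite ler_wpM2r.
apply: (le_lt_trans (integral_sqr_comb mu mB _ (mT mfn) (mT mgn))).
have k0 : 0 <= 2 * (`|c| + 1) ^+ 2 by rewrite mulr_ge0// sqr_ge0.
apply: lte_add_pinfty; rewrite lte_mul_pinfty ?lee_fin//.
- rewrite (eq_integral (fun z => ((f z) ^+ 2)%:E)); first exact: approximable_L2.
  by move=> z _; rewrite real_normK// num_real.
- rewrite (eq_integral (fun z => ((g z) ^+ 2)%:E)); first exact: approximable_L2.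
  by move=> z _; rewrite real_normK// num_real.
Qed.

Lemma approximable_sum (I : Type) (s : seq I) (c : I -> R) (f : I -> mE -> R) :
  (forall i, approximable (f i)) -> approximable (fun z => \sum_(i <- s) c i * f i z).
Proof.
move=> af; elim: s => [|i s IH].
  by rewrite (_ : (fun z => _) = cst 0); [exact: approximable0|apply/funext => z; rewrite big_nil].
rewrite (_ : (fun z => _) = fun z => \sum_(j <- s) c j * f j z + c i * f i z).
  exact: approximable_comb.
by apply/funext => z; rewrite big_cons addrC.
Qed.

Lemma approximable_box (a b : option 'I_d -> R) : approximable (\1_(box a b) : mE -> R).
Proof.
have fin1 : (\int[mu]_(z in B) ((cst 1 z) ^+ 2)%:E < +oo)%E.
  by apply: (@integral_bounded_fin _ 1) => // z; rewrite normr1.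
have m1 (c e : option 'I_d -> R) : measurable_fun setT (\1_(box c e) : mE -> R).
  by apply: measurable_indic; exact: measurable_box.
have ind1 (A : set mE) z : `|\1_A z : R| <= 1.
  by rewrite indicE ger0_norm// lern1 leq_b1.
have qbox_approx (c e : qpoint) :
    (forall i, l i <= qreal c i) -> (forall i, qreal e i <= u i) ->
    approximable (\1_(box (qreal c) (qreal e)) : mE -> R).
  move=> lc eu.
  apply: (@approximable_dominated (fun n => bump n (qreal c) (qreal e)) _ (cst 1)) => //.
  - move=> n; pose k : qcode := [:: (1%Q, (n, (c, e)))].
    rewrite (_ : bump _ _ _ = qcomb k).
      by apply: approximable_qcomb => x; rewrite inE => /eqP -> i /=; split.
    by apply/funext => z; rewrite /qcomb big_seq1 rmorph1 mul1r.
  - by move=> z _; exact: bump_cvg.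
  - by move=> n z _; rewrite ger0_norm ?bump_ge0// bump_le1.
pose a' i := Num.max (a i) (l i); pose b' i := Num.min (b i) (u i).
apply: (@approximable_eq (\1_(box a' b'))) => //.
  move=> z Bz; rewrite !indicE; congr (_%:R); congr nat_of_bool.
  apply/idP/idP; rewrite !inE => h i; have /andP[h1 h2] := h i; have /andP[h3 h4] := Bz i.
    by move: h1 h2; rewrite gt_max lt_min => /andP[-> _] /andP[-> _].
  by rewrite gt_max lt_min h1 h2 h3.
have ratl n (x : R) : exists q : rat, x < ratr q < x + n.+1%:R^-1.
  have [|q] := @rat_in_itvoo R x (x + n.+1%:R^-1); first by rewrite ltrDl invr_gt0.
  by rewrite in_itv/= => h; exists q.
have ratu n (x : R) : exists q : rat, x - n.+1%:R^-1 < ratr q < x.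
  have [|q] := @rat_in_itvoo R (x - n.+1%:R^-1) x; first by rewrite ltrBlDr ltrDl invr_gt0.
  by rewrite in_itv/= => h; exists q.
pose qa n : qpoint := [ffun i => xchoose (ratl n (a' i))].
pose qb n : qpoint := [ffun i => xchoose (ratu n (b' i))].
apply: (@approximable_dominated (fun n => \1_(box (qreal (qa n)) (qreal (qb n)))) _ (cst 1)) => //.
- move=> n; apply: qbox_approx => i; rewrite /qreal ffunE.
    have /andP[h _] := xchooseP (ratl n (a' i)).
    by apply: le_trans (ltW h); rewrite /a' le_max lexx orbT.
  have /andP[_ h] := xchooseP (ratu n (b' i)).
  by apply: le_trans (ltW h) _; rewrite /b' ge_min lexx orbT.
- move=> z Bz; apply: (@cvg_trans _ (cst (\1_(box a' b') z : R) @ \oo)); last exact: cvg_cst.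
  apply: near_eq_cvg; rewrite /= !indicE.
  have [bz|bz] := pselect (box a' b' z).
  + have : \forall n \near \oo, forall i, a' i + n.+1%:R^-1 < coord i z < b' i - n.+1%:R^-1.
      apply: filter_forall => i; have /andP[h1 h2] := bz i.
      pose e := Num.min (coord i z - a' i) (b' i - coord i z).
      have e0 : 0 < e by rewrite lt_min !subr_gt0 h1 h2.
      have := @cvg_harmonic R => /cvgrPdist_lt /(_ e e0).
      apply: filterS => n; rewrite /= sub0r normrN gtr0_norm ?invr_gt0// /e lt_min => /andP[].
      by move: (n.+1%:R^-1) => w h3 h4; apply/andP; split; lra.
    apply: filterS => n hn; rewrite /= indicE (mem_set bz) mem_set// => i.
    have /andP[h1 h2] := hn i; rewrite /qreal !ffunE.
    have /andP[h3 h4] := xchooseP (ratl n (a' i)).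
    have /andP[h5 h6] := xchooseP (ratu n (b' i)).
    move: (n.+1%:R^-1) (ratr _) (ratr _) h1 h2 h3 h4 h5 h6 => w v v' h1 h2 h3 h4 h5 h6.
    by apply/andP; split; lra.
  + apply: nearW => n; rewrite /= indicE (memNset bz) memNset// => h; apply: bz => i.
    have /andP[] := h i; rewrite /qreal !ffunE => h1 h2.
    have /andP[h3 h4] := xchooseP (ratl n (a' i)).
    have /andP[h5 h6] := xchooseP (ratu n (b' i)).
    move: (n.+1%:R^-1) (ratr _) (ratr _) h1 h2 h3 h4 h5 h6 => w v v' h1 h2 h3 h4 h5 h6.
    by apply/andP; split; lra.
Qed.

(** The sets whose indicator is approximable form a Dynkin system containing the
pi-system of boxes. *)
Lemma approximable_indic (A : set mE) : measurable A -> approximable (\1_A : mE -> R).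
Proof.
have fin1 : (\int[mu]_(z in B) ((cst 1 z) ^+ 2)%:E < +oo)%E.
  by apply: (@integral_bounded_fin _ 1) => // z; rewrite normr1.
have aT : approximable (\1_setT : mE -> R).
  apply: (@approximable_eq (\1_B)); last exact: approximable_box.
    exact: measurable_indic.
  by move=> z Bz; rewrite !indicE !mem_set.
rewrite measurable_spacetimeE => mA.
apply: (@dynkin_induction _ mE (@boxes R d) (fun A => approximable (\1_A : mE -> R))
   (@measurable_spacetimeE R d) (@boxes_setI R d)) => //.
- by move=> _ [a [b ->]]; exact: approximable_box.
- move=> S mS aS; rewrite (_ : \1_(~` S) = fun z => \1_setT z + (-1) * \1_S z).
    exact: approximable_comb.
  apply/funext => z; rewrite !indicE in_setT in_setC.
  by case: (z \in S); rewrite /=; ring.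
- move=> S mS tS aS.
  apply: (@approximable_dominated (fun n z => \sum_(i <- iota 0 n) 1 * \1_(S i) z) _ (cst 1)) => //.
  + by move=> n; apply: approximable_sum.
  + by apply: measurable_indic; exact: bigcupT_measurable.
  + move=> z _; apply: (@cvg_trans _ (cst (\1_(\bigcup_k S k) z : R) @ \oo)); last exact: cvg_cst.
    apply: near_eq_cvg; rewrite /= indicE.
    have [[k _ Sk]|nS] := pselect ((\bigcup_k S k) z).
      near=> n; rewrite mem_set; last by exists k.
      rewrite (bigD1_seq k)/= ?iota_uniq//; last first.
        by rewrite mem_iota add0n; near: n; exact: nbhs_infty_gt.
      rewrite indicE mem_set// mulr1 big1 ?addr0// => i ik.
      rewrite indicE memNset ?mulr0// => Si.
      by move/trivIsetP: tS => /(_ i k I I ik)/seteqP[/(_ z (conj Si Sk))].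
    apply: nearW => n; rewrite memNset// big1// => i _.
    by rewrite indicE memNset ?mulr0// => Si; apply: nS; exists i.
  + move=> n z _; rewrite /cst.
    have -> : \sum_(i <- iota 0 n) 1 * \1_(S i) z = \1_(\bigcup_(i in [set` iota 0 n]) S i) z :> R.
      rewrite [RHS]indicE; have [[k kn Sk]|nS] := pselect ((\bigcup_(i in [set` iota 0 n]) S i) z).
        rewrite mem_set; last by exists k.
        rewrite (bigD1_seq k)/= ?iota_uniq//.
        rewrite indicE mem_set// mulr1 big1 ?addr0// => i ik.
        rewrite indicE memNset ?mulr0// => Si.
        by move/trivIsetP: tS => /(_ i k I I ik)/seteqP[/(_ z (conj Si Sk))].
      rewrite memNset// big_seq big1// => i ii.
      by rewrite indicE memNset ?mulr0// => Si; apply: nS; exists i.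
    by rewrite indicE ger0_norm// lern1 leq_b1.
Unshelve. all: by end_near. Qed.

Import HBNNSimple.

Lemma approximable_nneg (f : mE -> R) : measurable_fun setT f -> (forall z, 0 <= f z) ->
  (\int[mu]_(z in B) ((f z) ^+ 2)%:E < +oo)%E -> approximable f.
Proof.
move=> mf f0 if2.
have mfe : measurable_fun setT (EFin \o f) by exact/measurable_EFinP.
pose g := nnsfun_approx measurableT mfe.
have cg z : g n z @[n --> \oo] --> f z.
  have := @cvg_nnsfun_approx _ _ _ _ measurableT _ mfe _ z I.
  move=> /(_ (fun x _ => f0 x)) /fine_cvgP[_]; exact.
have gf n z : g n z <= f z.
  have : nondecreasing_seq (fun n => g n z).
    by move=> i j ij; have /lefP := nd_nnsfun_approx measurableT mfe ij; exact.
  move=> ndg; have := nondecreasing_cvgn_le ndg (cvgP _ (cg z)) n.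
  by rewrite (cvg_lim _ (cg z)).
apply: (@approximable_dominated (fun n => g n) _ f) => //.
- move=> n; rewrite (funext (fimfunEord (g n))).
  apply: approximable_sum => i; apply: approximable_indic.
  by rewrite -[X in measurable X]setTI; exact: measurable_funP.
- by move=> n z _; rewrite ger0_norm// gf.
Qed.

Lemma L2_approximable (f : mE -> R) : measurable_fun setT f ->
  (\int[mu]_(z in B) ((f z) ^+ 2)%:E < +oo)%E -> approximable f.
Proof.
move=> mf if2.
have h (g : mE -> R) : measurable_fun setT g -> (forall z, `|g z| <= `|f z|) ->
    (forall z, 0 <= g z) -> approximable g.
  move=> mg gf g0; apply: approximable_nneg => //; apply: le_lt_trans if2.
  apply: ge0_le_integral => //.
  - by move=> z _; rewrite lee_fin sqr_ge0.
  - by apply/measurable_EFinP; apply: measurable_funX; exact: mT.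
  - by apply/measurable_EFinP; apply: measurable_funX; exact: mT.
  - move=> z _; rewrite lee_fin -(real_normK (num_real (g z))) -(real_normK (num_real (f z))).
    by rewrite lerXn2r ?nnegrE.
rewrite (_ : f = fun z => Num.max (f z) 0 + (-1) * Num.max (- f z) 0); last first.
  by apply/funext => z; rewrite /Num.max; case: ltP => ?; case: ltP => ?; lra.
apply: approximable_comb; apply: h.
- exact: measurable_maxr.
- by move=> z; rewrite /Num.max; case: ifPn => // _; rewrite normr0.
- by move=> z; rewrite le_max lexx orbT.
- by apply: measurable_maxr => //; exact: measurable_funN.
- by move=> z; rewrite /Num.max; case: ifPn; rewrite ?normr0 ?normrN.
- by move=> z; rewrite le_max lexx orbT.
Qed.

End density.

(** * Translation invariance and Gaussian integrals *)

Section change_of_variables.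
Local Open Scope ereal_scope.

Lemma ge0_integral_preserving d (X : measurableType d) (R : realType)
    (mu : {measure set X -> \bar R}) (phi : X -> X) (f : X -> \bar R) :
  measurable_fun setT phi ->
  (forall A, measurable A -> mu (phi @^-1` A) = mu A) ->
  measurable_fun setT f -> (forall x, 0 <= f x) ->
  \int[mu]_x f (phi x) = \int[mu]_x f x.
Proof.
move=> mphi pres mf f0.
have := @ge0_integral_pushforward _ _ _ _ R phi mphi mu setT f measurableT mf (fun x _ => f0 x).
rewrite preimage_setT => <-.
by apply: eq_measure_integral => A mA _; exact: pres.
Qed.

Context {R : realType}.
Local Notation leb := (@lebesgue_measure R).

Let shiftR (c : R) : measurableTypeR R -> measurableTypeR R := fun x => (x + c)%R.

Lemma lebesgue_measure_shift (c : R) (A : set R) : measurable A ->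
  leb (shiftR c @^-1` A) = leb A.
Proof.
move=> mA; rewrite -[LHS]/(pushforward leb (shiftR c) A).
have ms : measurable_fun setT (shiftR c) by rewrite /shiftR; mfun.
apply/esym/lebesgue_measure_unique => //= _ [[a b]] _ <-.
rewrite /pushforward (_ : _ @^-1` _ = `](a - c)%R, (b - c)%R]%classic); last first.
  by apply/seteqP; split => x /=; rewrite !in_itv/= /shiftR ltrBlDr lerBrDr.
rewrite !lebesgue_measure_itv/= !lte_fin ltrD2r; case: ifP => // _.
by rewrite -!EFinD; congr EFin; ring.
Qed.

Lemma ge0_integral_shift (c : R) (f : R -> \bar R) : measurable_fun setT f ->
  (forall x, 0 <= f x) -> \int[leb]_x f (x + c)%R = \int[leb]_x f x.
Proof.
move=> mf f0; have ms : measurable_fun setT (shiftR c) by rewrite /shiftR; mfun.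
exact: (ge0_integral_preserving ms (@lebesgue_measure_shift c)).
Qed.

Lemma ge0_integral_opp (f : R -> \bar R) : measurable_fun setT f ->
  (forall x, 0 <= f x) -> \int[leb]_x f (- x)%R = \int[leb]_x f x.
Proof.
move=> mf f0.
have ms : measurable_fun setT (-%R : measurableTypeR R -> measurableTypeR R).
  exact: oppr_measurable.
exact: (ge0_integral_preserving ms (@lebesgue_measureN R)).
Qed.

Lemma rV_cons0 n (p : measurableTypeR R * 'rV[R]_n) : rV_cons p ord0 ord0 = p.1.
Proof. by have := rV_consK p; move: (rV_cons p) => x <-. Qed.

Lemma rV_consS n (p : measurableTypeR R * 'rV[R]_n) j :
  rV_cons p ord0 (lift ord0 j) = p.2 ord0 j.
Proof. by have := rV_consK p; move: (rV_cons p) => x <-; rewrite mxE. Qed.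

Lemma rV_consD n (p q : measurableTypeR R * 'rV[R]_n) :
  (rV_cons p + rV_cons q = rV_cons ((p.1 + q.1, p.2 + q.2) : measurableTypeR R * 'rV[R]_n))%R.
Proof.
apply/rowP => i; rewrite mxE.
by have [j ->|->] := unliftP ord0 i; rewrite ?rV_consS ?rV_cons0//= mxE.
Qed.

Lemma rV_unconsK n : cancel (@rV_uncons R n) (@rV_cons R n).
Proof.
move=> x; apply/rowP => i.
by have [j ->|->] := unliftP ord0 i; rewrite ?rV_consS ?rV_cons0//= mxE.
Qed.

Lemma ge0_integral_rV_cons n (f : 'rV[R]_n.+1 -> \bar R) : measurable_fun setT f ->
  (forall x, 0 <= f x) ->
  \int[lebesgue_rV R n.+1]_x f x =
  \int[leb]_a \int[lebesgue_rV R n]_v f (rV_cons (a, v)).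
Proof.
move=> mf f0; have mc := @measurable_rV_cons R n.
transitivity (\int[pushforward (leb \x lebesgue_rV R n) (@rV_cons R n)]_x f x).
  by [].
rewrite (ge0_integral_pushforward mc)//.
rewrite preimage_setT (fubini_tonelli1 (f \o @rV_cons R n))//.
- exact: measurableT_comp.
- by move=> z; exact: f0.
Qed.

Lemma measurable_rV_section n (f : 'rV[R]_n.+1 -> \bar R) : measurable_fun setT f ->
  (forall x, 0 <= f x) ->
  measurable_fun setT (fun a : R => \int[lebesgue_rV R n]_v f (rV_cons (a, v))).
Proof.
move=> mf f0; have mc := @measurable_rV_cons R n.
apply: (@measurable_fun_fubini_tonelli_F _ _ _ _ _ (lebesgue_rV R n) (f \o @rV_cons R n)).
- exact: measurableT_comp.
- by move=> z; exact: f0.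
Qed.

Lemma ge0_integral_rV0 (f : 'rV[R]_0 -> \bar R) : measurable_fun setT f ->
  \int[lebesgue_rV R 0]_x f x = f 0%R.
Proof.
move=> mf; transitivity (\int[dirac (0 : 'rV[R]_0)%R]_x f x); first by [].
by rewrite integral_dirac// diracE in_setT mul1e.
Qed.

Lemma measurable_shift_rV n (w : 'rV[R]_n) :
  measurable_fun setT (fun v : 'rV[R]_n => (v + w)%R).
Proof.
apply: measurable_fun_rVP => i; under eq_fun do rewrite mxE.
by apply: measurable_funD => //; exact: measurable_coord.
Qed.

Lemma ge0_integral_rV_shift n (w : 'rV[R]_n) (f : 'rV[R]_n -> \bar R) :
  measurable_fun setT f -> (forall x, 0 <= f x) ->
  \int[lebesgue_rV R n]_v f (v + w)%R = \int[lebesgue_rV R n]_v f v.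
Proof.
elim: n w f => [|n IH] w f mf f0.
  by apply: eq_integral => v _; congr f; apply/rowP => -[].
have mfw : measurable_fun setT (fun v : 'rV[R]_n.+1 => f (v + w)%R).
  exact: (measurableT_comp mf (@measurable_shift_rV _ w)).
pose w0 := (rV_uncons w).1; pose w' := (rV_uncons w).2.
have E a v : (rV_cons (a, v) + w = rV_cons ((a + w0, v + w') : measurableTypeR R * 'rV[R]_n))%R.
  by rewrite -{1}(rV_unconsK w) rV_consD.
apply: (etrans (ge0_integral_rV_cons mfw (fun v => f0 (v + w)%R))).
apply: (etrans _ (esym (ge0_integral_rV_cons mf f0))).
apply: (etrans _ (ge0_integral_shift w0 (measurable_rV_section mf f0) _)); last first.
  by move=> a; exact: integral_ge0.
apply: eq_integral => a _.
apply: (etrans _ (IH w' (fun v => f (rV_cons (a + w0, v)%R)) _ _)).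
- by apply: eq_integral => v _; rewrite E.
- apply: (measurableT_comp mf).
  apply: (measurableT_comp (@measurable_rV_cons R n)).
  exact: pair1_measurable.
- by move=> v; exact: f0.
Qed.

Lemma ge0_integral_spacetime d (f : measurableTypeR R * 'rV[R]_d -> \bar R) :
  measurable_fun setT f -> (forall x, 0 <= f x) ->
  \int[spacetime_measure R d]_z f z =
  \int[leb]_t \int[lebesgue_rV R d]_x f (t, x).
Proof.
by move=> mf f0; exact: (@fubini_tonelli1 _ _ _ _ R leb (lebesgue_rV R d) f mf f0).
Qed.

Lemma ge0_integral_spacetime_shift d (z0 : R * 'rV[R]_d)
    (f : measurableTypeR R * 'rV[R]_d -> \bar R) :
  measurable_fun setT f -> (forall x, 0 <= f x) ->
  \int[spacetime_measure R d]_z f (z.1 + z0.1, z.2 + z0.2)%R =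
  \int[spacetime_measure R d]_z f z.
Proof.
move=> mf f0.
have ms : measurable_fun setT (fun z : measurableTypeR R * 'rV[R]_d => (z.1 + z0.1, z.2 + z0.2)%R).
  apply: measurable_fun_pair; first by mfun.
  apply: (measurableT_comp (@measurable_shift_rV _ z0.2)); exact: measurable_snd.
apply: (etrans (ge0_integral_spacetime (measurableT_comp mf ms) (fun z => f0 _))).
apply: (etrans _ (esym (ge0_integral_spacetime mf f0))).
apply: (etrans _ (@ge0_integral_shift z0.1 (fun t => \int[lebesgue_rV R d]_x f (t, x)) _ _)); last 2 first.
- exact: measurable_fun_fubini_tonelli_F.
- by move=> a; exact: integral_ge0.
apply: eq_integral => a _.
apply: (ge0_integral_rV_shift z0.2 (f := fun v : 'rV[R]_d => f (a + z0.1, v)%R)).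
- exact: (measurableT_comp mf (@pair1_measurable _ _ _ _ _)).
- by move=> v; exact: f0.
Qed.

Lemma integral_gauss_center (b m : R) : (0 < b)%R ->
  \int[leb]_x (expR (- b * (x - m) ^+ 2))%:E = (Num.sqrt (pi / b))%:E.
Proof.
move=> b0; pose s := Num.sqrt (2 * b)^-1.
have s2 : (s ^+ 2 = (2 * b)^-1)%R by rewrite sqr_sqrtr// invr_ge0 mulr_ge0// ltW.
have s0 : s != 0%R by rewrite gt_eqF// sqrtr_gt0 invr_gt0 mulr_gt0.
have := @integral_normal_pdf R m s.
rewrite normal_pdfE//=.
have pk : (normal_peak s = (Num.sqrt (pi / b))^-1)%R.
  by rewrite /normal_peak s2; congr (Num.sqrt _)^-1%R; rewrite -mulr_natr; field; rewrite gt_eqF.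
have sp : (0 < Num.sqrt (pi / b) :> R)%R by rewrite sqrtr_gt0 divr_gt0// pi_gt0.
under eq_integral do rewrite EFinM.
rewrite ge0_integralZl//; last 3 first.
- apply/measurable_EFinP; exact: measurable_normal_fun.
- by move=> x _; rewrite lee_fin normal_fun_ge0.
- by rewrite lee_fin normal_peak_ge0.
have E x : normal_fun m s x = expR (- b * (x - m) ^+ 2).
  by rewrite /normal_fun s2 -mulr_natr; congr expR; field; rewrite gt_eqF.
under eq_integral do rewrite E.
rewrite pk => h.
have : (Num.sqrt (pi / b))%:E * ((Num.sqrt (pi / b))^-1%:E *
  \int[leb]_x (expR (- b * (x - m) ^+ 2))%:E) = (Num.sqrt (pi / b))%:E by rewrite h mule1.
by rewrite muleA -EFinM mulfV ?gt_eqF// mul1e.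
Qed.

Lemma sqnorm_rV_cons n (a : R) (v x : 'rV[R]_n.+1) w : v = rV_cons (a, w) ->
  (sqnorm (v - x) = (a - x ord0 ord0) ^+ 2 + sqnorm (w - (rV_uncons x).2))%R.
Proof.
move=> ->; rewrite /sqnorm big_ord_recl.
have e i : ((rV_cons (a, w) - x) ord0 i = rV_cons (a, w) ord0 i - x ord0 i)%R.
  by rewrite [LHS]mxE [X in (_ + X)%R]mxE.
rewrite e rV_cons0; congr (_ + _)%R.
by apply: eq_bigr => i _; rewrite e rV_consS !mxE.
Qed.

Lemma measurable_sqnorm_center n (x : 'rV[R]_n) :
  measurable_fun setT (fun v : 'rV[R]_n => sqnorm (v - x)%R).
Proof.
apply: measurable_sum => i; apply: measurable_funX.
under eq_fun do rewrite !mxE.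
by apply: measurable_funB => //; exact: measurable_coord.
Qed.

Lemma integral_gauss_rV n (b : R) (x : 'rV[R]_n) : (0 < b)%R ->
  \int[lebesgue_rV R n]_v (expR (- b * sqnorm (v - x)))%:E =
  ((Num.sqrt (pi / b)) ^+ n)%:E.
Proof.
move=> b0.
have mg k (y : 'rV[R]_k) : measurable_fun setT (fun v : 'rV[R]_k => (expR (- b * sqnorm (v - y)))%:E).
  have := measurable_sqnorm_center y => ms; mfun.
elim: n x => [|n IH] x.
  rewrite ge0_integral_rV0; last exact: mg.
  by rewrite /sqnorm big_ord0 mulr0 expR0 expr0.
rewrite ge0_integral_rV_cons//.
under eq_integral => a _.
  under eq_integral => v _.
    rewrite (sqnorm_rV_cons x (erefl (rV_cons (a, v)))) mulrDr expRD EFinM.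
    over.
  rewrite ge0_integralZl//; last exact: mg.
  rewrite IH.
  over.
rewrite ge0_integralZr//; last by mfun.
by rewrite integral_gauss_center// -EFinM exprS.
Qed.

End change_of_variables.

(** * Square-integrable functions have finite energy *)

Section kernel_schur.
Context d (X : measurableType d) (R : realType).
Variable mu : {sigma_finite_measure set X -> \bar R}.

(** The Schur test: a symmetric kernel with bounded row masses is a bounded
quadratic form on square-integrable functions. *)
Lemma kernel_form_schur (K : X * X -> R) (f chi : X -> R) (C : R) :
  measurable_fun setT f -> measurable_fun setT chi -> measurable_fun setT K ->
  (forall x, 0 <= f x) -> (forall x, chi x = 0 \/ chi x = 1) ->
  (forall x, chi x = 0 -> f x = 0) ->
  (forall z, 0 <= K z) -> (forall x y, K (x, y) = K (y, x)) -> 0 <= C ->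
  (forall x, chi x = 1 -> (\int[mu]_y (K (x, y) * chi y)%:E <= C%:E)%E) ->
  (kernel_form mu K f f <= C%:E * \int[mu]_x ((f x) ^+ 2)%:E)%E.
Proof.
move=> mf mchi mK f0 chi01 fchi K0 Ksym C0 KC.
have chi0 x : 0 <= chi x by case: (chi01 x) => ->.
pose f2 (x : X) : R := f x ^+ 2.
have f20 x : 0 <= f2 x by exact: sqr_ge0.
have mf2 : measurable_fun setT f2 by rewrite /f2; mfun.
pose g1 (z : X * X) : \bar R := (f2 z.1 * K z * chi z.2)%:E.
pose g2 (z : X * X) : \bar R := (chi z.1 * K z * f2 z.2)%:E.
have g10 z : (0 <= g1 z)%E by rewrite lee_fin !mulr_ge0.
have g20 z : (0 <= g2 z)%E by rewrite lee_fin !mulr_ge0.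
have m1 : measurable_fun setT g1 by rewrite /g1; mfun.
have m2 : measurable_fun setT g2 by rewrite /g2; mfun.
apply: (@le_trans _ _ (kernel_form mu K f2 chi)).
  have sym : kernel_form mu K f2 chi = kernel_form mu K chi f2 by exact: kernel_form_sym.
  rewrite -(@lee_pmul2l _ 2%:E)//.
  have -> : (2%:E * kernel_form mu K f2 chi = \int[(mu \x mu)%E]_z (g1 z + g2 z))%E.
    by rewrite ge0_integralD// (_ : 2%:E = 1 + 1)%E ?ge0_muleDl ?mul1e//; congr (_ + _)%E.
  rewrite /kernel_form -ge0_integralZl//; last 2 first.
  - by mfun.
  - by move=> z _; rewrite lee_fin !mulr_ge0.
  apply: ge0_le_integral => //.
  - by move=> z _; rewrite -EFinM lee_fin !mulr_ge0.
  - by apply: measurable_funeM; mfun.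
  - exact: emeasurable_funD.
  - move=> z _; rewrite -EFinM -EFinD lee_fin.
    case: (chi01 z.1) => h1; first by rewrite (fchi _ h1) h1 !mul0r mulr0 /f2 (fchi _ h1) expr0n !mul0r addr0.
    case: (chi01 z.2) => h2; first by rewrite /f2 (fchi _ h2) h2 expr0n !mulr0 addr0.
    have := mulr_ge0 (K0 z) (sqr_ge0 (f z.1 - f z.2)).
    by rewrite h1 h2 /f2; nra.
rewrite /kernel_form (fubini_tonelli1 g1)//.
rewrite -ge0_integralZl//; last 2 first.
- by mfun.
- by move=> x _; rewrite lee_fin ?sqr_ge0.
apply: ge0_le_integral => //.
- by move=> x _; apply: integral_ge0 => y _.
- exact: (measurable_fun_fubini_tonelli_F g1).
- by apply: measurable_funeM; mfun.
- move=> x _; rewrite /fubini_F/= /g1/=.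
  have mKx : measurable_fun setT (fun y : X => K (x, y)).
    exact: (measurableT_comp mK (measurable_pair1 x)).
  under eq_integral do rewrite -mulrA EFinM.
  rewrite ge0_integralZl//; [|by mfun|by move=> y _; rewrite lee_fin mulr_ge0|by rewrite lee_fin].
  rewrite muleC; case: (chi01 x) => h; last by apply: lee_wpmul2r; [rewrite lee_fin|exact: KC].
  by rewrite /f2 fchi// expr0n/= !mule0.
Qed.

End kernel_schur.

Section schur.
Context {R : realType}.
Local Notation leb := (@lebesgue_measure R).
Variable a : R.
Hypothesis a01 : 0 < a < 1.

Let powint (t : R) : 0 < t ->
  (\int[leb]_w (if (0 < w) && (w <= t) then w `^ (- a) else 0)%:E =
   (t `^ (1 - a) / (1 - a))%:E)%E.
Proof.
move=> t0; have a1 : -1 < - a by move: a01 => /andP[]; lra.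
have := integral_powR0 a1 t0; rewrite integral_mkcond/= addrC => <-.
apply: eq_integral => w _; rewrite patchE mem_setE in_itv/=.
by case: ifP.
Qed.

Let mpow (t : R) : measurable_fun setT
  (fun w : R => (if (0 < w) && (w <= t) then w `^ (- a) else 0)%:E).
Proof. by mfun. Qed.

Let pow_ge0 (t w : R) : (0 <= (if (0 < w) && (w <= t) then w `^ (- a) else 0)%:E)%E.
Proof. by rewrite lee_fin; case: ifP => // _; exact: powR_ge0. Qed.

Lemma riesz_mass_half (u : R) : 0 < u ->
  (\int[leb]_v (riesz a (u, v) * (if (0 <= v) && (v < u) then 1 else 0))%:E =
   (u `^ (1 - a) / (1 - a))%:E)%E.
Proof.
move=> u0; have mr := @measurable_riesz R a; rewrite -powint//.
pose f (v : R) : \bar R := (riesz a (u, v) * (if (0 <= v) && (v < u) then 1 else 0))%:E.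
have f0 v : (0 <= f v)%E by rewrite lee_fin mulr_ge0 ?powR_ge0//; case: ifP.
have mf : measurable_fun setT f by rewrite /f; mfun.
have mfN : measurable_fun setT (fun v : R => f (- v)).
  by apply: (measurableT_comp mf); exact: oppr_measurable.
apply: (etrans (esym (ge0_integral_opp mf f0))).
apply: (etrans (esym (ge0_integral_shift (- u) mfN (fun v => f0 _)))).
apply: eq_integral => v _; congr EFin; rewrite opprB subr_ge0.
rewrite ltrBlDr ltrDl [_ && _]andbC; case: ifPn => [/andP[v0 vu]|_]; last by rewrite mulr0.
by rewrite mulr1 /riesz/= opprB addrCA subrr addr0 gtr0_norm.
Qed.

Lemma riesz_mass_le (T u : R) : 0 < u < T ->
  (\int[leb]_v (riesz a (u, v) * (if (0 < v) && (v < T) then 1 else 0))%:E <=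
   (2 * (T `^ (1 - a) / (1 - a)))%:E)%E.
Proof.
move=> /andP[u0 uT]; have T0 : 0 < T by exact: lt_trans uT.
pose k (w : R) := if (0 < w) && (w <= T) then w `^ (- a) else 0.
have kr w : 0 <= k w by have := pow_ge0 T w; rewrite lee_fin.
apply: (@le_trans _ _ (\int[leb]_v ((k (v - u))%:E + (k (- (v - u)))%:E))%E).
  apply: ge0_le_integral => //.
  - by move=> v _; rewrite lee_fin mulr_ge0 ?powR_ge0//; case: ifP.
  - have := @measurable_riesz R a => mr; mfun.
  - by apply: emeasurable_funD; rewrite /k; mfun.
  - move=> v _; rewrite -EFinD lee_fin.
    case: ifPn => [/andP[v0 vT]|_]; last first.
      by rewrite mulr0 addr_ge0.
    rewrite mulr1 /riesz/=.
    have [uv|vu|->] := ltgtP u v.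
    + have -> : k (v - u) = (v - u) `^ (- a).
        by rewrite /k subr_gt0 uv/= (_ : v - u <= T)//; lra.
      by rewrite distrC gtr0_norm ?subr_gt0// lerDl kr.
    + have -> : k (- (v - u)) = (u - v) `^ (- a).
        by rewrite /k opprB subr_gt0 vu/= (_ : u - v <= T)//; lra.
      by rewrite gtr0_norm ?subr_gt0// lerDr kr.
    + rewrite subrr normr0 powR0; last by rewrite oppr_eq0; move: a01 => /andP[]; lra.
      by rewrite addr_ge0.
rewrite ge0_integralD//; last 4 first.
- by move=> v _; rewrite lee_fin.
- by rewrite /k; mfun.
- by move=> v _; rewrite lee_fin.
- by rewrite /k; mfun.
have mk : measurable_fun setT (fun w : R => (k w)%:E) by exact: mpow.
have k0 w : (0 <= (k w)%:E)%E by exact: pow_ge0.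
have mkN : measurable_fun setT (fun w : R => (k (- w))%:E).
  by apply: (measurableT_comp mk); exact: oppr_measurable.
rewrite (ge0_integral_shift (- u) mk k0) (ge0_integral_shift (- u) mkN (fun w => k0 _)).
by rewrite (ge0_integral_opp mk k0) powint// -EFinD lee_fin; lra.
Qed.

Lemma riesz_form_schur (T : R) (f : R -> R) : measurable_fun setT f ->
  (forall x, 0 <= f x) -> (forall x, ~~ ((0 < x) && (x < T)) -> f x = 0) ->
  (kernel_form leb (riesz a) f f <=
   (2 * (T `^ (1 - a) / (1 - a)))%:E * \int[leb]_x ((f x) ^+ 2)%:E)%E.
Proof.
move=> mf f0 fT; pose chi (x : R) : R := if (0 < x) && (x < T) then 1 else 0.
have mchi : measurable_fun setT chi by rewrite /chi; mfun.
have a1 : 0 < 1 - a by move: a01 => /andP[]; lra.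
apply: (@kernel_form_schur _ (measurableTypeR R) R leb _ f chi) => //.
- exact: measurable_riesz.
- by move=> x; rewrite /chi; case: ifP; [right|left].
- by move=> x; rewrite /chi; case: ifPn => [_ /eqP|/fT//]; rewrite oner_eq0.
- by move=> z; exact: powR_ge0.
- by move=> u v; rewrite /riesz distrC.
- by rewrite mulr_ge0// divr_ge0 ?powR_ge0 ?ltW.
- move=> x; rewrite /chi; case: ifPn => [xT _|_ /esym/eqP]; last by rewrite oner_eq0.
  exact: riesz_mass_le.
Qed.

End schur.

(** * Semi-inner products *)

Lemma discriminant_le (R : realFieldType) (a b c : R) : 0 <= c ->
  (forall t : R, 0 <= a - 2 * t * b + t ^+ 2 * c) -> b ^+ 2 <= a * c.
Proof.
move=> c0 h; have [c00|c00] := eqVneq c 0.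
  have [->|b0] := eqVneq b 0; first by rewrite c00 mulr0 expr2 mul0r.
  have := h ((a + 1) / (2 * b)); rewrite c00 mulr0 addr0.
  have -> : 2 * ((a + 1) / (2 * b)) * b = a + 1 by field.
  lra.
have cp : 0 < c by rewrite lt_neqAle eq_sym c00.
have := h (b / c).
have -> : a - 2 * (b / c) * b + (b / c) ^+ 2 * c = a - b ^+ 2 / c by field.
by rewrite subr_ge0 ler_pdivrMr.
Qed.

(** The energy form and the covariance are both treated through this interface:
two maps into such spaces that agree on a dense part agree in the limit. *)
Section semi_inner_product.
Context {R : realType} {U : Type}.
Variables (dom : (U -> R) -> Prop) (b : (U -> R) -> (U -> R) -> R).

Record semi_inner : Prop := SemiInner {
  dom_comb : forall c f g, dom f -> dom g -> dom (fun z => f z + c * g z);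
  inner_sym : forall f g, dom f -> dom g -> b f g = b g f;
  inner_combl : forall c f g h, dom f -> dom g -> dom h ->
    b (fun z => f z + c * g z) h = b f h + c * b g h;
  inner_ge0 : forall f, dom f -> 0 <= b f f }.

Hypothesis hb : semi_inner.

Let subE' (f g : U -> R) : f \- g = fun z => f z + (-1) * g z.
Proof. by apply/funext => z; rewrite mulN1r. Qed.

Lemma dom_sub f g : dom f -> dom g -> dom (f \- g).
Proof. by move=> df dg; rewrite subE'; exact: dom_comb. Qed.

Lemma inner_Bl f g h : dom f -> dom g -> dom h -> b (f \- g) h = b f h - b g h.
Proof. by move=> df dg dh; rewrite subE' (inner_combl hb)// mulN1r. Qed.

Lemma inner_Br f g h : dom f -> dom g -> dom h -> b h (f \- g) = b h f - b h g.
Proof.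
move=> df dg dh.
by rewrite (inner_sym hb)//; [rewrite inner_Bl// !(inner_sym hb dh)|exact: dom_sub].
Qed.

Lemma inner_sqrB f g : dom f -> dom g -> b (f \- g) (f \- g) = b f f - 2 * b f g + b g g.
Proof.
move=> df dg; have dd := dom_sub df dg.
by rewrite inner_Bl// !inner_Br// (inner_sym hb dg df); ring.
Qed.

Lemma inner_subC f g : dom f -> dom g -> b (f \- g) (f \- g) = b (g \- f) (g \- f).
Proof. by move=> df dg; rewrite !inner_sqrB// (inner_sym hb df dg); ring. Qed.

Lemma inner_triangle f g h : dom f -> dom g -> dom h ->
  b (f \- h) (f \- h) <= 2 * b (f \- g) (f \- g) + 2 * b (g \- h) (g \- h).
Proof.
move=> df dg dh; have dp := dom_sub df dg; have dq := dom_sub dg dh.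
pose p := f \- g; pose q := g \- h.
have -> : f \- h = fun z => p z + 1 * q z by apply/funext => z; rewrite /p /q/=; ring.
have dpq : dom (fun z => p z + 1 * q z) by exact: (dom_comb hb).
have := inner_ge0 hb (dom_sub dp dq); rewrite inner_sqrB// -/p -/q.
rewrite (inner_combl hb)// (inner_sym hb dp dpq) (inner_sym hb dq dpq).
by rewrite !(inner_combl hb)// (inner_sym hb dq dp); lra.
Qed.

Lemma inner_CS f g : dom f -> dom g -> b f g ^+ 2 <= b f f * b g g.
Proof.
move=> df dg; apply: discriminant_le; first exact: (inner_ge0 hb).
move=> t; pose h z := f z + (- t) * g z.
have dh : dom h by exact: (dom_comb hb).
have := inner_ge0 hb dh.
have bl k : dom k -> b h k = b f k - t * b g k.
  by move=> dk; rewrite /h (inner_combl hb)// mulNr.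
rewrite bl// (inner_sym hb df dh) (inner_sym hb dg dh) !bl// (inner_sym hb dg df).
by congr (_ <= _); ring.
Qed.

Lemma cvg_sqr0 (u v : nat -> R) : (forall n, v n ^+ 2 <= u n) ->
  u n @[n --> \oo] --> 0 -> v n @[n --> \oo] --> 0.
Proof.
move=> vu u0; apply/cvgrPdist_lt => e e0.
have e2 : 0 < e ^+ 2 by rewrite exprn_gt0.
have /cvgrPdist_lt/(_ _ e2) := u0; apply: filterS => n.
rewrite !sub0r !normrN => h; rewrite -ltr_sqr ?nnegrE ?(ltW e0)//.
rewrite real_normK ?num_real//; apply: le_lt_trans (vu n) _.
by apply: le_lt_trans h; exact: ler_norm.
Qed.

Lemma inner_cvg (f_ g_ : nat -> U -> R) f g :
  (forall n, dom (f_ n)) -> (forall n, dom (g_ n)) -> dom f -> dom g ->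
  b (f_ n \- f) (f_ n \- f) @[n --> \oo] --> 0 ->
  b (g_ n \- g) (g_ n \- g) @[n --> \oo] --> 0 ->
  b (f_ n) (g_ n) @[n --> \oo] --> b f g.
Proof.
move=> df_ dg_ df dg cf cg.
have dF n := dom_sub (df_ n) df; have dG n := dom_sub (dg_ n) dg.
rewrite (_ : (fun n => b (f_ n) (g_ n)) = (fun n => b f g + (b (f_ n \- f) g +
    (b f (g_ n \- g) + b (f_ n \- f) (g_ n \- g))))); last first.
  by apply/funext => n; rewrite !inner_Bl// !inner_Br//; ring.
rewrite -[X in _ --> X]addr0; apply: cvgD; first exact: cvg_cst.
rewrite -[X in _ --> X](addr0 0); apply: cvgD; last rewrite -[X in _ --> X](addr0 0); last apply: cvgD.
- apply: (@cvg_sqr0 (fun n => b (f_ n \- f) (f_ n \- f) * b g g)).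
    by move=> n; exact: inner_CS.
  by rewrite -(mul0r (b g g)); apply: cvgM => //; exact: cvg_cst.
- apply: (@cvg_sqr0 (fun n => b f f * b (g_ n \- g) (g_ n \- g))).
    by move=> n; exact: inner_CS.
  by rewrite -(mulr0 (b f f)); apply: cvgM => //; exact: cvg_cst.
- apply: (@cvg_sqr0 (fun n => b (f_ n \- f) (f_ n \- f) * b (g_ n \- g) (g_ n \- g))).
    by move=> n; exact: inner_CS.
  by rewrite -(mulr0 0); exact: cvgM.
Qed.

End semi_inner_product.

Lemma H_semi_inner (R : realType) (d : nat) (T H : R) : 2^-1 < H < 1 ->
  semi_inner (@H_finite R d T H) (@H_inner R d T H).
Proof.
move=> hH; split.
- exact: H_finite_comb.
- exact: H_inner_sym.
- exact: H_inner_combl.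
- exact: H_inner_ge0.
Qed.

(** * Approximation in the space of the noise *)

Section approximation.
Context {R : realType} {d : nat}.
Variables (T H : R).
Hypotheses (hT : 0 < T) (hH : 2^-1 < H < 1).
Local Notation E := (R * 'rV[R]_d)%type.
Local Notation mE := (measurableTypeR R * 'rV[R]_d)%type.
Local Notation leb := (@lebesgue_measure R).
Local Notation mu := (spacetime_measure R d).
Local Notation strip := (@open_strip R d T).

Let mS : measurable (strip : set mE). Proof. exact: measurable_open_strip. Qed.
Let mT (f : mE -> R) : measurable_fun setT f -> measurable_fun strip f.
Proof. by move=> mf; exact: measurable_funTS. Qed.

Definition schur_const : R := 2 * (T `^ (1 - (2 - 2 * H)) / (1 - (2 - 2 * H))).

Lemma energy_L2 (f : E -> R) : measurable_fun (strip : set mE) f ->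
  (energy T H f f <= schur_const%:E * \int[mu]_(z in strip) ((f z) ^+ 2)%:E)%E.
Proof.
move=> mf; rewrite energy_fubini//.
have ma := measurable_abs_ext mf.
have mx (x : 'rV[R]_d) : measurable_fun setT (fun t : R => abs_ext T f (t, x)).
  by apply: (measurableT_comp ma); exact: measurable_pair2.
pose q (z : mE) : \bar R := ((abs_ext T f z) ^+ 2)%:E.
have mq : measurable_fun setT q by rewrite /q; mfun.
have q0 z : (0 <= q z)%E by rewrite lee_fin sqr_ge0.
have C0 : 0 <= schur_const.
  by rewrite /schur_const mulr_ge0// divr_ge0 ?powR_ge0//; move: hH => /andP[]; lra.
apply: (@le_trans _ _ (\int[lebesgue_rV R d]_x (schur_const%:E * \int[leb]_t q (t, x)))%E).
  apply: ge0_le_integral => //.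
  - by move=> x _; apply: kernel_form_ge0 => t; exact: abs_ext_ge0.
  - exact: measurable_kernel_form_ext.
  - apply: measurable_funeM.
    exact: (@measurable_fun_fubini_tonelli_G _ _ (measurableTypeR R) _ R leb q mq q0).
  - move=> x _; apply: (riesz_form_schur _ (mx x)).
    + by move: hH => /andP[]; lra.
    + by move=> t; exact: abs_ext_ge0.
    + by move=> t /negbTE tT; rewrite /abs_ext/= tT.
rewrite ge0_integralZl//; last 2 first.
- exact: (@measurable_fun_fubini_tonelli_G _ _ (measurableTypeR R) _ R leb q mq q0).
- by move=> x _; apply: integral_ge0 => t _.
rewrite (_ : (\int[lebesgue_rV R d]_x \int[leb]_t q (t, x))%E = (\int[mu]_z q z)%E); last first.
  by apply: esym; exact: (@fubini_tonelli2 _ _ (measurableTypeR R) _ R leb (lebesgue_rV R d) q mq q0).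
rewrite [in leRHS]integral_mkcond/= le_eqVlt; apply/orP; left; apply/eqP.
congr (_ * _)%E; apply: eq_integral => z _; rewrite patchE /q.
case: ifPn => [/set_mem zS|zS]; first by rewrite abs_ext_in// real_normK ?num_real.
rewrite /abs_ext; case: ifPn => [zz|_]; last by rewrite expr0n.
by case/negP: zS; rewrite inE/=; split => //=; rewrite in_itv.
Qed.

Lemma L2_H_finite (f : E -> R) : measurable_fun (strip : set mE) f ->
  (\int[mu]_(z in strip) ((f z) ^+ 2)%:E < +oo)%E -> H_finite T H f.
Proof.
move=> mf foo; apply/(H_finiteP T H); split => //.
apply: (le_lt_trans (energy_L2 mf)); apply: lte_mul_pinfty => //.
by rewrite lee_fin mulr_ge0// divr_ge0 ?powR_ge0//; move: hH => /andP[]; lra.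
Qed.

Lemma H_inner_le_energy (f g : E -> R) : H_finite T H f -> H_finite T H g ->
  ((H_inner T H f g)%:E <= (H * (2 * H - 1))%:E * energy T H f g)%E.
Proof.
move=> Hf Hg; have a0 := alphaH_gt0 hH.
have i := H_kernel_integrable hH Hf Hg.
rewrite /H_inner EFinM lee_pmul2l//.
rewrite /Rintegral fineK; last by apply: integrable_fin_num => //; exact: measurable_H_domain.
apply: le_integral => //; first exact: measurable_H_domain.
- exact: integrable_abse.
- by move=> w _; exact: lee_abs.
Qed.

(** The squared distance in the completion. *)
Definition hdist (f g : E -> R) : R := H_inner T H (f \- g) (f \- g).

Local Notation HS := (@H_semi_inner R d T H hH).

Lemma hdist_ge0 (f g : E -> R) : H_finite T H f -> H_finite T H g -> 0 <= hdist f g.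
Proof. by move=> Hf Hg; exact: (inner_ge0 HS (dom_sub HS Hf Hg)). Qed.

Lemma hdistC (f g : E -> R) : H_finite T H f -> H_finite T H g -> hdist f g = hdist g f.
Proof. exact: (inner_subC HS). Qed.

Lemma hdist_triangle (f g h : E -> R) :
  H_finite T H f -> H_finite T H g -> H_finite T H h ->
  hdist f h <= 2 * hdist f g + 2 * hdist g h.
Proof. exact: (inner_triangle HS). Qed.

Definition strip_code (c : @qcode d) : Prop :=
  forall x, x \in c -> (0 : R) < qreal x.2.2.1 None /\ (qreal x.2.2.2 None : R) < T.

Lemma test_function_qcomb (c : @qcode d) : strip_code c -> test_function strip (qcomb c).
Proof.
move=> cS.
have [K [cK clK KS qK]] : exists K : set E, [/\ compact K, closed K, K `<=` strip &
    [set z | qcomb c z != 0] `<=` K].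
  elim: c cS => [|x c ih] cS.
    exists set0; split; [exact: compact0|exact: closed0|by []|].
    by move=> z/=; rewrite /qcomb big_nil eqxx.
  have [|K [cK clK KS qK]] := ih; first by move=> y yc; apply: cS; rewrite in_cons yc orbT.
  exists (closed_box (qreal x.2.2.1) (qreal x.2.2.2) `|` K); split.
  - by apply: compactU => //; exact: closed_box_compact.
  - by apply: closedU => //; exact: closed_closed_box.
  - rewrite subUset; split => // z /(_ None)/andP[/= h1 h2].
    have [l0 uT] := cS _ (mem_head _ _).
    by split => //=; rewrite in_itv/= (lt_le_trans l0 h1) (le_lt_trans h2 uT).
  - move=> z/=; rewrite /qcomb big_cons.
    have [->|nz] := eqVneq (bump x.2.1 (qreal x.2.2.1) (qreal x.2.2.2) z : R) 0.
      by rewrite mulr0 add0r => h; right; exact: qK.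
    by move=> _; left; apply: (@bump_support _ _ x.2.1); exact: subset_closure.
have sub : closure [set z | qcomb c z != 0] `<=` K by rewrite [X in _ `<=` X](closure_id K).1//; exact: closure_subset.
split; last exact: subset_trans KS.
- apply: diff_upto_smooth => n; rewrite /qcomb; elim: c {cS qK sub} => [|x c ih].
    by under eq_fun do rewrite big_nil; exact: diff_upto_cst.
  under eq_fun do rewrite big_cons.
  apply: (@diff_uptoD _ _ n) => //.
  by apply: (@diff_uptoM _ _ n); [exact: diff_upto_cst|exact: diff_upto_bump].
- by apply: (subclosed_compact _ cK sub); exact: closed_closure.
Qed.

Lemma test_function_bounded (phi : E -> R) : test_function strip phi ->
  exists l u M, [/\ forall z, phi z != 0 -> box l u z, forall z, `|phi z| <= M &
    forall z, ~ strip z -> phi z = 0].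
Proof.
move=> [/(_ [::])/=[cphi _] cK KS]; set K := closure _ in cK KS.
have KP z : ~ K z -> phi z = 0.
  by move=> nK; apply/eqP/negPn/negP => h; apply: nK; exact: subset_closure.
have bnd (f : E -> R) : continuous f -> exists M, forall z, K z -> `|f z| < M.
  move=> cf.
  have : compact (f @` K) by apply: continuous_compact => //; exact: continuous_subspaceT.
  move=> /compact_bounded [M [_ hM]]; exists (M + 2) => z Kz.
  have := hM (M + 1); rewrite ltrDl ltr01 => /(_ isT (f z)).
  by move=> h; apply: (@le_lt_trans _ _ (M + 1)); [apply: h; exists z|rewrite ltrD2l ltr1n].
have [M hM] := bnd phi cphi.
have /choice[B hB] : forall i : option 'I_d, exists M, forall z, K z -> `|coord i z| < M.
  by move=> i; apply: bnd; exact: continuous_coord.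
exists (fun i => - B i), B, (Num.max M 0); split.
- by move=> z pz i; rewrite -ltr_norml; apply: hB; exact: subset_closure.
- move=> z; have [/hM/ltW h|/KP ->] := pselect (K z); first by rewrite le_max h.
  by rewrite normr0 le_max lexx orbT.
- by move=> z nS; apply: KP => /KS.
Qed.

Lemma test_function_measurable (phi : E -> R) : test_function strip phi ->
  measurable_fun (setT : set mE) phi.
Proof.
by move=> [/(_ [::])/=[cphi _] _ _]; exact: continuous_measurable_spacetime.
Qed.

Lemma test_function_integrable (phi : E -> R) : test_function strip phi ->
  (\int[mu]_z `|phi z|%:E < +oo)%E.
Proof.
move=> tphi; have mphi := test_function_measurable tphi.
have [l [u [M [hbox hM _]]]] := test_function_bounded tphi.
have M0 : 0 <= M by exact: le_trans (hM 0).
have mB : measurable (box l u : set mE) by exact: measurable_box.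
apply: (@le_lt_trans _ _ (\int[mu]_(z in box l u) M%:E)%E); last first.
  by rewrite integral_cst// lte_mul_pinfty//; exact: spacetime_box_fin.
rewrite [leRHS]integral_mkcond; apply: ge0_le_integral => //.
- by mfun.
- by apply/(measurable_restrictT _ _).1 => //; exact: measurable_cst.
- move=> z _; rewrite patchE; case: ifPn => [_|/negP zB]; first by rewrite lee_fin.
  have [->|/hbox h] := eqVneq (phi z) 0; first by rewrite normr0.
  by case: zB; rewrite inE.
Qed.

Lemma test_function_L2 (phi : E -> R) : test_function strip phi ->
  (\int[mu]_(z in strip) ((phi z) ^+ 2)%:E < +oo)%E.
Proof.
move=> tphi; have mphi := test_function_measurable tphi.
have [l [u [M [hbox hM _]]]] := test_function_bounded tphi.
have M0 : 0 <= M by exact: le_trans (hM 0).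
apply: (@le_lt_trans _ _ (\int[mu]_z (M%:E * `|phi z|%:E))%E); last first.
  rewrite ge0_integralZl//; last by mfun.
  by apply: lte_mul_pinfty => //; exact: test_function_integrable.
rewrite [leLHS]integral_mkcond; apply: ge0_le_integral => //.
- by move=> z _; rewrite patchE; case: ifP => // _; rewrite lee_fin sqr_ge0.
- by apply/(measurable_restrictT _ _).1 => //; apply: measurable_funTS; mfun.
- by apply: measurable_funeM; mfun.
- move=> z _; rewrite patchE -EFinM; case: ifPn => _; last by rewrite lee_fin mulr_ge0.
  by rewrite lee_fin -real_normK ?num_real// expr2 ler_wpM2r.
Qed.

Lemma test_function_H_finite (phi : E -> R) : test_function strip phi -> H_finite T H phi.
Proof.
move=> tphi; apply: L2_H_finite; last exact: test_function_L2.
by apply: measurable_funTS; exact: test_function_measurable.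
Qed.

Lemma qcomb_H_finite c : strip_code c -> H_finite T H (qcomb c).
Proof. by move=> /test_function_qcomb; exact: test_function_H_finite. Qed.

(** Approximants are taken in a countable family, so that they can later be
selected measurably. *)
Definition H_approximable (f : E -> R) : Prop := H_finite T H f /\
  forall e, 0 < e -> exists2 c, strip_code c & hdist (qcomb c) f < e.

Lemma H_approximable_in_H (f : E -> R) : H_approximable f -> in_H T H f.
Proof.
move=> [Hf af].
have /choice[c hc] : forall n : nat, exists c : @qcode d, strip_code c /\ hdist (qcomb c) f < n.+1%:R^-1.
  by move=> n; have [|c] := af n.+1%:R^-1; [rewrite invr_gt0|exists c].
exists (fun n => qcomb (c n)); split.
- by move=> n; apply: test_function_qcomb; exact: (hc n).1.
- by move=> n; apply: H_finiteB => //; apply: qcomb_H_finite; exact: (hc n).1.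
- apply: (@squeeze_cvgr _ _ _ _ (cst 0) (@harmonic R)).
  + near=> n; apply/andP; split; last exact: ltW (hc n).2.
    by apply: hdist_ge0 => //; apply: qcomb_H_finite; exact: (hc n).1.
  + exact: cvg_cst.
  + exact: cvg_harmonic.
Unshelve. all: by end_near.
Qed.

Lemma H_approximable_lim (f : E -> R) : H_finite T H f ->
  (forall e, 0 < e -> exists2 g, H_approximable g & hdist g f < e) ->
  H_approximable f.
Proof.
move=> Hf lf; split=> // e e0.
have e4 : 0 < e / 4 by lra.
have [g [Hg ag] gf] := lf _ e4; have [c cS cg] := ag _ e4.
exists c => //; apply: le_lt_trans (hdist_triangle (qcomb_H_finite cS) Hg Hf) _.
lra.
Qed.

Lemma L2_hdist (f g : E -> R) : H_finite T H f -> H_finite T H g ->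
  ((hdist f g)%:E <= (H * (2 * H - 1) * schur_const)%:E * sqd mu strip f g)%E.
Proof.
move=> Hf Hg; have Hfg := H_finiteB hH Hf Hg.
apply: (le_trans (H_inner_le_energy Hfg Hfg)).
rewrite [in leRHS]EFinM -muleA lee_pmul2l//; last by rewrite lte_fin; exact: alphaH_gt0.
by apply: energy_L2; exact: Hfg.1.
Qed.

Definition strip_lower (n : nat) (i : option 'I_d) : R :=
  if i is Some _ then - n%:R else n.+1%:R^-1.
Definition strip_upper (n : nat) (i : option 'I_d) : R :=
  if i is Some _ then n%:R else T - n.+1%:R^-1.

Lemma strip_boxS n : box (strip_lower n) (strip_upper n) `<=` strip.
Proof.
move=> z /(_ None)/andP[/= h1 h2]; split => //=; rewrite in_itv/=.
have : 0 < n.+1%:R^-1 :> R by rewrite invr_gt0.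
by move: (n.+1%:R^-1) h1 h2 => w; lra.
Qed.

Lemma strip_box_code n (c : @qcode d) :
  qcode_in (strip_lower n) (strip_upper n) c -> strip_code c.
Proof.
move=> cB x /cB/(_ None)[/= h1 h2]; have : 0 < n.+1%:R^-1 :> R by rewrite invr_gt0.
by move: (n.+1%:R^-1) h1 h2 => w; lra.
Qed.

Lemma strip_exhaustion (z : E) : strip z ->
  \forall n \near \oo, box (strip_lower n) (strip_upper n) z.
Proof.
move=> [/=]; rewrite in_itv/= => /andP[z0 zT] _.
pose m (i : option 'I_d) : R := if i is Some j then `|z.2 ord0 j| else Num.max z.1^-1 (T - z.1)^-1.
have : \forall n \near \oo, forall i, m i < n%:R.
  apply: filter_forall => i; near=> n; apply: (lt_le_trans (truncnS_gt (m i))).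
  by rewrite ler_nat; near: n; exists (Num.truncn (m i)).+1.
apply: filterS => n hn -[j|]/=.
  by rewrite -ltr_norml; exact: (hn (Some j)).
have := hn None; rewrite /m gt_max => /andP[h1 h2].
have n1 : (n%:R : R) < n.+1%:R by rewrite ltr_nat.
apply/andP; split; first by rewrite invf_plt ?posrE//; exact: lt_trans n1.
rewrite ltrBrDl -ltrBrDr invf_plt ?posrE ?subr_gt0//; exact: lt_trans n1.
Unshelve. all: by end_near.
Qed.

(** The strip is exhausted by boxes, on which rational bumps are dense in the
mean square sense. *)
Lemma L2_H_approximable (f : E -> R) : measurable_fun (setT : set mE) f ->
  (\int[mu]_(z in strip) ((f z) ^+ 2)%:E < +oo)%E -> H_approximable f.
Proof.
move=> mf foo; have Hf : H_finite T H f by apply: L2_H_finite => //; exact: measurable_funTS.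
split=> // e e0.
pose l := strip_lower; pose u := strip_upper.
pose fn n (z : E) : R := f z * \1_(box (l n) (u n)) z.
have mbox n : measurable (box (l n) (u n) : set mE) by exact: measurable_box.
have mfn n : measurable_fun (setT : set mE) (fn n).
  by apply: measurable_funM => //; exact: measurable_indic.
have boxS := strip_boxS.
have fnf n z : `|fn n z| <= `|f z|.
  by rewrite /fn normrM ler_piMr// indicE; case: (_ \in _); rewrite ?normr1 ?normr0.
have lim z : strip z -> fn n z @[n --> \oo] --> f z.
  move=> zS; apply: cvg_near_cst; apply: filterS (strip_exhaustion zS) => n zB.
  by rewrite /fn indicE mem_set// mulr1.
have mabs : measurable_fun (setT : set mE) (fun z : mE => `|f z|) by mfun.
have foo' : (\int[mu]_(z in strip) (`|f z| ^+ 2)%:E < +oo)%E.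
  by under eq_integral do rewrite real_normK ?num_real//.
have cv := sqd_dominated mS (fun n => mT (mfn n)) (mT mf) (mT mabs) lim (fun n z _ => fnf n z) foo'.
pose C := H * (2 * H - 1) * schur_const.
have C0 : 0 < C.
  rewrite /C mulr_gt0 ?alphaH_gt0// /schur_const mulr_gt0// divr_gt0 ?powR_gt0//.
  by move: hH => /andP[]; lra.
pose e' := e / (8 * C).
have e'0 : 0 < e' by rewrite divr_gt0// mulr_gt0.
have [n hn] : exists n, (sqd mu strip f (fn n) < e'%:E)%E.
  by have [N _ /(_ N (leqnn N))] := cvge0_lt e'0 cv; exists N.
have fnoo : (\int[mu]_(z in box (l n) (u n)) ((fn n z) ^+ 2)%:E < +oo)%E.
  apply: le_lt_trans foo; apply: (@le_trans _ _ (\int[mu]_(z in box (l n) (u n)) ((f z) ^+ 2)%:E)%E).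
    apply: ge0_le_integral => //.
    - by move=> z _; rewrite lee_fin sqr_ge0.
    - by apply: measurable_funTS; have mfnn := mfn n; mfun.
    - by apply: measurable_funTS; mfun.
    - by move=> z _; rewrite lee_fin -[leLHS]real_normK ?num_real// -[leRHS]real_normK ?num_real// lerXn2r// nnegrE.
  apply: ge0_subset_integral => //.
  - by apply: measurable_funTS; mfun.
  - by move=> z _; rewrite lee_fin sqr_ge0.
have [_ /(_ _ e'0)[c cB hc]] := L2_approximable (mfn n) fnoo.
have cS := strip_box_code cB.
exists c => //; rewrite -lte_fin; apply: le_lt_trans (L2_hdist (qcomb_H_finite cS) Hf) _.
rewrite -/C sqdC; apply: (@le_lt_trans _ _ (C%:E * (4 * e')%:E)%E); last first.
  rewrite -EFinM lte_fin /e' (_ : C * (4 * (e / (8 * C))) = e / 2); last by field; rewrite gt_eqF.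
  by rewrite ltr_pdivrMr// ltr_pMr// ltr1n.
rewrite lee_pmul2l//.
apply: (le_trans (sqd_triangle mu mS (mT mf) (mT (mfn n)) (mT (measurable_qcomb c)))).
have -> : sqd mu strip (fn n) (qcomb c) = sqd mu (box (l n) (u n)) (fn n) (qcomb c).
  rewrite /sqd [LHS]integral_mkcond [RHS]integral_mkcond; apply: eq_integral => z _.
  rewrite !patchE; have [zB|nB] := pselect (box (l n) (u n) z).
    by rewrite (mem_set zB) (mem_set (boxS _ _ zB)).
  rewrite (memNset nB); case: ifP => // _.
  by rewrite (qcomb_out cB nB) /fn indicE memNset// mulr0 subrr expr0n.
rewrite (_ : 4 * e' = 2 * e' + 2 * e'); last ring.
by rewrite (EFinD (2 * e')) !EFinM leeD// lee_pmul2l// ltW.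
Qed.

End approximation.

(** * Mean square limits *)

Lemma limn_einf_le (R : realType) (u : (\bar R)^nat) (c : \bar R) :
  (forall n, (u n <= c)%E) -> (limn_einf u <= c)%E.
Proof.
move=> uc; rewrite limn_einf_lim; apply: lime_le; first exact: is_cvg_einfs.
by near=> n; apply: le_trans (uc n); apply: ereal_inf_lbound; exists n => /=.
Unshelve. all: by end_near.
Qed.

(** The real limit of a convergent sequence, chosen so that limits of
measurable functions are measurable. *)
Definition real_limit (R : realType) (X : Type) (f : nat -> X -> R) (w : X) : R :=
  fine (limn_esup (fun n => (f n w)%:E)).

Lemma real_limitE (R : realType) (X : Type) (f : nat -> X -> R) (w : X) (l : R) :
  f n w @[n --> \oo] --> l -> real_limit f w = l.
Proof.
move=> fl; rewrite /real_limit.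
have h : (fun n => (f n w)%:E) @ \oo --> l%:E by apply: cvg_EFin; [exact: nearW|exact: fl].
by rewrite is_cvg_limn_esupE; [rewrite (cvg_lim _ h)|apply/cvg_ex; exists l%:E].
Qed.

Lemma measurable_real_limit d (X : measurableType d) (R : realType)
    (f : nat -> X -> R) (D : set X) : measurable D ->
  (forall n, measurable_fun D (f n)) -> measurable_fun D (real_limit f).
Proof.
move=> mD mf; apply: (@measurableT_comp _ _ _ _ _ _ (@fine R)) => //.
by apply: measurable_fun_limn_esup => n; apply/measurable_EFinP; exact: mf.
Qed.

Section mean_square_limit.
Context d (X : measurableType d) (R : realType) (mu : probability X R).
Variable f : nat -> X -> R.
Hypothesis mf : forall n, measurable_fun setT (f n).
Local Notation q := (4^-1 : R).
Hypothesis fast : forall n, (sqd mu setT (f n) (f n.+1) <= (q ^+ n)%:E)%E.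

Lemma sqd_fast n k : (sqd mu setT (f n) (f (n + k)%N) <= (4 * q ^+ n)%:E)%E.
Proof.
elim: k n => [|k ih] n.
  rewrite addn0 /sqd; under eq_integral do rewrite subrr expr0n/=.
  by rewrite integral0 lee_fin mulr_ge0// exprn_ge0.
rewrite addnS -addSn.
apply: (le_trans (sqd_triangle mu measurableT (mf n) (mf n.+1) (mf _))).
have -> : (4 * q ^+ n)%:E = (2%:E * (q ^+ n)%:E + 2%:E * (4 * q ^+ n.+1)%:E :> \bar R)%E.
  by rewrite -!EFinM -EFinD; congr EFin; rewrite exprS; lra.
by rewrite leeD// lee_pmul2l.
Qed.

Let d_ n (w : X) : R := `|f n.+1 w - f n w|.
Let md n : measurable_fun setT (d_ n).
Proof. by rewrite /d_; have m1 := mf n; have m2 := mf n.+1; mfun. Qed.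

Let d_le n : (\int[mu]_w (d_ n w)%:E <= (2^-1 ^+ n)%:E)%E.
Proof.
pose h := (2^-1 : R) ^+ n; have h0 : 0 < h by rewrite exprn_gt0//; lra.
have hq : h * h = q ^+ n by rewrite -exprMn; congr (_ ^+ n); lra.
have m1 := mf n; have m2 := mf n.+1.
apply: (@le_trans _ _ (\int[mu]_w ((h / 2)%:E + (h^-1 / 2)%:E * ((f n w - f n.+1 w) ^+ 2)%:E))%E).
  apply: ge0_le_integral => //.
  - by move=> w _; rewrite lee_fin normr_ge0.
  - by apply/measurable_EFinP; exact: md.
  - apply: emeasurable_funD; first exact: measurable_cst.
    by apply: measurable_funeM; mfun.
  - move=> w _; rewrite -EFinM -EFinD lee_fin /d_ distrC.
    rewrite -(real_normK (num_real (f n w - f n.+1 w))); set x := `|_|.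
    have := mulr_ge0 (ltW (_ : 0 < h^-1)) (sqr_ge0 (x - h)); rewrite invr_gt0 => /(_ h0).
    have -> : h^-1 * (x - h) ^+ 2 = h^-1 * x ^+ 2 - 2 * x + h.
      by field; rewrite gt_eqF.
    lra.
rewrite ge0_integralD//; last 3 first.
- by move=> w _; rewrite lee_fin divr_ge0// ltW.
- by move=> w _; rewrite -EFinM lee_fin mulr_ge0 ?sqr_ge0// divr_ge0// invr_ge0 ltW.
- by apply: measurable_funeM; mfun.
rewrite integral_cst//= probability_setT mule1 ge0_integralZl//; [|by mfun|by move=> w _; rewrite lee_fin sqr_ge0|by rewrite lee_fin divr_ge0// invr_ge0 ltW].
apply: (@le_trans _ _ ((h / 2)%:E + (h^-1 / 2)%:E * (q ^+ n)%:E)%E).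
  by rewrite leeD2l// lee_pmul2l// ?lte_fin ?divr_gt0 ?invr_gt0//; exact: fast.
by rewrite -EFinM -EFinD lee_fin -hq (_ : h^-1 / 2 * (h * h) = h / 2); [rewrite -splitr|field; rewrite gt_eqF].
Qed.

(** Since 2|x| <= h + x^2 / h for h = 2^-n, the increments are summable in mean,
hence almost surely. *)
Lemma fast_cvg : {ae mu, forall w, cvgn (fun n => f n w)}.
Proof.
have md' n : measurable_fun setT (fun w => (d_ n w)%:E) by apply/measurable_EFinP; exact: md.
have d0 n w : (0 <= (d_ n w)%:E)%E by rewrite lee_fin normr_ge0.
have sfin : (\int[mu]_w (\sum_(n <oo) (d_ n w)%:E) < +oo)%E.
  rewrite integral_nneseries//.
  apply: (@le_lt_trans _ _ (\sum_(n <oo) (2^-1 ^+ n)%:E)%E).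
    by apply: lee_nneseries => // n _ _; apply: integral_ge0.
  have := @cvg_geometric_series R 1 2^-1.
  rewrite ger0_norm//; have h2 : (2^-1 : R) < 1 by lra.
  move=> /(_ h2) cv; rewrite (_ : (\sum_(n <oo) _)%E = (1 / (1 - 2^-1))%:E) ?ltry//.
  apply/cvg_lim => //.
  rewrite (_ : (fun n => _) = EFin \o series (geometric (1 : R) 2^-1)).
    by apply: cvg_EFin => //; exact: nearW.
  by apply/funext => n /=; rewrite sumEFin; congr EFin; apply: eq_bigr => i _; rewrite /= mul1r.
have : mu.-integrable setT (fun w => \sum_(n <oo) (d_ n w)%:E)%E.
  apply/integrableP; split.
    exact: ge0_emeasurable_sum.
  by under eq_integral do rewrite gee0_abs ?nneseries_ge0//.
move=> /(integrable_ae measurableT); apply: filterS => w /(_ I) sw.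
have : cvgn [normed series (telescope (fun n => f n w))].
  apply: nondecreasing_is_cvgn.
    by apply: nondecreasing_series => n _ _; exact: normr_ge0.
  exists (fine (\sum_(n <oo) (d_ n w)%:E)%E) => _ [n _ <-].
  rewrite -lee_fin fineK// /series/= -sumEFin.
  by apply: nneseries_lim_ge.
move=> /normed_cvg; rewrite telescopeK => h.
rewrite (_ : (fun n => f n w) = (fun n => (f n w - f 0 w) + f 0 w)); last by apply/funext => n; rewrite subrK.
by apply: is_cvgD => //; exact: is_cvg_cst.
Qed.

(** Fatou's lemma along the almost sure limit. *)
Lemma sqd_real_limit n : (sqd mu setT (f n) (real_limit f) <= (4 * q ^+ n)%:E)%E.
Proof.
have m1 := mf n; have mX := measurable_real_limit measurableT mf.
pose g k w : \bar R := ((f n w - f (n + k)%N w) ^+ 2)%:E.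
have mg k : measurable_fun setT (g k) by rewrite /g; have m2 := mf (n + k)%N; mfun.
have g0 k w : (0 <= g k w)%E by rewrite lee_fin sqr_ge0.
apply: (@le_trans _ _ (\int[mu]_w limn_einf (g ^~ w))%E); last first.
  apply: (le_trans (fatou mu measurableT mg (fun k w _ => g0 k w))).
  by apply: limn_einf_le => k; exact: sqd_fast.
rewrite /sqd le_eqVlt; apply/orP; left; apply/eqP.
apply: ae_eq_integral => //.
- by mfun.
- apply: (measurableT_comp (@oppe_measurable R setT)) => //.
  apply: measurable_fun_limn_esup => k; apply: (measurableT_comp (@oppe_measurable R setT)) => //; exact: mg.
apply: filterS fast_cvg => w /cvg_ex[l hl] _.
have lim : g k w @[k --> \oo] --> ((f n w - real_limit f w) ^+ 2)%:E.
  apply: cvg_EFin; first exact: nearW.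
  rewrite (real_limitE hl).
  have c : f n w - f (n + k)%N w @[k --> \oo] --> f n w - l.
    apply: cvgB; first exact: cvg_cst.
    rewrite (_ : (fun k => f (n + k)%N w) = [sequence f (k + n)%N w]_k).
      by rewrite (cvg_shiftn n (fun k => f k w)).
    by apply/funext => k; rewrite addnC.
  rewrite expr2; apply: (cvg_trans _ (cvgM c c)); apply: near_eq_cvg.
  by near=> k; rewrite /= expr2.
by rewrite is_cvg_limn_einfE; [rewrite (cvg_lim _ lim)|apply/cvg_ex; eexists; exact: lim].
Unshelve. all: by end_near.
Qed.

End mean_square_limit.

(** * The noise integral *)

Section covariance.
Context {R : realType} {d : measure_display} {X : measurableType d}.
Variable P : {measure set X -> \bar R}.

Definition L2 (f : X -> R) : Prop := measurable_fun setT f /\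
  (\int[P]_w ((f w) ^+ 2)%:E < +oo)%E.

Definition cov (f g : X -> R) : R := fine (\int[P]_w (f w * g w)%:E)%E.

Lemma L2_comb (c : R) (f g : X -> R) : L2 f -> L2 g -> L2 (fun w => f w + c * g w).
Proof.
move=> [mf ff] [mg gg]; split; first by mfun.
apply: (le_lt_trans (integral_sqr_comb P measurableT c mf mg)).
by rewrite lte_add_pinfty// lte_mul_pinfty// lee_fin mulr_ge0// sqr_ge0.
Qed.

Lemma L2_integrableM (f g : X -> R) : L2 f -> L2 g ->
  P.-integrable setT (fun w => (f w * g w)%:E).
Proof.
move=> [mf ff] [mg gg]; apply/integrableP; split; first by mfun.
apply: (@le_lt_trans _ _ (\int[P]_w (((f w) ^+ 2)%:E + ((g w) ^+ 2)%:E))%E).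
  apply: ge0_le_integral => //.
  - by apply: (measurableT_comp (@abse_measurable R setT)) => //; mfun.
  - by apply: emeasurable_funD; mfun.
  - move=> w _; rewrite -EFinD lee_fin ler_norml; apply/andP; split.
      have := sqr_ge0 (f w + g w); have := sqr_ge0 (f w); have := sqr_ge0 (g w); nra.
    have := sqr_ge0 (f w - g w); have := sqr_ge0 (f w); have := sqr_ge0 (g w); nra.
rewrite ge0_integralD//; last 4 first.
- by move=> w _; rewrite lee_fin sqr_ge0.
- by mfun.
- by move=> w _; rewrite lee_fin sqr_ge0.
- by mfun.
exact: lte_add_pinfty.
Qed.

Lemma cov_semi_inner : semi_inner L2 cov.
Proof.
split.
- exact: L2_comb.
- by move=> f g _ _; rewrite /cov; under eq_integral do rewrite mulrC.
- move=> c f g h df dg dh; rewrite /cov.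
  have i1 := L2_integrableM df dh; have i2 := L2_integrableM dg dh.
  have -> : (\int[P]_w ((f w + c * g w) * h w)%:E =
             \int[P]_w ((f w * h w)%:E + c%:E * (g w * h w)%:E))%E.
    by apply: eq_integral => w _; rewrite -EFinM -EFinD mulrDl mulrA.
  rewrite integralD//; last by apply: integrableZl.
  by rewrite integralZl// fineD ?integrable_fin_num ?integralZl//; [rewrite fineM ?integrable_fin_num|rewrite fin_numM ?integrable_fin_num].
- move=> f _; apply: fine_ge0; apply: integral_ge0 => w _.
  by rewrite lee_fin -expr2 sqr_ge0.
Qed.

Lemma cov_sqr (f : X -> R) : L2 f -> (cov f f)%:E = (\int[P]_w ((f w) ^+ 2)%:E)%E.
Proof.
move=> [mf ff]; rewrite /cov fineK; last first.
  by apply: integrable_fin_num => //; exact: L2_integrableM.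
by apply: eq_integral => w _; rewrite expr2.
Qed.

Lemma sqd_cov (f g : X -> R) : L2 f -> L2 g ->
  sqd P setT f g = (cov (f \- g) (f \- g))%:E.
Proof. by move=> df dg; rewrite cov_sqr//; exact: (dom_sub cov_semi_inner). Qed.

Lemma cov0_ae (f : X -> R) : L2 f -> cov f f = 0 -> {ae P, forall w, f w = 0}.
Proof.
move=> df f0; have [mf ff] := df.
have := cov_sqr df; rewrite f0 => /esym i0.
have : (\int[P]_w `|((f w) ^+ 2)%:E| = 0)%E.
  by rewrite -[RHS]i0; apply: eq_integral => w _; rewrite gee0_abs// lee_fin sqr_ge0.
move=> /(ae_eq_integral_abs P measurableT _).1 h.
apply: filterS (h _); last by mfun.
by move=> w /(_ I)/= [] /eqP; rewrite sqrf_eq0 => /eqP.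
Qed.

End covariance.

Section noise_integral.
Context {R : realType} {d : nat} {dO : measure_display}
        {Omega : measurableType dO}.
Variables (T H : R) (P : probability Omega R).
Hypothesis (hH : 2^-1 < H < 1).
Local Notation E := (R * 'rV[R]_d)%type.
Local Notation D := (test_function (@open_strip R d T)).
Local Notation HS := (@H_semi_inner R d T H hH).
Local Notation PS := (cov_semi_inner P).
Variable F : (E -> R) -> {RV P >-> R}.
Hypothesis hF : fractional_noise T H F.

Lemma noise_cov (phi psi : E -> R) : D phi -> D psi -> cov P (F phi) (F psi) = H_inner T H phi psi.
Proof.
move=> tp ts; have [_ _ /(_ _ _ tp ts)] := hF.
by rewrite unlock /cov => ->.
Qed.

Lemma noise_L2 (phi : E -> R) : D phi -> L2 P (F phi).
Proof.
move=> tp; split; first exact: measurable_funPT.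
have [_ _ /(_ _ _ tp tp)] := hF; rewrite unlock => h.
by under eq_integral do rewrite expr2; rewrite h ltry.
Qed.

Lemma sqd_noise (phi psi : E -> R) : D phi -> D psi ->
  sqd P setT (F phi) (F psi) = (hdist T H phi psi)%:E.
Proof.
move=> tp ts; have dp := noise_L2 tp; have ds := noise_L2 ts.
have Hp := test_function_H_finite hH tp; have Hs := test_function_H_finite hH ts.
by rewrite sqd_cov// /hdist (inner_sqrB PS)// (inner_sqrB HS)// !noise_cov.
Qed.

Lemma H_approx_finite (phi : nat -> E -> R) (f : E -> R) : H_approx T H phi f -> H_finite T H f.
Proof.
move=> [Dp Hp _]; have h0 := test_function_H_finite hH (Dp 0).
rewrite (_ : f = phi 0 \- (phi 0 \- f)); first exact: (dom_sub HS).
by apply/funext => z /=; rewrite opprB addrC subrK.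
Qed.

Lemma is_noise_integralE (f : E -> R) (X : {RV P >-> R}) : is_noise_integral T H F f X ->
  exists2 phi, H_approx T H phi f & sqd P setT (F (phi n)) X @[n --> \oo] --> 0%E.
Proof. by move=> [phi ap h]; exists phi => //; rewrite unlock in h. Qed.

Lemma noise_integral_L2 f (X : {RV P >-> R}) : is_noise_integral T H F f X -> L2 P X.
Proof.
move=> /is_noise_integralE[phi [Dp Hp _]] cv; split; first exact: measurable_funPT.
have [n _ /(_ n (leqnn n)) hn] := cvge0_lt ltr01 cv.
have [mF fF] := noise_L2 (Dp n); have mX := @measurable_funPT _ _ _ _ X.
have := sqd_triangle P measurableT mX mF (measurable_cst (0 : R)).
rewrite !sqd0r => /le_lt_trans; apply.
by rewrite lte_add_pinfty// lte_mul_pinfty// sqdC (lt_trans hn)// ltry.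
Qed.

Lemma noise_integral_cvg f (X : {RV P >-> R}) : is_noise_integral T H F f X ->
  exists2 phi, H_approx T H phi f &
    cov P ((F (phi n) : Omega -> R) \- X) ((F (phi n) : Omega -> R) \- X) @[n --> \oo] --> 0.
Proof.
move=> iX; have dX := noise_integral_L2 iX; have [phi ap cv] := is_noise_integralE iX.
exists phi => //; have [Dp _ _] := ap.
apply: (@fine_cvg _ _ _ _ (fun n => (cov P ((F (phi n) : Omega -> R) \- X) ((F (phi n) : Omega -> R) \- X))%:E)).
rewrite (_ : (fun n => _) = (fun n => sqd P setT (F (phi n)) X))//.
by apply/funext => n; rewrite sqd_cov//; exact: noise_L2.
Qed.

(** The isometry extends to the completion. *)
Lemma noise_integral_cov (f g : E -> R) (X Y : {RV P >-> R}) :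
  is_noise_integral T H F f X -> is_noise_integral T H F g Y ->
  cov P X Y = H_inner T H f g.
Proof.
move=> iX iY; have dX := noise_integral_L2 iX; have dY := noise_integral_L2 iY.
have [phi ap cX] := noise_integral_cvg iX; have [psi bp cY] := noise_integral_cvg iY.
have Hf := H_approx_finite ap; have Hg := H_approx_finite bp.
have [Dp _ hp] := ap; have [Ds _ hs] := bp.
have c1 := inner_cvg PS (fun n => noise_L2 (Dp n)) (fun n => noise_L2 (Ds n)) dX dY cX cY.
have c2 := inner_cvg HS (fun n => test_function_H_finite hH (Dp n)) (fun n => test_function_H_finite hH (Ds n)) Hf Hg hp hs.
apply: (cvg_unique _ c1); rewrite // (_ : (fun n => _) = (fun n => H_inner T H (phi n) (psi n)))//.
by apply/funext => n; rewrite noise_cov.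
Qed.

Lemma noise_integral_unique f (X Y : {RV P >-> R}) :
  is_noise_integral T H F f X -> is_noise_integral T H F f Y ->
  {ae P, forall w, X w = Y w}.
Proof.
move=> iX iY; have dX := noise_integral_L2 iX; have dY := noise_integral_L2 iY.
have := cov0_ae (dom_sub PS dX dY).
rewrite (inner_sqrB PS)// (noise_integral_cov iX iX) (noise_integral_cov iX iY) (noise_integral_cov iY iY).
by rewrite (_ : _ - _ + _ = 0); [move=> /(_ erefl); apply: filterS => w /eqP; rewrite subr_eq0 => /eqP|ring].
Qed.

Lemma noise_integral_test (phi : E -> R) : D phi -> is_noise_integral T H F phi (F phi).
Proof.
move=> tp; have Hp := test_function_H_finite hH tp.
exists (fun=> phi).
  split => //; first by move=> _; exact: (dom_sub HS).
  rewrite (inner_sqrB HS)// (_ : _ - _ + _ = 0); [exact: cvg_cst|ring].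
rewrite unlock; under eq_fun do under eq_integral do rewrite subrr expr0n/=.
by under eq_fun do rewrite integral0; exact: cvg_cst.
Qed.

(** At geometric speed the noise integrals converge almost surely, to a limit that
is a pointwise function of the sequence. *)
Lemma noise_limit (phi : nat -> E -> R) (f : E -> R) (X : {RV P >-> R}) :
  (forall n, D (phi n)) -> H_finite T H f ->
  (forall n, hdist T H (phi n) f <= (4^-1) ^+ n.+1) ->
  X = real_limit (fun n => F (phi n) : Omega -> R) :> (Omega -> R) ->
  is_noise_integral T H F f X.
Proof.
move=> Dp Hf hp XE.
have Hp n := test_function_H_finite hH (Dp n).
have h0 n : 0 <= hdist T H (phi n) f by exact: hdist_ge0.
have g0 : (4^-1 : R) ^+ n @[n --> \oo] --> 0 by apply: cvg_expr; rewrite ger0_norm; lra.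
have g1 : (4^-1 : R) ^+ n.+1 @[n --> \oo] --> 0.
  by rewrite (cvg_shiftS (fun n => (4^-1 : R) ^+ n)).
exists phi.
  split => //; first by move=> n; exact: (dom_sub HS).
  by apply: (squeeze_cvgr _ _ g1); [apply: nearW => n; apply/andP; split; [exact: h0|exact: hp]|exact: cvg_cst].
rewrite unlock; have mF n : measurable_fun setT (F (phi n)) by exact: measurable_funPT.
have fast n : (sqd P setT (F (phi n)) (F (phi n.+1)) <= ((4^-1) ^+ n)%:E)%E.
  rewrite sqd_noise// lee_fin; apply: (le_trans (hdist_triangle hH (Hp n) Hf (Hp n.+1))).
  rewrite (hdistC hH Hf (Hp n.+1)); have := hp n; have := hp n.+1; rewrite !exprS.
  have : 0 <= (4^-1 : R) ^+ n by rewrite exprn_ge0.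
  lra.
have key n := sqd_real_limit mF fast n.
apply: (@squeeze_cvge _ _ _ _ (cst 0%E) _ (fun n => (4 * (4^-1) ^+ n)%:E)).
- apply: nearW => n; apply/andP; split; first exact: sqd_ge0.
  by have := key n; rewrite -XE.
- exact: cvg_cst.
- apply: cvg_EFin; first exact: nearW.
  by rewrite -(mulr0 4); apply: cvgM => //; exact: cvg_cst.
Qed.

Lemma noise_integral_exists f : in_H T H f ->
  is_noise_integral T H F f (noise_integral T H F f).
Proof.
move=> [phi ap]; apply: xgetPex; have Hf := H_approx_finite ap; have [Dp Hp cv] := ap.
have /choice[k hk] : forall n, exists k, hdist T H (phi k) f <= (4^-1) ^+ n.+1.
  move=> n; have e0 : (0 : R) < (4^-1) ^+ n.+1 by rewrite exprn_gt0.
  have /cvgrPdist_lt/(_ _ e0)[k _ /(_ k (leqnn k))] := cv.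
  rewrite sub0r normrN => h; exists k; apply: ltW; apply: le_lt_trans h.
  exact: ler_norm.
pose X := real_limit (fun n => F (phi (k n)) : Omega -> R).
have mX : measurable_fun setT X.
  by apply: measurable_real_limit => // n; exact: measurable_funPT.
pose X' : {RV P >-> R} := mfun_Sub (mem_set mX : X \in mfun).
by exists X'; apply: (@noise_limit (fun n => phi (k n))).
Qed.

End noise_integral.

(** * The heat kernel *)

Section heat_kernel_facts.
Context {R : realType} {d : nat}.
Local Notation E := (R * 'rV[R]_d)%type.
Local Notation mE := (measurableTypeR R * 'rV[R]_d)%type.
Local Notation leb := (@lebesgue_measure R).
Local Notation p := (d%:R / 2 : R).

Lemma heat_kernel_ge0 (z : E) : 0 <= heat_kernel z.
Proof. by rewrite /heat_kernel; case: ifP => // _; rewrite mulr_ge0 ?powR_ge0 ?expR_ge0. Qed.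

Lemma heat_kernel_at_ge0 (z w : E) : 0 <= heat_kernel_at z w.
Proof. exact: heat_kernel_ge0. Qed.

Lemma measurable_heat_kernel : measurable_fun (setT : set mE) (@heat_kernel R d).
Proof. by rewrite /heat_kernel /sqnorm; mfun. Qed.

Lemma measurable_heat_kernel_at :
  measurable_fun (setT : set (mE * mE)) (fun q => heat_kernel_at q.1 q.2).
Proof.
rewrite /heat_kernel_at.
apply: (measurableT_comp measurable_heat_kernel); apply: measurable_fun_pair => /=; first by mfun.
apply: (@measurable_fun_rVP _ _ _ _ d) => i; under eq_fun do rewrite !mxE.
apply: measurable_funB.
- apply: (measurableT_comp (@measurable_coord _ _ _ i)).
  exact: (measurableT_comp measurable_snd measurable_fst).
- apply: (measurableT_comp (@measurable_coord _ _ _ i)).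
  exact: (measurableT_comp measurable_snd measurable_snd).

Qed.

Lemma measurable_heat_kernel_at_r (z : E) : measurable_fun (setT : set mE) (heat_kernel_at z).
Proof. exact: (measurableT_comp measurable_heat_kernel_at (measurable_pair1 (z : mE))). Qed.

Lemma measurable_heat_kernel_at_l (w : E) :
  measurable_fun (setT : set mE) (fun z => heat_kernel_at z w).
Proof. exact: (measurableT_comp measurable_heat_kernel_at (measurable_pair2 (w : mE))). Qed.

Lemma sqnormC (x y : 'rV[R]_d) : sqnorm (x - y) = sqnorm (y - x).
Proof. by apply: eq_bigr => i _; rewrite !mxE -sqrrN opprB. Qed.

Lemma integral_gauss_powR (b : R) (x : 'rV[R]_d) : 0 < b ->
  (\int[lebesgue_rV R d]_y (expR (- b * sqnorm (x - y)))%:E = ((pi / b) `^ p)%:E)%E.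
Proof.
move=> b0; under eq_integral do rewrite sqnormC.
have h : 0 <= pi / b :> R by rewrite divr_ge0 ?pi_ge0 ?ltW.
by rewrite integral_gauss_rV// -powR12_sqrt// -powR_mulrn ?powR_ge0// -powRrM [2^-1 * _]mulrC.
Qed.

Lemma heat_kernelE (s : R) (v : 'rV[R]_d) : 0 < s ->
  heat_kernel (s, v) = (4 * pi * s) `^ (- p) * expR (- (4 * s)^-1 * sqnorm v).
Proof. by move=> s0; rewrite /heat_kernel/= s0 !mulNr [_^-1 * _]mulrC. Qed.

Let pi4 (s : R) : 0 < s -> 0 < 4 * pi * s.
Proof. by move=> s0; rewrite !mulr_gt0// pi_gt0. Qed.

Lemma heat_mass (s : R) (x : 'rV[R]_d) : 0 < s ->
  (\int[lebesgue_rV R d]_y (heat_kernel (s, (x - y)%R))%:E = 1)%E.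
Proof.
move=> s0; have b0 : 0 < (4 * s)^-1 by rewrite invr_gt0 mulr_gt0.
under eq_integral do rewrite heat_kernelE// EFinM.
rewrite ge0_integralZl//; last first.
- by rewrite lee_fin powR_ge0.
- apply/measurable_EFinP; apply: measurableT_comp => //; apply: measurable_funM => //.
  by under eq_fun do rewrite sqnormC; exact: measurable_sqnorm_center.
rewrite integral_gauss_powR// -EFinM (_ : pi / (4 * s)^-1 = 4 * pi * s); last first.
  by rewrite invrK; ring.
by rewrite powRN mulVf// gt_eqF// powR_gt0// pi4.
Qed.

(** The semigroup property at coinciding points. *)
Lemma heat_pair (s t : R) (x : 'rV[R]_d) : 0 < s -> 0 < t ->
  (\int[lebesgue_rV R d]_y (heat_kernel (s, (x - y)%R) * heat_kernel (t, (x - y)%R))%:E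
   = ((4 * pi * (s + t)) `^ (- p))%:E)%E.
Proof.
move=> s0 t0; pose b := (4 * s)^-1 + (4 * t)^-1.
have b0 : 0 < b by rewrite addr_gt0// invr_gt0 mulr_gt0.
have st0 : 0 < s + t by rewrite addr_gt0.
transitivity (\int[lebesgue_rV R d]_y
  (((4 * pi * s) `^ (- p) * (4 * pi * t) `^ (- p))%:E * (expR (- b * sqnorm (x - y)))%:E))%E.
  apply: eq_integral => y _; rewrite !heat_kernelE// -EFinM; congr EFin.
  set q := sqnorm _; rewrite (_ : - b * q = - (4 * s)^-1 * q + - (4 * t)^-1 * q); last by rewrite /b; ring.
  by rewrite expRD; ring.
rewrite ge0_integralZl//; last first.
- by rewrite lee_fin mulr_ge0 ?powR_ge0.
- apply/measurable_EFinP; apply: measurableT_comp => //; apply: measurable_funM => //.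
  by under eq_fun do rewrite sqnormC; exact: measurable_sqnorm_center.
rewrite integral_gauss_powR// -EFinM; congr EFin.
have -> : pi / b = (4 * pi * s) * (4 * pi * t) / (4 * pi * (s + t)).
  rewrite /b; move: (@pi_gt0 R); move: (pi : R) => c c0.
  by field; rewrite !gt_eqF.
move: (pi4 s0) (pi4 t0) (pi4 st0).
move: (4 * pi * s) (4 * pi * t) (4 * pi * (s + t)) => A B C A0 B0 C0.
rewrite powRM ?invr_ge0 ?mulr_ge0 ?(ltW A0) ?(ltW B0) ?(ltW C0)//.
rewrite powRM ?(ltW A0) ?(ltW B0)// !powRN.
rewrite -(@powR_inv1 _ C) ?(ltW C0)// -powRrM mulN1r powRN.
by field; rewrite !gt_eqF// powR_gt0.
Qed.

End heat_kernel_facts.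

Section heat_energy.
Context {R : realType} {d : nat}.
Variables (T H : R).
Hypotheses (hH : 2^-1 < H < 1).
Local Notation E := (R * 'rV[R]_d)%type.
Local Notation mE := (measurableTypeR R * 'rV[R]_d)%type.
Local Notation leb := (@lebesgue_measure R).
Local Notation p := (d%:R / 2 : R).
Local Notation a := (2 - 2 * H).

Let a01 : 0 < a < 1. Proof. by move: hH => /andP[? ?]; apply/andP; split; lra. Qed.

Lemma ge0_integral_flip (t : R) (f : R -> \bar R) : measurable_fun setT f ->
  (forall x, (0 <= f x)%E) -> (\int[leb]_x f (t - x)%R = \int[leb]_x f x)%E.
Proof.
move=> mf f0.
have mfN : measurable_fun setT (fun x : R => f (- x)).
  by apply: (measurableT_comp mf); exact: oppr_measurable.
rewrite -(ge0_integral_opp mf f0) -(ge0_integral_shift (- t) mfN (fun x => f0 _)).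
by apply: eq_integral => x _; rewrite opprB.
Qed.

Definition heat_pair_kernel (t : R) (q : R * R) : R :=
  if [&& 0 < q.1, q.1 < t, 0 < q.2 & q.2 < t]
  then riesz a q * (4 * pi * (q.1 + q.2)) `^ (- p) else 0.

Lemma heat_pair_kernel_ge0 t q : 0 <= heat_pair_kernel t q.
Proof. by rewrite /heat_pair_kernel; case: ifP => // _; rewrite mulr_ge0 ?powR_ge0. Qed.

Lemma measurable_heat_pair_kernel t : measurable_fun setT (heat_pair_kernel t).
Proof. by have mr := @measurable_riesz R a; rewrite /heat_pair_kernel; mfun. Qed.

(** Reversing time turns the energy of the heat kernel at (t, x) into an
integral that depends on t only. *)
Lemma energy_heat (z : E) : z.1 <= T ->
  (energy T H (heat_kernel_at z) (heat_kernel_at z) =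
   \int[leb]_u \int[leb]_v (heat_pair_kernel z.1 (u, v))%:E)%E.
Proof.
move=> zT; have mr := @measurable_riesz R a.
have mg := measurable_heat_kernel_at_r z.
have mgS : measurable_fun (open_strip T : set mE) (heat_kernel_at z) by exact: measurable_funTS.
rewrite energy_fubini//; set h := abs_ext T (heat_kernel_at z).
have mh : measurable_fun (setT : set mE) h by exact: measurable_abs_ext.
have h0 w : 0 <= h w by exact: abs_ext_ge0.
pose G (w : (measurableTypeR R * measurableTypeR R) * 'rV[R]_d) : \bar R :=
  (h (w.1.1, w.2) * riesz a w.1 * h (w.1.2, w.2))%:E.
have mG : measurable_fun setT G.
  rewrite /G; apply/measurable_EFinP; apply: measurable_funM; first apply: measurable_funM.
  - by apply: (measurableT_comp mh); apply: measurable_fun_pair; mfun.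
  - exact: (measurableT_comp mr).
  - by apply: (measurableT_comp mh); apply: measurable_fun_pair; mfun.
have G0 w : (0 <= G w)%E by rewrite lee_fin !mulr_ge0// powR_ge0.
transitivity (\int[sfprod leb leb]_q \int[lebesgue_rV R d]_x G (q, x))%E.
  exact: (esym (@fubini_tonelli _ _ _ _ R (sfprod leb leb) (lebesgue_rV R d) G mG G0)).
pose Phi (q : R * R) := heat_pair_kernel z.1 (z.1 - q.1, z.1 - q.2).
have mPhi : measurable_fun setT Phi.
  apply: (measurableT_comp (measurable_heat_pair_kernel z.1)).
  by apply: measurable_fun_pair; mfun.
transitivity (\int[sfprod leb leb]_q (Phi q)%:E)%E.
  apply: eq_integral => -[u v] _; rewrite /G/= /Phi /heat_pair_kernel/=.
  rewrite !subr_gt0 !ltrBlDr !ltrDl.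
  have hE s x : h (s, x) = if (0 < s) && (s < z.1) then heat_kernel_at z (s, x) else 0.
    rewrite /h /abs_ext/=; case: ifPn => [/andP[s0 sT]|].
      rewrite s0/= ger0_norm ?heat_kernel_at_ge0//; case: ifPn => // sz.
      by rewrite /heat_kernel_at /heat_kernel/= subr_gt0 (negbTE sz).
    rewrite negb_and => /orP[/negbTE->//|sT]; case: ifPn => // /andP[_ sz].
    by move: sT; rewrite (lt_le_trans sz zT).
  under eq_integral do rewrite !hE.
  case: ifPn => [/and4P[ut u0 vt v0]|nuv]; last first.
    rewrite integral0_eq// => x _.
    case: ifPn => [/andP[u0 ut]|_]; last by rewrite !mul0r.
    case: ifPn => [/andP[v0 vt]|_]; last by rewrite mulr0.
    by case/negP: nuv; rewrite ut u0 vt v0.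
  rewrite ut u0 vt v0/=.
  have rE : riesz a (z.1 - u, z.1 - v) = riesz a (u, v).
    by rewrite /riesz/= opprB addrC addrA subrK distrC.
  transitivity (\int[lebesgue_rV R d]_x ((riesz a (u, v))%:E *
     (heat_kernel (z.1 - u, z.2 - x) * heat_kernel (z.1 - v, z.2 - x))%:E))%E.
    by apply: eq_integral => x _; rewrite -EFinM /heat_kernel_at/=; congr EFin; ring.
  rewrite ge0_integralZl//; last 3 first.
  - apply/measurable_EFinP; apply: measurable_funM.
    + exact: (measurableT_comp (measurable_heat_kernel_at_r z) (measurable_pair1 (u : measurableTypeR R))).
    + exact: (measurableT_comp (measurable_heat_kernel_at_r z) (measurable_pair1 (v : measurableTypeR R))).
  - by move=> x _; rewrite lee_fin mulr_ge0 ?heat_kernel_ge0.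
  - by rewrite lee_fin powR_ge0.
  by rewrite heat_pair ?subr_gt0// -EFinM rE.
transitivity (\int[leb]_u \int[leb]_v (Phi (u, v))%:E)%E.
  apply: (@fubini_tonelli1 _ _ (measurableTypeR R) (measurableTypeR R) R leb leb (fun q => (Phi q)%:E)).
  - exact/measurable_EFinP.
  - by move=> q; rewrite lee_fin heat_pair_kernel_ge0.
pose K (q : measurableTypeR R * measurableTypeR R) : \bar R := (heat_pair_kernel z.1 q)%:E.
have mK : measurable_fun setT K by apply/measurable_EFinP; exact: measurable_heat_pair_kernel.
have K0 q : (0 <= K q)%E by rewrite lee_fin heat_pair_kernel_ge0.
transitivity (\int[leb]_u \int[leb]_v K ((z.1 - u)%R, v))%E.
  apply: eq_integral => u _.
  have mKu : measurable_fun setT (fun v : R => K ((z.1 - u)%R, v)).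
    by apply: (measurableT_comp mK); exact: measurable_pair1.
  exact: (ge0_integral_flip z.1 mKu (fun v => K0 _)).
apply: (@ge0_integral_flip z.1 (fun u => \int[leb]_v K (u, v))%E).
- exact: (@measurable_fun_fubini_tonelli_F _ _ (measurableTypeR R) (measurableTypeR R) R leb K mK K0).
- by move=> u; apply: integral_ge0 => v _.
Qed.

Let p0 : 0 <= p. Proof. by rewrite divr_ge0. Qed.
Let c4 : 0 < 4 * pi :> R. Proof. by rewrite mulr_gt0// pi_gt0. Qed.

Lemma powR_antimono (x y r : R) : 0 <= r -> 0 < x -> x <= y -> y `^ (- r) <= x `^ (- r).
Proof.
move=> r0 x0 xy; have y0 : 0 < y by exact: lt_le_trans xy.
rewrite !powRN lef_pV2 ?posrE ?powR_gt0//.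
by apply: ge0_ler_powR => //; rewrite nnegrE ltW.
Qed.

(** Near the diagonal the time weight is integrable, and what remains is the
integral of u^(2H - 1 - d/2) near zero. *)
Lemma energy_heat_le : d%:R / 4 < H -> 0 < T -> exists2 C : R, 0 <= C &
  forall z : E, z.1 <= T ->
    (energy T H (heat_kernel_at z) (heat_kernel_at z) <= C%:E)%E.
Proof.
move=> dH T0; have mr := @measurable_riesz R a.
have e1 : -1 < 1 - a - p by lra.
have a1 : 0 < 1 - a by move: a01 => /andP[]; lra.
pose A := (4 * pi) `^ (- p) / (1 - a).
have A0 : 0 <= A by rewrite divr_ge0 ?powR_ge0// ltW.
exists (2 * (A * (T `^ (1 - a - p + 1) / (1 - a - p + 1)))).
  by rewrite mulr_ge0// mulr_ge0// divr_ge0 ?powR_ge0//; lra.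
move=> z zT; rewrite energy_heat//; set t := z.1 in zT *.
pose c (u : R) : R := if (0 < u) && (u <= T) then (4 * pi * u) `^ (- p) else 0.
pose k (q : measurableTypeR R * measurableTypeR R) : \bar R :=
  (c q.1 * (riesz a q * (if (0 <= q.2) && (q.2 < q.1) then 1 else 0)))%:E.
have c0 u : 0 <= c u by rewrite /c; case: ifP => // _; exact: powR_ge0.
have k0 q : (0 <= k q)%E.
  by rewrite lee_fin mulr_ge0// mulr_ge0 ?powR_ge0//; case: ifP.
have mk : measurable_fun setT k by rewrite /k /c; mfun.
have mkC : measurable_fun setT (fun q : measurableTypeR R * measurableTypeR R => k (q.2, q.1)).
  by apply: (measurableT_comp mk); apply: measurable_fun_pair; mfun.
pose K (q : measurableTypeR R * measurableTypeR R) : \bar R := (heat_pair_kernel t q)%:E.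
have mK : measurable_fun setT K by apply/measurable_EFinP; exact: measurable_heat_pair_kernel.
have K0 q : (0 <= K q)%E by rewrite lee_fin heat_pair_kernel_ge0.
have Kk q : (K q <= k q + k (q.2, q.1))%E.
  rewrite -EFinD lee_fin /heat_pair_kernel/=.
  have kk0 : 0 <= c q.1 * (riesz a q * (if (0 <= q.2) && (q.2 < q.1) then 1 else 0)).
    by have := k0 q; rewrite lee_fin.
  have kk1 : 0 <= c q.2 * (riesz a (q.2, q.1) * (if (0 <= q.1) && (q.1 < q.2) then 1 else 0)).
    by have := k0 (q.2, q.1); rewrite lee_fin.
  case: ifPn => [/and4P[u0 ut v0 vt]|_]; last by rewrite addr_ge0.
  have [uv|vu|uv] := ltgtP q.1 q.2.
  - rewrite andbF !mulr0 add0r (ltW u0)/= mulr1 /c v0 (ltW (lt_le_trans vt zT))/= mulrC /riesz/= distrC.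
    apply: ler_wpM2r; first exact: powR_ge0.
    apply: powR_antimono => //; first by rewrite mulr_gt0.
    by rewrite ler_pM2l// lerDr ltW.
  - rewrite andbF !mulr0 addr0 (ltW v0)/= mulr1 /c u0 (ltW (lt_le_trans ut zT))/= mulrC.
    apply: ler_wpM2r; first exact: powR_ge0.
    apply: powR_antimono => //; first by rewrite mulr_gt0.
    by rewrite ler_pM2l// lerDl ltW.
  - rewrite !andbF !mulr0 addr0 /riesz uv subrr normr0 powR0 ?mul0r//.
    by rewrite oppr_eq0; move: a01 => /andP[]; lra.
apply: (@le_trans _ _ (\int[sfprod leb leb]_q (k q + k (q.2, q.1)))%E).
  rewrite (_ : (\int[leb]_u \int[leb]_v _)%E = (\int[sfprod leb leb]_q K q)%E); last first.
    exact: (esym (@fubini_tonelli1 _ _ (measurableTypeR R) (measurableTypeR R) R leb leb K mK K0)).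
  by apply: ge0_le_integral => //; exact: emeasurable_funD.
rewrite ge0_integralD//.
have kI : (\int[sfprod leb leb]_q k q <= (A * (T `^ (1 - a - p + 1) / (1 - a - p + 1)))%:E)%E.
  apply: (le_trans (le_refl _ : _ <= \int[(leb \x leb)%E]_q k q)%E).
  rewrite (@fubini_tonelli1 _ _ (measurableTypeR R) (measurableTypeR R) R leb leb k mk k0).
  apply: (@le_trans _ _ (\int[leb]_u (A%:E * (if (0 < u) && (u <= T) then u `^ (1 - a - p) else 0)%:E))%E).
    apply: ge0_le_integral => //.
    - by move=> u _; apply: integral_ge0 => v _.
    - exact: (@measurable_fun_fubini_tonelli_F _ _ (measurableTypeR R) (measurableTypeR R) R leb k mk k0).
    - by apply: measurable_funeM; mfun.
    move=> u _; rewrite /fubini_F /k/= /c; case: ifPn => [/andP[u0 uT]|_]; last first.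
      by rewrite integral0_eq ?mule0// => v _; rewrite mul0r.
    under eq_integral do rewrite EFinM.
    rewrite ge0_integralZl//; last 3 first.
    - by mfun.
    - by move=> v _; rewrite lee_fin mulr_ge0 ?powR_ge0//; case: ifP.
    - by rewrite lee_fin powR_ge0.
    rewrite (riesz_mass_half a01 u0) -!EFinM lee_fin /A powRM ?(ltW c4) ?(ltW u0)//.
    rewrite (_ : 1 - a - p = - p + (1 - a)); last ring.
    rewrite (@powRD R u (- p)); last by rewrite (gt_eqF u0) implybT.
    by rewrite le_eqVlt; apply/orP; left; apply/eqP; ring.
  rewrite ge0_integralZl//; last 2 first.
  - by mfun.
  - by move=> u _; rewrite lee_fin; case: ifP => // _; exact: powR_ge0.
  rewrite [in leRHS]EFinM; apply: lee_wpmul2l => //.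
  rewrite -integral_powR0// [leRHS]integral_mkcond/= le_eqVlt; apply/orP; left; apply/eqP.
  by apply: eq_integral => u _; rewrite patchE mem_setE in_itv/=; case: ifP.
rewrite mulrDl !mul1r EFinD; apply: leeD => //.
rewrite (_ : (\int[sfprod leb leb]_q k (q.2, q.1))%E = (\int[sfprod leb leb]_q k q)%E)//.
transitivity (\int[leb]_u \int[leb]_v k (v, u))%E.
  exact: (@fubini_tonelli1 _ _ (measurableTypeR R) (measurableTypeR R) R leb leb (fun q => k (q.2, q.1)) mkC (fun q => k0 _)).
exact: (esym (@fubini_tonelli2 _ _ (measurableTypeR R) (measurableTypeR R) R leb leb k mk k0)).
Qed.

(** For v < u the integrand is at least u^(2H-2) (8 pi u)^(-d/2); integrating over v
leaves a multiple of u^(2H-1-d/2). *)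
Lemma energy_heat_infty : H <= d%:R / 4 -> forall z : E, 0 < z.1 <= T ->
  energy T H (heat_kernel_at z) (heat_kernel_at z) = +oo%E.
Proof.
move=> Hd z /andP[t0 zT]; rewrite energy_heat//; set t := z.1 in t0 zT *.
have mr := @measurable_riesz R a.
have e1 : 1 - a - p <= -1 by lra.
pose A := (4 * pi * 2) `^ (- p).
have A0 : 0 < A by rewrite powR_gt0// mulr_gt0.
pose K (q : measurableTypeR R * measurableTypeR R) : \bar R := (heat_pair_kernel t q)%:E.
have mK : measurable_fun setT K by apply/measurable_EFinP; exact: measurable_heat_pair_kernel.
have K0 q : (0 <= K q)%E by rewrite lee_fin heat_pair_kernel_ge0.
pose l (u : R) : R := if (0 < u) && (u < t) then u `^ (1 - a - p) else 0.
have ml : measurable_fun setT l by rewrite /l; mfun.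
have l0 u : 0 <= l u by rewrite /l; case: ifP => // _; exact: powR_ge0.
apply/eqP; rewrite -leye_eq.
apply: (@le_trans _ _ (\int[leb]_u (A%:E * (l u)%:E))%E); last first.
  apply: ge0_le_integral => //.
  - by move=> u _; rewrite -EFinM lee_fin mulr_ge0// ltW.
  - by apply: measurable_funeM; exact/measurable_EFinP.
  - exact: (@measurable_fun_fubini_tonelli_F _ _ (measurableTypeR R) (measurableTypeR R) R leb K mK K0).
  move=> u _; rewrite /l; case: ifPn => [/andP[u0 ut]|_]; last first.
    by rewrite mule0; apply: integral_ge0 => v _; exact: K0.
  pose e := A * u `^ (- a - p).
  have e0 : 0 <= e by rewrite mulr_ge0 ?powR_ge0// ltW.
  apply: (@le_trans _ _ (\int[leb]_(v in `]0%R, u[) e%:E)%E).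
    rewrite integral_cst//= lebesgue_measure_itv/= lte_fin u0 -EFinD subr0 -!EFinM lee_fin.
    rewrite /e (_ : 1 - a - p = (- a - p) + 1); last ring.
    by rewrite (@powRD R u (- a - p)) ?(gt_eqF u0) ?implybT// powRr1 ?(ltW u0)// mulrA.
  rewrite integral_mkcond; apply: ge0_le_integral => //.
  - by move=> v _; rewrite patchE; case: ifP.
  - by apply/(measurable_restrictT _ _).1 => //; exact: measurable_cst.
  - by apply: (measurableT_comp mK); exact: measurable_pair1.
  move=> v _; rewrite patchE mem_setE in_itv/=; case: ifPn => [/andP[v0 vu]|_]; last exact: K0.
  rewrite lee_fin /heat_pair_kernel/= u0 ut v0 (lt_trans vu ut)/= /e.
  rewrite (@powRD R u (- a)); last by rewrite (gt_eqF u0) implybT.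
  rewrite mulrCA /riesz/= gtr0_norm ?subr_gt0//; apply: ler_pM; rewrite ?powR_ge0//.
  - by rewrite mulr_ge0 ?powR_ge0.
  - by apply: powR_antimono; [move: a01 => /andP[]; lra|rewrite subr_gt0|lra].
  - rewrite /A -powRM ?(ltW u0)//; last by rewrite ltW// mulr_gt0.
    apply: powR_antimono => //; first by rewrite mulr_gt0// addr_gt0.
    by rewrite -[leRHS]mulrA ler_pM2l//; lra.
rewrite ge0_integralZl//; last 3 first.
- exact/measurable_EFinP.
- by move=> u _; rewrite lee_fin.
- by rewrite lee_fin ltW.
apply: (@le_trans _ _ (A%:E * +oo)%E); first by rewrite gt0_muley// lte_fin.
rewrite lee_pmul2l//.
have t2 : 0 < t / 2 by rewrite divr_gt0.
rewrite -(integral_powR0_infty e1 t2) [leLHS]integral_mkcond; apply: ge0_le_integral => //.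
- by move=> u _; rewrite patchE; case: ifP => // _; rewrite lee_fin powR_ge0.
- by apply/(measurable_restrictT _ _).1 => //; apply: measurable_funTS; mfun.
- exact/measurable_EFinP.
move=> u _; rewrite patchE mem_setE in_itv/=; case: ifPn => [/andP[u0 ut]|_]; last by rewrite lee_fin.
by rewrite /l u0/= (le_lt_trans ut)// ltr_pdivrMr// ltr_pMr// ltr1n.
Qed.

End heat_energy.

Lemma measurable_integral_param d1 d2 (S : measurableType d1) (W : measurableType d2)
    (R : realType) (m : {sigma_finite_measure set W -> \bar R})
    (h : S * W -> R) (D : set W) : measurable D -> measurable_fun setT h ->
  measurable_fun setT (fun s => \int[m]_(w in D) (h (s, w))%:E)%E.
Proof.
move=> mD mh; pose k (q : S * W) := h q * \1_D q.2.
have mk : measurable_fun setT k.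
  apply: measurable_funM => //; apply: (measurableT_comp _ measurable_snd).
  exact: measurable_indic.
pose kp (q : S * W) : \bar R := (Num.max (k q) 0)%:E.
pose km (q : S * W) : \bar R := (Num.max (- k q) 0)%:E.
have mkp : measurable_fun setT kp by rewrite /kp; mfun.
have mkm : measurable_fun setT km by rewrite /km; mfun.
have kp0 q : (0 <= kp q)%E by rewrite lee_fin le_max lexx orbT.
have km0 q : (0 <= km q)%E by rewrite lee_fin le_max lexx orbT.
rewrite (_ : (fun s => _) = (fun s => \int[m]_w kp (s, w) - \int[m]_w km (s, w))%E).
  apply: emeasurable_funB; [exact: (measurable_fun_fubini_tonelli_F kp)|exact: (measurable_fun_fubini_tonelli_F km)].
apply/funext => s; rewrite integral_mkcond integralE; congr (_ - _)%E.
  apply: eq_integral => w _; rewrite funeposE patchE /kp /k/= indicE.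
  by case: ifP => _; rewrite ?mulr1 ?mulr0 ?EFin_max.
apply: eq_integral => w _; rewrite funenegE patchE /km /k/= indicE.
by case: ifP => _; rewrite ?mulr1 ?mulr0 ?oppr0 ?oppe0 ?EFin_max.
Qed.

Section heat_approximation.
Context {R : realType} {d : nat}.
Variables (T H : R).
Hypotheses (hH : 2^-1 < H < 1).
Local Notation E := (R * 'rV[R]_d)%type.
Local Notation mE := (measurableTypeR R * 'rV[R]_d)%type.
Local Notation leb := (@lebesgue_measure R).
Local Notation mu := (spacetime_measure R d).
Local Notation strip := (@open_strip R d T).
Local Notation p := (d%:R / 2 : R).

Lemma measurable_H_inner dS (S : measurableType dS) (f g : S -> E -> R) :
  measurable_fun (setT : set (S * mE)) (fun q => f q.1 q.2) ->
  measurable_fun (setT : set (S * mE)) (fun q => g q.1 q.2) ->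
  measurable_fun setT (fun s => H_inner T H (f s) (g s)).
Proof.
move=> mf mg; rewrite /H_inner; apply: measurable_funM; first exact: measurable_cst.
apply: (@measurableT_comp _ _ _ _ _ _ (@fine R)) => //.
have mr := @measurable_riesz R (2 - 2 * H).
pose h (q : S * ((measurableTypeR R * measurableTypeR R) * 'rV[R]_d)) : R :=
  f q.1 (q.2.1.1, q.2.2) * riesz (2 - 2 * H) q.2.1 * g q.1 (q.2.1.2, q.2.2).
have mh : measurable_fun setT h.
  rewrite /h; apply: measurable_funM; first apply: measurable_funM.
  - have mq : measurable_fun (setT : set (S * ((measurableTypeR R * measurableTypeR R) * 'rV[R]_d)))
      (fun q => (q.1, (q.2.1.1, q.2.2)) : S * mE).
      by apply: measurable_fun_pair; [mfun|apply: measurable_fun_pair; mfun].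
    exact: (measurableT_comp mf mq).
  - exact: (measurableT_comp mr (measurableT_comp measurable_fst measurable_snd)).
  - have mq : measurable_fun (setT : set (S * ((measurableTypeR R * measurableTypeR R) * 'rV[R]_d)))
      (fun q => (q.1, (q.2.1.2, q.2.2)) : S * mE).
      by apply: measurable_fun_pair; [mfun|apply: measurable_fun_pair; mfun].
    exact: (measurableT_comp mg mq).
have kE s : (\int[time2space_measure R d]_(w in H_domain T) (H_kernel H (f s) (g s) w)%:E =
    \int[time2space_measure R d]_(w in H_domain T) (h (s, w))%:E)%E.
  by apply: eq_integral => w _; congr EFin; rewrite /h /H_kernel /riesz/= opprB.
rewrite (funext kE).
exact: (@measurable_integral_param _ _ _ _ R (sfprod (sfprod leb leb) (lebesgue_rV R d)) h (H_domain T) (measurable_H_domain T) mh).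
Qed.

Hypotheses (hT : 0 < T) (dH : d%:R / 4 < H).

Let a0 := alphaH_gt0 hH.

Lemma heat_H_finite (z : E) : z.1 <= T -> H_finite T H (heat_kernel_at z).
Proof.
move=> zT; apply/(H_finiteP T H); split.
  by apply: measurable_funTS; exact: measurable_heat_kernel_at_r.
have [C _ /(_ z zT) h] := energy_heat_le (d := d) hH dH hT.
by apply: (le_lt_trans h); rewrite ltry.
Qed.

Lemma heat_H_bounded : exists2 C : R, 0 <= C & forall z : E, z.1 <= T ->
  H_inner T H (heat_kernel_at z) (heat_kernel_at z) <= C.
Proof.
have [C C0 hC] := energy_heat_le (d := d) hH dH hT.
exists (H * (2 * H - 1) * C); first by rewrite mulr_ge0// ltW.
move=> z zT; rewrite H_inner_energy; [|exact: heat_kernel_at_ge0..].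
rewrite ler_pM2l// -lee_fin fineK ?hC//.
by rewrite ge0_fin_numE ?energy_ge0// (le_lt_trans (hC z zT))// ltry.
Qed.

(** The singularity of the heat kernel is removed by cutting off a short time
interval; what is left is square-integrable. *)
Definition heat_trunc (z : E) (n : nat) (w : E) : R :=
  if n.+1%:R^-1 < z.1 - w.1 then heat_kernel_at z w else 0.

Lemma measurable_heat_trunc z n : measurable_fun (setT : set mE) (heat_trunc z n).
Proof. by rewrite /heat_trunc; have mg := measurable_heat_kernel_at_r z; mfun. Qed.

Lemma heat_trunc_le z n w : 0 <= heat_trunc z n w <= heat_kernel_at z w.
Proof.
by rewrite /heat_trunc; case: ifP => _; rewrite heat_kernel_at_ge0 lexx.
Qed.

Lemma heat_trunc_L2 z n : (\int[mu]_(w in strip) ((heat_trunc z n w) ^+ 2)%:E < +oo)%E.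
Proof.
pose e : R := n.+1%:R^-1; have e0 : 0 < e by rewrite invr_gt0.
pose q (w : mE) : \bar R := ((if (0 < w.1) && (w.1 < T) then heat_trunc z n w else 0) ^+ 2)%:E.
have mt := measurable_heat_trunc z n.
have mq : measurable_fun setT q by rewrite /q; mfun.
have q0 w : (0 <= q w)%E by rewrite lee_fin sqr_ge0.
have -> : (\int[mu]_(w in strip) ((heat_trunc z n w) ^+ 2)%:E = \int[mu]_w q w)%E.
  rewrite integral_mkcond; apply: eq_integral => w _; rewrite patchE /q.
  case: ifPn => [/set_mem[/=]|zS].
    by rewrite in_itv/= => /andP[-> ->].
  case: ifPn => [zz|_]; last by rewrite expr0n.
  by case/negP: zS; rewrite inE/=; split => //=; rewrite in_itv.
apply: (le_lt_trans (le_refl _ : _ <= \int[spacetime_measure R d]_z q z)%E).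
rewrite (ge0_integral_spacetime mq q0).
pose M := (4 * pi * e) `^ (- p).
have M0 : 0 <= M by exact: powR_ge0.
apply: (@le_lt_trans _ _ (\int[leb]_(s in `]0%R, T[) M%:E)%E); last first.
  by rewrite integral_cst//= lebesgue_measure_itv/= lte_fin hT -EFinD -EFinM ltry.
rewrite [leRHS]integral_mkcond; apply: ge0_le_integral => //.
- by move=> s _; apply: integral_ge0 => x _.
- exact: (@measurable_fun_fubini_tonelli_F _ _ (measurableTypeR R) _ R (lebesgue_rV R d) q mq q0).
- by apply/(measurable_restrictT _ _).1 => //; exact: measurable_cst.
move=> s _; rewrite patchE mem_setE in_itv/= /q/=.
case: ifPn => [sT|_]; last first.
  by rewrite integral0_eq// => x _; rewrite expr0n.
have [es|se] := ltP e (z.1 - s); last first.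
  by rewrite integral0_eq// => x _; rewrite /heat_trunc/= ltNge se/= expr0n.
have s0 : 0 < z.1 - s by exact: lt_trans es.
apply: (@le_trans _ _ (\int[lebesgue_rV R d]_x (heat_kernel (z.1 - s, z.2 - x) * heat_kernel (z.1 - s, z.2 - x))%:E)%E).
  rewrite le_eqVlt; apply/orP; left; apply/eqP; apply: eq_integral => x _.
  by rewrite /heat_trunc/= es expr2.
rewrite heat_pair// lee_fin /M; apply: powR_antimono.
- by rewrite divr_ge0.
- by rewrite !mulr_gt0// pi_gt0.
- by rewrite ler_pM2l ?mulr_gt0 ?pi_gt0//; move: es; rewrite -/e; move: (e) e0 s0; move=> x; lra.
Qed.

Lemma heat_H_approximable (z : E) : z.1 <= T -> H_approximable T H (heat_kernel_at z).
Proof.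
move=> zT; have Hg := heat_H_finite zT; set g := heat_kernel_at z in Hg *.
have mt n := measurable_heat_trunc z n.
have Ht n : H_finite T H (heat_trunc z n).
  by apply: L2_H_finite => //; [exact: measurable_funTS|exact: heat_trunc_L2].
apply: H_approximable_lim => // e e0.
suff cv : hdist T H (heat_trunc z n) g @[n --> \oo] --> 0.
  have /cvgrPdist_lt/(_ _ e0)[n _ /(_ n (leqnn n)) hn] := cv.
  exists (heat_trunc z n); first by apply: L2_H_approximable => //; exact: heat_trunc_L2.
  by apply: le_lt_trans hn; rewrite sub0r normrN ler_norm.
rewrite /hdist /H_inner -[X in _ --> X](mulr0 (H * (2 * H - 1))).
apply: cvgM; first exact: cvg_cst.
have gint : (time2space_measure R d).-integrable (H_domain T) (EFin \o H_kernel H g g).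
  exact: H_kernel_integrable.
apply: fine_cvg; rewrite (_ : 0%:E = \int[time2space_measure R d]_(w in H_domain T) cst 0%E w)%E; last first.
  by rewrite integral0.
apply: (@dominated_cvg _ _ _ _ _ (measurable_H_domain T) _ _ (EFin \o H_kernel H g g)) => //.
- move=> n; apply/measurable_EFinP; have [mfg _] := H_finiteB hH (Ht n) Hg.
  exact: measurable_H_kernel.
- move=> w _; apply: cvg_near_cst.
  have [wz|zw] := ltP w.1.1 z.1; last first.
    have g0 : g (w.1.1, w.2) = 0.
      by rewrite /g /heat_kernel_at /heat_kernel/= subr_gt0 ltNge zw.
    by apply: nearW => n; rewrite /H_kernel/= /heat_trunc -/g g0 if_same subrr !mul0r.
  near=> n; rewrite /H_kernel/= /heat_trunc/= ifT ?subrr ?mul0r//.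
  rewrite invf_plt ?posrE ?subr_gt0//.
  apply: (lt_trans (truncnS_gt _)); rewrite ltr_nat ltnS; near: n.
  by exists (Num.truncn (z.1 - w.1.1)^-1).+1.
- move=> n w _; rewrite /= lee_fin /H_kernel.
  have dg v : `|(heat_trunc z n \- g) v| <= g v.
    have /andP[h1 h2] := heat_trunc_le z n v.
    by rewrite /= distrC ger0_norm ?subr_ge0// gerBl.
  rewrite !normrM [X in _ * X * _]ger0_norm ?powR_ge0//.
  by apply: ler_pM; rewrite ?mulr_ge0 ?powR_ge0//; apply: ler_pM; rewrite ?powR_ge0.
Unshelve. all: by end_near.
Qed.

End heat_approximation.

(** * Convolution with the heat kernel *)

Section fubini_real.
Local Open Scope ereal_scope.
Context d1 d2 (X : measurableType d1) (Y : measurableType d2) (R : realType).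
Variables (m1 : {sigma_finite_measure set X -> \bar R})
  (m2 : {sigma_finite_measure set Y -> \bar R}).

Lemma fubini_real (f : X * Y -> R) : measurable_fun setT f ->
  \int[m1]_x \int[m2]_y (`|f (x, y)|%:E) < +oo ->
  [/\ \int[m1]_x \int[m2]_y (f (x, y))%:E = \int[m2]_y \int[m1]_x (f (x, y))%:E,
      m1.-integrable setT (fun x => \int[m2]_y (f (x, y))%:E) &
      m2.-integrable setT (fun y => \int[m1]_x (f (x, y))%:E)].
Proof.
move=> mf foo; have mf' : measurable_fun setT (EFin \o f) by exact/measurable_EFinP.
have i : (m1 \x m2).-integrable setT (EFin \o f).
  by apply/(integrable12ltyP m1 m2 mf').
split; first exact: (Fubini i).
- exact: (integrable_fubini_F i).
- apply/integrableP; split; first exact: (measurable_fubini_G i).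
  have := (integrable21ltyP m1 m2 mf').1 i => h.
  apply: (le_lt_trans _ h); apply: ge0_le_integral => //.
  + by apply: measurableT_comp => //; exact: (measurable_fubini_G i).
  + by apply: (measurable_fun_fubini_tonelli_G (abse \o (EFin \o f))); [exact: measurableT_comp|move=> z; exact: abse_ge0].
  + move=> y _; apply: le_abse_integral => //.
    by apply: (measurableT_comp mf'); exact: measurable_pair2.
Qed.

End fubini_real.

Section heat_conv_facts.
Context {R : realType} {d : nat}.
Variables (T H : R).
Hypotheses (hH : 2^-1 < H < 1) (hT : 0 < T).
Local Notation E := (R * 'rV[R]_d)%type.
Local Notation mE := (measurableTypeR R * 'rV[R]_d)%type.
Local Notation leb := (@lebesgue_measure R).
Local Notation mu := (spacetime_measure R d).
Local Notation strip := (@open_strip R d T).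

Lemma integral_spacetime_shift (z0 : E) (f : mE -> R) : measurable_fun setT f ->
  (\int[mu]_z (f ((z.1 + z0.1, z.2 + z0.2)%R : mE))%:E = \int[mu]_z (f z)%:E)%E.
Proof.
move=> mf; rewrite integralE [RHS]integralE; congr (_ - _)%E.
- have mp : measurable_fun setT (fun z : mE => (Num.max (f z) 0)%:E) by mfun.
  have p0 (z : mE) : (0 <= (Num.max (f z) 0)%:E)%E by rewrite lee_fin le_max lexx orbT.
  transitivity (\int[mu]_z (Num.max (f z) 0)%:E)%E.
    rewrite -(ge0_integral_spacetime_shift z0 mp p0).
    by apply: eq_integral => z _; rewrite funeposE EFin_max.
  by apply: eq_integral => z _; rewrite funeposE EFin_max.
- have mp : measurable_fun setT (fun z : mE => (Num.max (- f z) 0)%:E) by mfun.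
  have p0 (z : mE) : (0 <= (Num.max (- f z) 0)%:E)%E by rewrite lee_fin le_max lexx orbT.
  transitivity (\int[mu]_z (Num.max (- f z) 0)%:E)%E.
    rewrite -(ge0_integral_spacetime_shift z0 mp p0).
    by apply: eq_integral => z _; rewrite funenegE EFin_max.
  by apply: eq_integral => z _; rewrite funenegE EFin_max.
Qed.

Lemma heat_kernel_sym (s : R) (x y : 'rV[R]_d) :
  heat_kernel (s, x - y) = heat_kernel (s, y - x).
Proof. by rewrite /heat_kernel/= sqnormC. Qed.

(** The elapsed time k is s - t or t - s, so that this bounds the mass of the heat
kernel in either variable. *)
Lemma heat_strip_mass (k : R -> R) (x : 'rV[R]_d) : measurable_fun setT k ->
  (\int[mu]_z ((if (0 < z.1) && (z.1 < T) then 1 else 0) *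
     heat_kernel (k z.1, (x - z.2)%R))%:E <= T%:E)%E.
Proof.
move=> mk; pose q (z : mE) : \bar R := ((if (0 < z.1) && (z.1 < T) then 1 else 0) *
     heat_kernel (k z.1, (x - z.2)%R))%:E.
have q0 z : (0 <= q z)%E by rewrite lee_fin mulr_ge0 ?heat_kernel_ge0//; case: ifP.
have mq : measurable_fun setT q.
  rewrite /q; apply/measurable_EFinP; apply: measurable_funM; first by mfun.
  apply: (measurableT_comp measurable_heat_kernel); apply: measurable_fun_pair => /=; first by mfun.
  apply: (@measurable_fun_rVP _ _ _ _ d) => i; under eq_fun do rewrite !mxE.
  apply: measurable_funB; first exact: measurable_cst.
  by apply: (measurableT_comp (@measurable_coord _ _ _ i)); exact: measurable_snd.
apply: (le_trans (le_refl _ : _ <= \int[mu]_z q z)%E).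
rewrite (ge0_integral_spacetime mq q0).
apply: (@le_trans _ _ (\int[leb]_(s in `]0%R, T[) 1%:E)%E); last first.
  by rewrite integral_cst//= lebesgue_measure_itv/= lte_fin hT -EFinD subr0 mul1e.
rewrite [leRHS]integral_mkcond; apply: ge0_le_integral => //.
- by move=> s _; apply: integral_ge0 => y _.
- exact: (@measurable_fun_fubini_tonelli_F _ _ (measurableTypeR R) _ R (lebesgue_rV R d) q mq q0).
- by apply/(measurable_restrictT _ _).1 => //; exact: measurable_cst.
move=> s _; rewrite patchE mem_setE in_itv/= /q/=.
case: ifPn => [sT|_]; last by rewrite integral0_eq// => y _; rewrite mul0r.
under eq_integral do rewrite mul1r.
have [k0|k0] := ltP 0 (k s); first by rewrite heat_mass.
by rewrite integral0_eq// => y _; rewrite /heat_kernel/= ltNge k0.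
Qed.

Lemma heat_mass_first (w : E) :
  (\int[mu]_z ((if (0 < z.1) && (z.1 < T) then 1 else 0) * heat_kernel_at z w)%:E <= T%:E)%E.
Proof.
have mk : measurable_fun setT (fun s : R => s - w.1) by mfun.
apply: le_trans (heat_strip_mass w.2 mk); rewrite le_eqVlt; apply/orP; left; apply/eqP.
by apply: eq_integral => z _; rewrite /heat_kernel_at heat_kernel_sym.
Qed.

Lemma heat_mass_second (z : E) :
  (\int[mu]_w ((if (0 < w.1) && (w.1 < T) then 1 else 0) * heat_kernel_at z w)%:E <= T%:E)%E.
Proof.
have mk : measurable_fun setT (fun s : R => z.1 - s) by mfun.
exact: (heat_strip_mass z.2 mk).
Qed.

(** What the estimates use of a test function; unlike test functions, sources are
stable under absolute values. *)
Record source (eta : E -> R) (M : R) : Prop := Source {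
  source_meas : measurable_fun (setT : set mE) eta;
  source_le : forall z, `|eta z| <= M;
  source_out : forall z, ~ strip z -> eta z = 0;
  source_int : (\int[mu]_z `|eta z|%:E < +oo)%E }.

Lemma source_test (eta : E -> R) : test_function strip eta -> exists M, source eta M.
Proof.
move=> te; have [l [u [M [_ hM hout]]]] := test_function_bounded te.
exists M; split => //; first exact: test_function_measurable te.
exact: test_function_integrable te.
Qed.

Lemma source_abs (eta : E -> R) M : source eta M -> source (fun z => `|eta z|) M.
Proof.
move=> [m1 m2 m3 m4]; split.
- by mfun.
- by move=> z; rewrite normr_id.
- by move=> z /m3 ->; rewrite normr0.
- by under eq_integral do rewrite normr_id.
Qed.

Lemma heat_convE (eta : E -> R) M : source eta M ->
  heat_conv eta = fun w => fine (\int[mu]_z (eta z * heat_kernel_at z w)%:E)%E.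
Proof.
move=> se; have meta := source_meas se; apply/funext => w; rewrite /heat_conv /Rintegral; congr fine.
have mf : measurable_fun setT (fun z : mE => eta z * heat_kernel_at z w).
  by apply: measurable_funM => //; exact: measurable_heat_kernel_at_l.
rewrite -(integral_spacetime_shift w mf) [LHS]integral_mkcond; apply: eq_integral => z _.
rewrite patchE /heat_kernel_at/= !addrK [z.1 + _]addrC [z.2 + _]addrC.
case: ifPn => [_|/negP zn]; first by case: z.
rewrite /heat_kernel/=; case: ifPn => [z0|_]; last by rewrite mulr0.
by case: zn; rewrite inE/=; split => //=; rewrite in_itv/= z0.
Qed.

Section source.
Variables (eta : E -> R) (M : R).
Hypothesis se : source eta M.

Let meta := source_meas se.
Let M0 : 0 <= M. Proof. exact: le_trans (source_le se 0). Qed.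

Lemma heat_conv_abs_le (w : E) :
  (\int[mu]_z (`|eta z| * heat_kernel_at z w)%:E <= (M * T)%:E)%E.
Proof.
have mg := measurable_heat_kernel_at_l w.
apply: (@le_trans _ _ (\int[mu]_z (M%:E * ((if (0 < z.1) && (z.1 < T) then 1 else 0) * heat_kernel_at z w)%:E))%E).
  apply: ge0_le_integral => //.
  - by move=> z _; rewrite lee_fin mulr_ge0 ?heat_kernel_at_ge0.
  - by mfun.
  - by apply: measurable_funeM; mfun.
  - move=> z _; rewrite -EFinM lee_fin mulrA; apply: ler_wpM2r; first exact: heat_kernel_at_ge0.
    case: ifPn => [_|zT]; first by rewrite mulr1; exact: source_le se z.
    rewrite (source_out se) ?normr0 ?mulr0// => -[/=]; rewrite in_itv/= => zz _.
    by rewrite zz in zT.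
rewrite ge0_integralZl//; last 2 first.
- by mfun.
- by move=> z _; rewrite lee_fin mulr_ge0 ?heat_kernel_at_ge0//; case: ifP.
by rewrite EFinM; apply: lee_wpmul2l => //; exact: heat_mass_first.
Qed.

Lemma heat_conv_integrable (w : E) :
  mu.-integrable setT (fun z => (eta z * heat_kernel_at z w)%:E).
Proof.
have mg := measurable_heat_kernel_at_l w; apply/integrableP; split; first by mfun.
under eq_integral do rewrite abse_EFin normrM (ger0_norm (heat_kernel_at_ge0 _ _)).
by apply: (le_lt_trans (heat_conv_abs_le w)); rewrite ltry.
Qed.

Lemma heat_conv_EFin (w : E) :
  ((heat_conv eta w)%:E = \int[mu]_z (eta z * heat_kernel_at z w)%:E)%E.
Proof.
rewrite (heat_convE se) fineK//; apply: integrable_fin_num => //.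
exact: heat_conv_integrable.
Qed.

Lemma measurable_heat_conv : measurable_fun (setT : set mE) (heat_conv eta).
Proof.
rewrite (heat_convE se); apply: (@measurableT_comp _ _ _ _ _ _ (@fine R)) => //.
pose h (q : mE * mE) := eta q.2 * heat_kernel_at q.2 q.1.
have mh : measurable_fun setT h.
  apply: measurable_funM; first exact: (measurableT_comp meta).
  have ms : measurable_fun (setT : set (mE * mE)) (fun q => (q.2, q.1) : mE * mE).
    by apply: measurable_fun_pair; mfun.
  exact: (measurableT_comp measurable_heat_kernel_at ms).
exact: (measurable_integral_param mu measurableT mh).
Qed.

Lemma heat_conv_le (w : E) : `|heat_conv eta w| <= M * T.
Proof.
rewrite -lee_fin -abse_EFin heat_conv_EFin.
apply: (le_trans (le_abse_integral mu measurableT _)).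
  by have mg := measurable_heat_kernel_at_l w; mfun.
under eq_integral do rewrite abse_EFin normrM (ger0_norm (heat_kernel_at_ge0 _ _)).
exact: heat_conv_abs_le.
Qed.

Lemma heat_conv_L1 : (\int[mu]_(w in strip) `|heat_conv eta w|%:E < +oo)%E.
Proof.
have mS : measurable (strip : set mE) by exact: measurable_open_strip.
pose chi (w : mE) : R := if (0 < w.1) && (w.1 < T) then 1 else 0.
have chi0 w : 0 <= chi w by rewrite /chi; case: ifP.
have mchi : measurable_fun setT chi by rewrite /chi; mfun.
pose q (p : mE * mE) : \bar R := (chi p.1 * (`|eta p.2| * heat_kernel_at p.2 p.1))%:E.
have q0 p : (0 <= q p)%E by rewrite lee_fin !mulr_ge0 ?heat_kernel_at_ge0.
have mq : measurable_fun setT q.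
  apply/measurable_EFinP; apply: measurable_funM; first exact: (measurableT_comp mchi).
  apply: measurable_funM; first by apply: measurableT_comp => //; exact: (measurableT_comp meta).
  have ms : measurable_fun (setT : set (mE * mE)) (fun q => (q.2, q.1) : mE * mE).
    by apply: measurable_fun_pair; mfun.
  exact: (measurableT_comp measurable_heat_kernel_at ms).
apply: (@le_lt_trans _ _ (\int[mu]_w \int[mu]_z q (w, z))%E).
  rewrite [leLHS]integral_mkcond; apply: ge0_le_integral => //.
  - by move=> w _; rewrite patchE; case: ifP => // _; rewrite lee_fin normr_ge0.
  - apply/(measurable_restrictT _ _).1 => //; apply: measurable_funTS.
    by have mh := measurable_heat_conv; mfun.
  - exact: (measurable_fun_fubini_tonelli_F q).
  - move=> w _; rewrite patchE; case: ifPn => [/set_mem wS|_]; last by apply: integral_ge0.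
    have chi1 : chi w = 1 by move: wS => [/=]; rewrite in_itv/= /chi => -> _.
    rewrite -abse_EFin heat_conv_EFin.
    apply: (le_trans (le_abse_integral mu measurableT _)).
      by have mg := measurable_heat_kernel_at_l w; mfun.
    rewrite le_eqVlt; apply/orP; left; apply/eqP; apply: eq_integral => z _.
    by rewrite abse_EFin normrM (ger0_norm (heat_kernel_at_ge0 _ _)) /q/= chi1 mul1r.
rewrite (@fubini_tonelli _ _ _ _ R mu mu q mq q0).
apply: (@le_lt_trans _ _ (\int[mu]_z (T%:E * `|eta z|%:E))%E); last first.
  rewrite ge0_integralZl//; [|by mfun|by rewrite lee_fin ltW].
  by apply: lte_mul_pinfty; [rewrite lee_fin ltW| |exact: source_int se].
apply: ge0_le_integral => //.
- by move=> z _; apply: integral_ge0.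
- exact: (measurable_fun_fubini_tonelli_G q).
- by apply: measurable_funeM; mfun.
move=> z _; rewrite /q/=.
under eq_integral do rewrite mulrCA EFinM.
have mg := measurable_heat_kernel_at_r z.
rewrite ge0_integralZl//; last 2 first.
- by mfun.
- by move=> w _; rewrite lee_fin mulr_ge0 ?heat_kernel_at_ge0.
by rewrite muleC; apply: lee_wpmul2r; [rewrite lee_fin normr_ge0|exact: heat_mass_second].
Qed.

Lemma heat_conv_L2 : (\int[mu]_(w in strip) ((heat_conv eta w) ^+ 2)%:E < +oo)%E.
Proof.
have mS : measurable (strip : set mE) by exact: measurable_open_strip.
have mh := measurable_heat_conv.
apply: (@le_lt_trans _ _ (\int[mu]_(w in strip) ((M * T)%:E * `|heat_conv eta w|%:E))%E).
  apply: ge0_le_integral => //.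
  - by move=> w _; rewrite lee_fin sqr_ge0.
  - by apply: measurable_funTS; mfun.
  - by apply: measurable_funTS; apply: measurable_funeM; mfun.
  - move=> w _; rewrite -EFinM lee_fin -real_normK ?num_real// expr2.
    by apply: ler_wpM2r => //; exact: heat_conv_le.
rewrite ge0_integralZl//; last 2 first.
- by apply: measurable_funTS; mfun.
- by rewrite lee_fin mulr_ge0// ltW.
by apply: lte_mul_pinfty; [rewrite lee_fin mulr_ge0// ltW| |exact: heat_conv_L1].
Qed.

Lemma heat_conv_H_finite : H_finite T H (heat_conv eta).
Proof.
apply: L2_H_finite => //; last exact: heat_conv_L2.
by apply: measurable_funTS; exact: measurable_heat_conv.
Qed.

Lemma heat_conv_in_H : in_H T H (heat_conv eta).
Proof.
apply: H_approximable_in_H => //; apply: L2_H_approximable => //.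
- exact: measurable_heat_conv.
- exact: heat_conv_L2.
Qed.

End source.

(** The energy form commutes with averaging the heat kernel over its pole. *)
Lemma heat_conv_inner (eta : E -> R) (M : R) (phi : E -> R) :
  d%:R / 4 < H -> source eta M -> measurable_fun (setT : set mE) phi -> H_finite T H phi ->
  ((H_inner T H phi (heat_conv eta))%:E =
     \int[mu]_z (eta z * H_inner T H phi (heat_kernel_at z))%:E)%E /\
  mu.-integrable setT (fun z => (eta z * H_inner T H phi (heat_kernel_at z))%:E).
Proof.
move=> dH se mphi Hphi; have meta := source_meas se.
pose a := 2 - 2 * H; have mr := @measurable_riesz R a.
pose W := ((measurableTypeR R * measurableTypeR R) * 'rV[R]_d)%type.
pose t2s := sfprod (sfprod leb leb) (lebesgue_rV R d).
pose chi (w : W) : R := \1_(H_domain T) w.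
have mchi : measurable_fun setT chi by apply: measurable_indic; exact: measurable_H_domain.
pose A (w : W) : R := chi w * (phi (w.1.1, w.2) * riesz a w.1).
have mA : measurable_fun setT A.
  apply: measurable_funM => //; apply: measurable_funM; last exact: (measurableT_comp mr).
  have mq : measurable_fun (setT : set W) (fun w => (w.1.1, w.2) : mE).
    by apply: measurable_fun_pair; mfun.
  exact: (measurableT_comp mphi mq).
pose snd2 (w : W) : mE := (w.1.2, w.2).
have msnd2 : measurable_fun setT snd2 by apply: measurable_fun_pair; mfun.
pose f (q : W * mE) : R := A q.1 * (eta q.2 * heat_kernel_at q.2 (snd2 q.1)).
have mf : measurable_fun setT f.
  apply: measurable_funM; first exact: (measurableT_comp mA).
  apply: measurable_funM; first exact: (measurableT_comp meta).
  have ms : measurable_fun (setT : set (W * mE)) (fun q => (q.2, snd2 q.1) : mE * mE).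
    by apply: measurable_fun_pair => /=; [exact: measurable_snd|exact: (measurableT_comp msnd2)].
  exact: (measurableT_comp measurable_heat_kernel_at ms).
have AE g w : (A w * g (snd2 w))%:E = (chi w * H_kernel H phi g w)%:E.
  by rewrite /A /H_kernel /riesz /a opprB -!mulrA.
have dom g : (\int[t2s]_w (A w * g (snd2 w))%:E =
    \int[time2space_measure R d]_(w in H_domain T) (H_kernel H phi g w)%:E)%E.
  rewrite [RHS]integral_mkcond; apply: eq_integral => w _; rewrite AE patchE /chi indicE.
  by case: ifP => _; rewrite ?mul1r ?mul0r.
have conv (g0 : E -> R) M0 w : source g0 M0 ->
    (\int[mu]_z (A w * (g0 z * heat_kernel_at z (snd2 w)))%:E = (A w * heat_conv g0 (snd2 w))%:E)%E.
  move=> sg; under eq_integral do rewrite EFinM.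
  by rewrite integralZl// -?(heat_conv_EFin sg)//; exact: (heat_conv_integrable sg).
have sa := source_abs se; have Ha := heat_conv_H_finite sa.
have ha0 w : 0 <= heat_conv (fun z => `|eta z|) w.
  rewrite (heat_convE sa); apply: fine_ge0; apply: integral_ge0 => z _.
  by rewrite lee_fin mulr_ge0 ?heat_kernel_at_ge0.
have foo : (\int[t2s]_w \int[mu]_z `|f (w, z)|%:E < +oo)%E.
  have h1 w : (\int[mu]_z `|f (w, z)|%:E = `|A w * heat_conv (fun z => `|eta z|) (snd2 w)|%:E)%E.
    rewrite normrM (ger0_norm (ha0 _)).
    transitivity (\int[mu]_z (`|A w|%:E * (`|eta z| * heat_kernel_at z (snd2 w))%:E))%E.
      apply: eq_integral => z _; rewrite -EFinM /f/= !normrM.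
      by rewrite (ger0_norm (heat_kernel_at_ge0 _ _)).
    by rewrite integralZl// ?EFinM ?(heat_conv_EFin sa)//; exact: (heat_conv_integrable sa).
  under eq_integral do rewrite h1.
  have /integrableP[_ +] := H_kernel_integrable hH Hphi Ha.
  apply: le_lt_trans; rewrite [leRHS]integral_mkcond le_eqVlt; apply/orP; left; apply/eqP.
  apply: eq_integral => w _; rewrite -abse_EFin AE patchE /chi indicE.
  by case: ifP => _; rewrite ?mul1r ?mul0r ?abse0.
have [fub _ iG] := fubini_real mf foo.
have alpha0 := alphaH_gt0 hH.
have Hh := heat_conv_H_finite se.
have rhsE z : ((H * (2 * H - 1))%:E * \int[t2s]_w (f (w, z))%:E =
    (eta z * H_inner T H phi (heat_kernel_at z))%:E)%E.
  have [zS|/(source_out se) e0] := pselect (strip z); last first.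
    by rewrite e0 mul0r integral0_eq ?mule0// => w _; rewrite /f/= e0 mul0r mulr0.
  have zT : z.1 <= T by move: zS => [/=]; rewrite in_itv/= => /andP[_ /ltW].
  have Hg := heat_H_finite hH hT dH zT.
  have ig := H_kernel_integrable hH Hphi Hg.
  have i1 : t2s.-integrable setT (fun w => (A w * heat_kernel_at z (snd2 w))%:E).
    apply/integrableP; split.
      apply/measurable_EFinP; apply: measurable_funM => //.
      exact: (measurableT_comp (measurable_heat_kernel_at_r z) msnd2).
    have /integrableP[_ +] := ig.
    apply: le_lt_trans; rewrite [leRHS]integral_mkcond le_eqVlt; apply/orP; left; apply/eqP.
    apply: eq_integral => w _; rewrite AE patchE /chi indicE.
    by case: ifP => _; rewrite ?mul1r ?mul0r ?abse0.
  transitivity ((H * (2 * H - 1))%:E * ((eta z)%:E * \int[t2s]_w (A w * heat_kernel_at z (snd2 w))%:E))%E.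
    congr (_ * _)%E; rewrite -integralZl//; apply: eq_integral => w _.
    by rewrite -EFinM /f/=; congr EFin; ring.
  rewrite dom /H_inner /Rintegral !EFinM fineK; first by rewrite muleCA.
  by apply: integrable_fin_num => //; exact: measurable_H_domain.
split; last first.
  rewrite (_ : (fun z => _) = (fun z => (H * (2 * H - 1))%:E * \int[t2s]_w (f (w, z))%:E)%E).
    exact: integrableZl.
  by apply/funext => z; rewrite rhsE.
under eq_integral do rewrite -rhsE.
rewrite integralZl// -fub /H_inner EFinM /Rintegral fineK; last first.
  by apply: integrable_fin_num; [exact: measurable_H_domain|exact: H_kernel_integrable].
congr (_ * _)%E; rewrite -dom; apply: eq_integral => w _.
by rewrite -(conv _ _ _ se).
Qed.

End heat_conv_facts.

(** * A jointly measurable version of the solution *)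

(** The least index is a measurable choice. *)
Lemma first_hit d (S : measurableType d) (A : nat -> set S) :
  (forall k, measurable (A k)) ->
  exists N : S -> nat, (forall k, measurable [set s | N s = k]) /\
    (forall s, (exists k, A k s) -> A (N s) s).
Proof.
move=> mA.
have /choice[N hN] : forall s, exists n, (A n s /\ forall j, (j < n)%N -> ~ A j s) \/
    ((forall k, ~ A k s) /\ n = 0%N).
  move=> s; have [ex|nex] := pselect (exists k, A k s); last first.
    by exists 0%N; right; split => // k Ak; apply: nex; exists k.
  have exb : exists k, `[< A k s >] by case: ex => k Ak; exists k; apply/asboolP.
  have [n /asboolP An min] := ex_minnP exb.
  exists n; left; split => // j jn Aj; have := min j; rewrite leqNgt jn => h.
  by have /h : `[< A j s >] by apply/asboolP.
exists N; split; last first.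
  by move=> s [k Ak]; case: (hN s) => [[]//|[/(_ k)]].
move=> k.
have -> : [set s | N s = k] = (A k `&` \bigcap_(j in [set j | (j < k)%N]) ~` A j) `|`
    (if k == 0%N then \bigcap_j ~` A j else set0).
  apply/seteqP; split=> s /=.
    by move=> <-; case: (hN s) => [[h1 h2]|[h1 ->]]; [left; split|right=> j _; exact: h1].
  case=> [[Ak nA]|].
    case: (hN s) => [[h1 h2]|[h1 _]]; last by case: (h1 k).
    apply/eqP; rewrite eqn_leq; apply/andP; split; rewrite leqNgt; apply/negP => lt.
    - exact: (h2 _ lt Ak).
    - exact: (nA _ lt h1).
  case: eqP => // -> nA; case: (hN s) => [[h1 _]|[_ ->]]//.
  by case: (nA (N s)).
apply: measurableU.
  by apply: measurableI => //; apply: bigcap_measurableType => j _; exact: measurableC.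
by case: eqP => // _; apply: bigcap_measurableType => j _; exact: measurableC.
Qed.

Lemma measurable_indexed d1 d2 d3 (S : measurableType d1) (W : measurableType d2)
    (V : measurableType d3) (N : S -> nat) (G : nat -> W -> V) :
  (forall k, measurable [set s | N s = k]) -> (forall k, measurable_fun setT (G k)) ->
  measurable_fun setT (fun q : S * W => G (N q.1) q.2).
Proof.
move=> mN mG _ B mB; rewrite setTI.
have -> : (fun q : S * W => G (N q.1) q.2) @^-1` B =
    \bigcup_k ([set s | N s = k] `*` (G k @^-1` B)).
  apply/seteqP; split => [[s w]/= h|[s w] [k _ [/= <-]]//].
  by exists (N s).
apply: bigcup_measurable => k _; apply: measurableX => //.
by rewrite -[X in measurable X]setTI; exact: mG.
Qed.

Section version.
Context {R : realType} {d : nat} {dO : measure_display}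
        {Omega : measurableType dO}.
Variables (T H : R) (P : probability Omega R).
Hypotheses (hT : 0 < T) (hH : 2^-1 < H < 1) (dH : d%:R / 4 < H).
Local Notation E := (R * 'rV[R]_d)%type.
Local Notation mE := (measurableTypeR R * 'rV[R]_d)%type.
Variable F : (E -> R) -> {RV P >-> R}.
Hypothesis hF : fractional_noise T H F.

Definition code_enum (n : nat) : @qcode d :=
  if unpickle n is Some c then if `[< strip_code T c >] then c else [::] else [::].

Lemma code_enum_strip n : strip_code T (code_enum n).
Proof.
have h0 : strip_code T ([::] : @qcode d) by [].
by rewrite /code_enum; case: (unpickle n) => [c|//]; case: asboolP.
Qed.

Lemma code_enumP (c : @qcode d) : strip_code T c -> exists n, code_enum n = c.
Proof.
by move=> cS; exists (pickle c); rewrite /code_enum pickleK; case: asboolP.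
Qed.

(** At each point the heat kernel is approximated at geometric speed by the
first admissible code of an enumeration, so that the resulting noise integrals
converge almost surely and depend measurably on the point. *)
Lemma measurable_version : exists Y : E -> Omega -> R,
  measurable_fun (setT : set (mE * Omega)) (fun q => Y q.1 q.2) /\
  forall z, z.1 <= T -> exists2 X : {RV P >-> R}, (X : Omega -> R) = Y z &
    is_noise_integral T H F (heat_kernel_at z) X.
Proof.
pose A n k : set mE := [set z | hdist T H (qcomb (code_enum k)) (heat_kernel_at z) <= (4^-1) ^+ n.+1].
have mA n k : measurable (A n k).
  have mh : measurable_fun (setT : set mE) (fun z => hdist T H (qcomb (code_enum k)) (heat_kernel_at z)).
    have mf : measurable_fun (setT : set (mE * mE))
        (fun q => (qcomb (code_enum k) \- heat_kernel_at q.1) q.2).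
      apply: measurable_funB; last exact: measurable_heat_kernel_at.
      exact: (measurableT_comp (measurable_qcomb _) measurable_snd).
    exact: measurable_H_inner.
  have := measurable_fun_ler mh (measurable_cst (4^-1 ^+ n.+1 : R)) => h.
  rewrite (_ : A n k = setT `&` (fun z => hdist T H (qcomb (code_enum k)) (heat_kernel_at z) <= 4^-1 ^+ n.+1) @^-1` [set true]).
    exact: h.
  by rewrite setTI; apply/seteqP; split => z.
have /choice[N hN] n := first_hit (mA n).
pose G k : Omega -> R := F (qcomb (code_enum k)).
pose Yn n (q : mE * Omega) : R := G (N n q.1) q.2.
have mYn n : measurable_fun setT (Yn n).
  by apply: (measurable_indexed (hN n).1) => k; exact: measurable_funPT.
exists (fun z w => real_limit Yn (z, w)); split.
  rewrite (_ : (fun q => _) = real_limit Yn); last by apply/funext => -[].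
  exact: measurable_real_limit.
move=> z zT; pose phi n := qcomb (code_enum (N n z)) : E -> R.
pose X := real_limit (fun n => F (phi n) : Omega -> R).
have mX : measurable_fun setT X.
  by apply: measurable_real_limit => // n; exact: measurable_funPT.
pose X' : {RV P >-> R} := mfun_Sub (mem_set mX : X \in mfun).
exists X' => //; apply: (@noise_limit _ _ _ _ _ _ _ hH _ hF phi) => //.
- by move=> n; apply: test_function_qcomb; exact: code_enum_strip.
- exact: heat_H_finite.
- move=> n; apply: (hN n).2.
  have [_ /(_ (4^-1 ^+ n.+1))] := heat_H_approximable hH hT dH zT.
  rewrite exprn_gt0// => /(_ isT)[c cS hc].
  by have [k kc] := code_enumP cS; exists k; rewrite /A/= kc ltW.
Qed.

End version.

(** * Averages of a mean square bounded process *)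

Section averages.
Context {R : realType} {dS : measure_display} {S : measurableType dS}
  {dO : measure_display} {Omega : measurableType dO}.
Variables (mu : {sigma_finite_measure set S -> \bar R}) (P : probability Omega R).
Variables (Z : S -> Omega -> R) (eta : S -> R) (C : R).
Hypotheses (mZ : measurable_fun setT (fun q : S * Omega => Z q.1 q.2))
  (meta : measurable_fun setT eta) (C0 : 0 <= C)
  (ZC : forall z, (\int[P]_w ((Z z w) ^+ 2)%:E <= C%:E)%E)
  (etaoo : (\int[mu]_z `|eta z|%:E < +oo)%E).

Let mZz z : measurable_fun setT (Z z).
Proof. exact: (measurableT_comp mZ (measurable_pair1 z)). Qed.

Let mZw w : measurable_fun setT (fun z => Z z w).
Proof. exact: (measurableT_comp mZ (measurable_pair2 w)). Qed.

Let mZs : measurable_fun setT (fun q : Omega * S => Z q.2 q.1).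
Proof.
have ms : measurable_fun (setT : set (Omega * S)) (fun q => (q.2, q.1) : S * Omega).
  by apply: measurable_fun_pair; mfun.
exact: (measurableT_comp mZ ms).
Qed.

Lemma process_L2 z : L2 P (Z z).
Proof. by split=> //; apply: (le_lt_trans (ZC z)); rewrite ltry. Qed.

Definition average (w : Omega) : R := fine (\int[mu]_z (Z z w * eta z)%:E)%E.

Let A := (\int[mu]_z `|eta z|%:E)%E.
Let B w := (\int[mu]_z ((Z z w) ^+ 2 * `|eta z|)%:E)%E.

Let mZ2 : measurable_fun setT (fun q : Omega * S => ((Z q.2 q.1) ^+ 2 * `|eta q.2|)%:E).
Proof.
apply/measurable_EFinP; apply: measurable_funM; first by apply: measurable_funX; exact: mZs.
by apply: measurableT_comp => //; exact: (measurableT_comp meta).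
Qed.
Let Z2_ge0 (q : Omega * S) : (0 <= ((Z q.2 q.1) ^+ 2 * `|eta q.2|)%:E)%E.
Proof. by rewrite lee_fin mulr_ge0 ?sqr_ge0. Qed.

Let mB : measurable_fun setT B.
Proof. exact: (measurable_fun_fubini_tonelli_F (fun q : Omega * S => ((Z q.2 q.1) ^+ 2 * `|eta q.2|)%:E) mZ2). Qed.

Let B0 w : (0 <= B w)%E.
Proof. by apply: integral_ge0 => z _; rewrite lee_fin mulr_ge0 ?sqr_ge0. Qed.

Let intB : (\int[P]_w B w <= C%:E * A)%E.
Proof.
rewrite /B (@fubini_tonelli _ _ _ _ R P mu _ mZ2 Z2_ge0)/= /A -ge0_integralZl//; last by mfun.
apply: ge0_le_integral => //.
- by move=> z _; apply: integral_ge0 => w _; rewrite lee_fin mulr_ge0 ?sqr_ge0.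
- exact: (measurable_fun_fubini_tonelli_G (fun q : Omega * S => ((Z q.2 q.1) ^+ 2 * `|eta q.2|)%:E) mZ2).
- by apply: measurable_funeM; mfun.
- move=> z _; have mz := mZz z; under eq_integral do rewrite EFinM.
  rewrite ge0_integralZr//; first by apply: lee_wpmul2r; [rewrite lee_fin normr_ge0|exact: ZC].
  + by mfun.
  + by move=> w _; rewrite lee_fin sqr_ge0.
Qed.

Lemma process_ae_L2 : {ae P, forall w, (\int[mu]_z ((Z z w) ^+ 2 * `|eta z|)%:E < +oo)%E}.
Proof.
have : P.-integrable setT B.
  apply/integrableP; split=> //; under eq_integral do rewrite gee0_abs//.
  by apply: (le_lt_trans intB); apply: lte_mul_pinfty.
move=> /(integrable_ae measurableT); apply: filterS => w /(_ I).
by rewrite ge0_fin_numE.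
Qed.

(** Cauchy-Schwarz for the measure with density |eta|. *)
Let CS w : (B w < +oo)%E ->
  mu.-integrable setT (fun z => (Z z w * eta z)%:E) /\
  (((average w) ^+ 2)%:E <= A * B w)%E.
Proof.
move=> Boo; have mw := mZw w.
pose r (z : S) : R := Num.sqrt `|eta z|.
have rr z : r z * r z = `|eta z| by rewrite -expr2 sqr_sqrtr.
have mr : measurable_fun setT r.
  rewrite (_ : r = (fun x : R => x `^ 2^-1) \o (fun z => `|eta z|)).
    by apply: measurableT_comp; [exact: measurable_powR|mfun].
  by apply/funext => z; rewrite /r/= powR12_sqrt.
pose f (z : S) : R := `|Z z w| * r z.
have Lr : L2 mu r.
  by split; [exact: mr|under eq_integral do rewrite expr2 rr].
have Lf : L2 mu f.
  split; first by rewrite /f; mfun.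
  rewrite (_ : (\int[mu]_z _)%E = B w)//; apply: eq_integral => z _.
  by rewrite /f exprMn real_normK ?num_real// [r z ^+ 2]expr2 rr.
have fr z : f z * r z = `|Z z w * eta z| by rewrite /f -mulrA rr normrM.
have i : mu.-integrable setT (fun z => (Z z w * eta z)%:E).
  have /integrableP[_ h] := L2_integrableM Lf Lr.
  apply/integrableP; split; first by mfun.
  by apply: le_lt_trans h; rewrite le_eqVlt; apply/orP; left; apply/eqP; apply: eq_integral => z _; rewrite fr !abse_EFin normr_id.
split=> //; have cs := inner_CS (cov_semi_inner mu) Lf Lr.
have -> : (A * B w)%E = (cov mu f f * cov mu r r)%:E.
  rewrite EFinM !cov_sqr// muleC; congr (_ * _)%E; apply: eq_integral => z _.
    by rewrite /f exprMn real_normK ?num_real// [r z ^+ 2]expr2 rr.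
  by rewrite expr2 rr.
rewrite lee_fin; apply: le_trans cs; rewrite -[leLHS]real_normK ?num_real//.
rewrite lerXn2r ?nnegrE ?fine_ge0//.
  by apply: integral_ge0 => z _; rewrite fr.
rewrite -lee_fin /cov fineK; last by apply: integrable_fin_num => //; exact: L2_integrableM.
rewrite -abse_EFin /average fineK; last exact: integrable_fin_num.
apply: (le_trans (le_abse_integral mu measurableT _)); first by mfun.
by rewrite le_eqVlt; apply/orP; left; apply/eqP; apply: eq_integral => z _; rewrite fr.
Qed.

Lemma average_EFin : {ae P, forall w,
  mu.-integrable setT (fun z => (Z z w * eta z)%:E) /\
  (average w)%:E = (\int[mu]_z (Z z w * eta z)%:E)%E}.
Proof.
apply: filterS process_ae_L2 => w /CS[i _]; split=> //.
by rewrite /average fineK//; exact: integrable_fin_num.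
Qed.

Lemma measurable_average : measurable_fun setT average.
Proof.
apply: (@measurableT_comp _ _ _ _ _ _ (@fine R)) => //.
have mh : measurable_fun setT (fun q : Omega * S => Z q.2 q.1 * eta q.2).
  by apply: measurable_funM => //; exact: (measurableT_comp meta).
exact: (measurable_integral_param mu measurableT mh).
Qed.

Lemma average_sqr_le : (\int[P]_w ((average w) ^+ 2)%:E <= C%:E * (A * A))%E.
Proof.
have ma := measurable_average.
apply: (@le_trans _ _ (\int[P]_w (A * B w))%E).
  apply: ae_ge0_le_integral => //.
  - by move=> w _; rewrite lee_fin sqr_ge0.
  - by mfun.
  - by move=> w _; apply: mule_ge0 => //; exact: integral_ge0.
  - exact: measurable_funeM.
  - by apply: filterS process_ae_L2 => w /CS[].
have A0 : (0 <= A)%E by exact: integral_ge0.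
rewrite ge0_integralZl// [leRHS]muleCA; apply: lee_wpmul2l => //.
Qed.

Lemma average_L2 : L2 P average.
Proof.
split; first exact: measurable_average.
by apply: (le_lt_trans average_sqr_le); rewrite lte_mul_pinfty// lte_mul_pinfty//; rewrite ?integral_ge0// ge0_fin_numE// integral_ge0.
Qed.

Lemma cov_average (xi : Omega -> R) : L2 P xi ->
  (cov P xi average)%:E = (\int[mu]_z (eta z * cov P xi (Z z))%:E)%E.
Proof.
move=> Lxi; have [mxi xioo] := Lxi.
pose f (q : Omega * S) : R := xi q.1 * (Z q.2 q.1 * eta q.2).
have mf : measurable_fun setT f.
  apply: measurable_funM; first exact: (measurableT_comp mxi).
  by apply: measurable_funM => //; exact: (measurableT_comp meta).
pose K := (\int[P]_w ((xi w) ^+ 2)%:E + C%:E)%E.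
have K0 : (0 <= K)%E by rewrite adde_ge0 ?integral_ge0// => w _; rewrite lee_fin sqr_ge0.
have Koo : (K < +oo)%E by rewrite lte_add_pinfty// ltry.
have foo : (\int[P]_w \int[mu]_z `|f (w, z)|%:E < +oo)%E.
  have mf' : measurable_fun setT (fun q => `|f q|%:E) by mfun.
  have f0' q : (0 <= `|f q|%:E)%E by rewrite lee_fin.
  rewrite (@fubini_tonelli _ _ _ _ R P mu _ mf' f0')/=.
  apply: (@le_lt_trans _ _ (\int[mu]_z (K * `|eta z|%:E))%E); last first.
    rewrite ge0_integralZl//; last by mfun.
    by apply: lte_mul_pinfty => //; rewrite ge0_fin_numE.
  apply: ge0_le_integral => //.
  - by move=> z _; apply: integral_ge0 => w _; exact: (f0' (w, z)).
  - exact: (measurable_fun_fubini_tonelli_G (fun q => `|f q|%:E) mf').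
  - by apply: measurable_funeM; mfun.
  - move=> z _; have mz := mZz z.
    apply: (@le_trans _ _ (\int[P]_w ((((xi w) ^+ 2)%:E + ((Z z w) ^+ 2)%:E) * `|eta z|%:E))%E).
      apply: ge0_le_integral => //.
      + by rewrite /f/=; mfun.
      + by apply: emeasurable_funM; [apply: emeasurable_funD; mfun|exact: measurable_cst].
      + move=> w _; rewrite -EFinD -EFinM lee_fin /f/= mulrA normrM; apply: ler_wpM2r => //.
        rewrite ler_norml; apply/andP; split.
          have := sqr_ge0 (xi w + Z z w); have := sqr_ge0 (xi w); have := sqr_ge0 (Z z w); nra.
        have := sqr_ge0 (xi w - Z z w); have := sqr_ge0 (xi w); have := sqr_ge0 (Z z w); nra.
    rewrite ge0_integralZr//; last 2 first.
    + by apply: emeasurable_funD; mfun.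
    + by move=> w _; rewrite -EFinD lee_fin addr_ge0 ?sqr_ge0.
    apply: lee_wpmul2r; first by rewrite lee_fin.
    rewrite ge0_integralD//; last 4 first.
    + by move=> w _; rewrite lee_fin sqr_ge0.
    + by mfun.
    + by move=> w _; rewrite lee_fin sqr_ge0.
    + by mfun.
    by apply: leeD => //; exact: ZC.
have [fub _ _] := fubini_real mf foo.
have ma := measurable_average.
rewrite /cov fineK; last first.
  by apply: integrable_fin_num => //; apply: L2_integrableM => //; exact: average_L2.
transitivity (\int[P]_w \int[mu]_z (f (w, z))%:E)%E.
  apply: ae_eq_integral => //.
  - by mfun.
  - exact: (measurable_integral_param mu measurableT mf).
  - apply: filterS average_EFin => w [i aE] _; rewrite EFinM aE -integralZl//.
rewrite fub; apply: eq_integral => z _.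
rewrite EFinM fineK; last first.
  by apply: integrable_fin_num => //; apply: L2_integrableM => //; exact: process_L2.
rewrite -integralZl//; last by apply: L2_integrableM => //; exact: process_L2.
by apply: eq_integral => w _; rewrite -EFinM /f/=; congr EFin; ring.
Qed.

End averages.

(** * The process solution represents the distribution solution *)

Section existence.
Context {R : realType} {d : nat} {dO : measure_display}
        {Omega : measurableType dO}.
Variables (T H : R) (P : probability Omega R).
Hypotheses (hT : 0 < T) (hH : 2^-1 < H < 1).
Local Notation E := (R * 'rV[R]_d)%type.
Local Notation mE := (measurableTypeR R * 'rV[R]_d)%type.
Local Notation mu := (spacetime_measure R d).
Local Notation strip := (@open_strip R d T).
Local Notation PS := (cov_semi_inner P).
Variable F : (E -> R) -> {RV P >-> R}.
Hypothesis hF : fractional_noise T H F.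

Lemma open_strip_closed (z : E) : strip z -> closed_strip T z.
Proof.
by move=> [/=]; rewrite in_itv/= => /andP[h1 h2] _; split => //=; rewrite in_itv/= !ltW.
Qed.

Lemma integral_closed_strip (Y Z : E -> R) (eta : E -> R) :
  (forall z, eta z != 0 -> closed_strip T z /\ Z z = Y z) ->
  (\int[mu]_(z in closed_strip T) (Y z * eta z)%:E = \int[mu]_z (Z z * eta z)%:E)%E.
Proof.
move=> h; rewrite integral_mkcond; apply: eq_integral => z _; rewrite patchE.
have [->|/h[zS ->]] := eqVneq (eta z) 0; first by rewrite !mulr0; case: ifP.
by rewrite mem_set.
Qed.

Lemma source_strip (eta : E -> R) M z : source T eta M -> eta z != 0 -> strip z.
Proof. by move=> se nz; apply: contrapT => /(source_out se)/eqP; rewrite (negbTE nz). Qed.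

Lemma dist_solutionP eta : test_function strip eta ->
  is_noise_integral T H F (heat_conv eta) (dist_solution T H F eta).
Proof.
move=> te; have [M se] := source_test te.
apply: noise_integral_exists => //; exact: (heat_conv_in_H hH hT se).
Qed.

(** The covariance with D is continuous in mean square. *)
Lemma noise_orthogonal (D : Omega -> R) : L2 P D ->
  (forall phi, test_function strip phi -> cov P (F phi) D = 0) ->
  forall f (U : {RV P >-> R}), is_noise_integral T H F f U -> cov P U D = 0.
Proof.
move=> LD h f U iU; have LU := noise_integral_L2 hF iU.
have [phi [Dp _ _] cv] := noise_integral_cvg hF iU.
have D0 : cov P (D \- D) (D \- D) @[n --> \oo] --> (0 : R).
  rewrite (inner_sqrB PS)// (_ : _ - _ + _ = 0); [exact: cvg_cst|ring].
have c := inner_cvg PS (fun n => noise_L2 hF (Dp n)) (fun _ : nat => LD) LU LD cv D0.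
apply: (cvg_unique _ c) => //.
rewrite (_ : (fun n => _) = cst 0); first exact: cvg_cst.
by apply/funext => n; rewrite h.
Qed.

Hypothesis dH : d%:R / 4 < H.

Lemma solution_exists : exists2 Y : E -> Omega -> R,
  solution_process T H F Y & is_modification T H F Y.
Proof.
have [Y [mY nY]] := measurable_version hT hH dH hF.
have [C C0 hC] := heat_H_bounded (d := d) hH hT dH.
have ms z : z.1 <= T -> (\int[P]_w ((Y z w) ^+ 2)%:E <= C%:E)%E.
  move=> zT; have [X XY iX] := nY z zT; rewrite -XY -cov_sqr.
    by rewrite (noise_integral_cov hH hF iX iX) lee_fin hC.
  exact: (noise_integral_L2 hF iX).
have cT (z : E) : closed_strip T z -> z.1 <= T.
  by move=> [/=]; rewrite in_itv/= => /andP[].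
exists Y; last first.
  move=> z /cT zT; have [X XY iX] := nY z zT.
  have iH : in_H T H (heat_kernel_at z).
    by apply: H_approximable_in_H => //; exact: heat_H_approximable.
  split=> //; rewrite -XY.
  exact: (noise_integral_unique hH hF iX (noise_integral_exists hH hF iH)).
split.
- by rewrite /jointly_measurable; apply: measurable_funTS.
- move=> K _ KS; apply: (@le_lt_trans _ _ C%:E); last by rewrite ltry.
  apply: ge_ereal_sup => _ [z Kz <-]; rewrite unlock.
  under eq_integral do rewrite real_normK ?num_real//.
  by apply: ms; exact/cT/KS.
move=> eta te; have [M se] := source_test te.
have iX := dist_solutionP te; split; first exact: (heat_conv_in_H hH hT se).
set X := dist_solution T H F eta in iX *.
pose Z (z : E) (w : Omega) : R := if z.1 <= T then Y z w else 0.
have mZ : measurable_fun (setT : set (mE * Omega)) (fun q => Z q.1 q.2).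
  by rewrite /Z; apply: measurable_fun_ifT => //; mfun.
have ZC z : (\int[P]_w ((Z z w) ^+ 2)%:E <= C%:E)%E.
  rewrite /Z; case: (boolP (z.1 <= T)) => [/ms//|_].
  by under eq_integral do rewrite expr0n/=; rewrite integral0 lee_fin.
have ZY z : eta z != 0 -> closed_strip T z /\ Z z = Y z.
  move=> nz; have zS := source_strip se nz; split; first exact: open_strip_closed.
  by apply/funext => w; rewrite /Z (cT _ (open_strip_closed zS)).
have meta := source_meas se; have etaoo := source_int se.
have aE := average_EFin mZ meta C0 ZC etaoo.
have LI := average_L2 mZ meta C0 ZC etaoo.
set I := average mu Z eta in aE LI.
have LX := noise_integral_L2 hF iX.
pose D := (X : Omega -> R) \- I.
have LD : L2 P D by exact: (dom_sub PS).
have avg xi : L2 P xi -> (cov P xi I)%:E = (\int[mu]_z (eta z * cov P xi (Z z))%:E)%E.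
  exact: (cov_average mZ meta C0 ZC etaoo).
have ortho phi : test_function strip phi -> cov P (F phi) D = 0.
  move=> tp; have Lp := noise_L2 hF tp; have ip := noise_integral_test hH F tp.
  rewrite (inner_Br PS)// (noise_integral_cov hH hF ip iX); apply/eqP; rewrite subr_eq0; apply/eqP.
  apply: EFin_inj; rewrite avg// (heat_conv_inner hH hT dH se (test_function_measurable tp) (test_function_H_finite hH tp)).1.
  apply: eq_integral => z _; congr EFin.
  have [->|nz] := eqVneq (eta z) 0; first by rewrite !mul0r.
  have [zC ->] := ZY z nz; have [U <- iU] := nY z (cT _ zC).
  by rewrite (noise_integral_cov hH hF ip iU).
have ort := noise_orthogonal LD ortho.
have DI : cov P D I = 0.
  apply: EFin_inj; rewrite avg// integral0_eq// => z _.
  have [->|nz] := eqVneq (eta z) 0; first by rewrite mul0r.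
  have [zC ->] := ZY z nz; have [U <- iU] := nY z (cT _ zC).
  by rewrite (inner_sym PS)// ?(ort _ _ iU) ?mulr0//; exact: (noise_integral_L2 hF iU).
have DD : cov P D D = 0.
  have -> : cov P D D = cov P D X - cov P D I by exact: (inner_Br PS).
  by rewrite DI subr0 (inner_sym PS)//; exact: (ort _ _ iX).
have := cov0_ae LD DD; apply: filterS2 aE => w [_ aw] /eqP.
rewrite subr_eq0 => /eqP ->; rewrite aw; apply: esym.
by apply: integral_closed_strip => z /ZY[zC zY]; split=> //; rewrite zY.
Qed.

End existence.

(** * Necessity *)

Section heat_continuity.
Context {R : realType} {d : nat}.
Local Notation E := (R * 'rV[R]_d)%type.

Lemma heat_kernel_continuous (w : E) : 0 < w.1 -> {for w, continuous (@heat_kernel R d)}.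
Proof.
move=> w0; rewrite /prop_for /continuous_at.
have pi0 : 0 < 4 * pi * w.1 by rewrite !mulr_gt0// pi_gt0.
pose f (z : E) : R := expR (- (d%:R / 2) * ln (4 * pi * z.1)) * expR (- sqnorm z.2 / (4 * z.1)).
have c1 : fst z @[z --> w] --> w.1 by exact: cvg_fst.
have near0 : \forall z \near w, 0 < z.1.
  have : \forall x \near w.1, 0 < x by exact: lt_nbhsr.
  by move=> /c1.
have csq : sqnorm z.2 @[z --> w] --> sqnorm w.2.
  rewrite /sqnorm; apply: cvg_big; first exact: add_continuous.
  move=> i _; rewrite expr2; under eq_fun do rewrite expr2.
  by apply: cvgM; exact: (@continuous_coord _ _ (Some i)).
have fw : f z @[z --> w] --> f w.
  apply: cvgM; apply: continuous_cvg; [exact: continuous_expR| |exact: continuous_expR|].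
    apply: cvgMl_tmp; apply: continuous_cvg; first exact: continuous_ln.
    exact: cvgMl_tmp.
  apply: cvgM; first exact: cvgN.
  by apply: cvgV; [rewrite gt_eqF// mulr_gt0|exact: cvgMl_tmp].
have fE z : 0 < z.1 -> f z = heat_kernel z.
  by move=> z0; rewrite /f /heat_kernel z0 /powR gt_eqF// !mulr_gt0// pi_gt0.
rewrite -(fE w w0); apply: cvg_trans fw; apply: near_eq_cvg.
by apply: filterS near0 => z /fE.
Qed.

Lemma heat_kernel_at_continuous (z0 w : E) : w.1 < z0.1 ->
  {for z0, continuous (fun z => heat_kernel_at z w)}.
Proof.
move=> h; apply: (@continuous_comp _ _ _ (fun z : E => (z.1 - w.1, z.2 - w.2) : E) (@heat_kernel R d)).
  apply: (@cvgB _ _ _ _ _ (id : E -> E) (cst w)); [exact: cvg_id|exact: cvg_cst].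
by apply: heat_kernel_continuous; rewrite /= subr_gt0.
Qed.

End heat_continuity.

Section centered_boxes.
Context {R : realType} {d : nat}.
Local Notation E := (R * 'rV[R]_d)%type.
Local Notation mE := (measurableTypeR R * 'rV[R]_d)%type.
Local Notation mu := (spacetime_measure R d).
Variable t0 : R.
Let z0 : E := (t0, 0).

Definition lower (r : R) (i : option 'I_d) : R := coord i z0 - r.
Definition upper (r : R) (i : option 'I_d) : R := coord i z0 + r.

Lemma centered_box_gt0 (r : R) : 0 < r -> (0 < mu (box (lower r) (upper r)))%E.
Proof.
move=> r0.
have -> : box (lower r) (upper r) = `]t0 - r, t0 + r[%classic `*` @cube R d r.
  apply/seteqP; split => z /=.
    move=> bz; split; first by have := bz None; rewrite /= in_itv.
    by move=> i; have := bz (Some i); rewrite /lower /upper/= mxE sub0r add0r -ltr_norml.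
  move=> [h1 h2] [i|]; last by move: h1; rewrite in_itv.
  by have := h2 i; rewrite /lower /upper/= mxE sub0r add0r -ltr_norml.
rewrite /spacetime_measure product_measure1E//; last exact: measurable_cube.
rewrite lebesgue_rV_cube//; apply: mule_gt0; last by rewrite lte_fin exprn_gt0// mulr_gt0.
have := @lebesgue_measure_itv R `]t0 - r, t0 + r[ => /= ->.
by rewrite lte_fin ltrD2l gtrN// -EFinB lte_fin; lra.
Qed.

Lemma centered_bump_mass (r : R) : 0 < r ->
  (0 < \int[mu]_z (bump 0 (lower r) (upper r) z)%:E)%E.
Proof.
move=> r0; have mb := measurable_bump 0 (lower r) (upper r).
rewrite lt0e; apply/andP; split; last by apply: integral_ge0 => z _; rewrite lee_fin bump_ge0.
apply/eqP => i0.
have : (\int[mu]_z `|(bump 0 (lower r) (upper r) z)%:E| = 0)%E.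
  by rewrite -i0; apply: eq_integral => z _; rewrite gee0_abs// lee_fin bump_ge0.
move=> /(ae_eq_integral_abs mu measurableT _).1; case; first by mfun.
move=> N [mN N0 hN]; have := centered_box_gt0 r0.
rewrite (_ : mu (box (lower r) (upper r)) = 0%E) ?ltxx//.
apply: (subset_measure0 _ mN _ N0); first exact: measurable_box.
move=> z bz; apply: hN => /= /(_ I) [] /eqP.
by rewrite gt_eqF// bump_gt0.
Qed.

Lemma centered_box_nbhs (r : nat -> R) (U : set E) : r n @[n --> \oo] --> 0 ->
  nbhs z0 U -> \forall n \near \oo, box (lower (r n)) (upper (r n)) `<=` U.
Proof.
move=> r0 /nbhs_qbox[c [cz cU]].
have : \forall n \near \oo, forall i, r n < coord i z0 - ratr (c.1 i) /\ r n < ratr (c.2 i) - coord i z0.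
  apply: filter_forall => i; have /andP[h1 h2] := cz i.
  have e1 : 0 < coord i z0 - ratr (c.1 i) by rewrite subr_gt0.
  have e2 : 0 < ratr (c.2 i) - coord i z0 by rewrite subr_gt0.
  have /cvgrPdist_lt/(_ _ e1) H1 := r0; have /cvgrPdist_lt/(_ _ e2) H2 := r0.
  apply: filterS2 H1 H2 => n; rewrite !sub0r !normrN => k1 k2.
  by split; apply: le_lt_trans (ler_norm _) _.
apply: filterS => n hn z bz; apply: cU => i; have [h1 h2] := hn i.
have /andP[] := bz i; rewrite /lower /upper /=.
move: (ratr (c.1 i)) (ratr (c.2 i)) h1 h2 => x y h1 h2 h3 h4; apply/andP; split; lra.
Qed.

End centered_boxes.

Section necessity.
Context {R : realType} {d : nat} {dO : measure_display}
        {Omega : measurableType dO}.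
Variables (T H : R) (P : probability Omega R).
Hypotheses (hT : 0 < T) (hH : 2^-1 < H < 1).
Local Notation E := (R * 'rV[R]_d)%type.
Local Notation mE := (measurableTypeR R * 'rV[R]_d)%type.
Local Notation mu := (spacetime_measure R d).
Local Notation strip := (@open_strip R d T).
Variable F : (E -> R) -> {RV P >-> R}.
Hypothesis hF : fractional_noise T H F.

Lemma measurable_closed_strip : measurable (closed_strip T : set mE).
Proof. by apply: measurableX => //; exact: measurable_itv. Qed.

(** The moments of a solution are only bounded locally; those of the solution cut
off outside a compact set are bounded globally. *)
Definition cut (K : set E) (Y : E -> Omega -> R) (z : E) (w : Omega) : R :=
  if z \in K then Y z w else 0.

Lemma measurable_cut (K : set E) (Y : E -> Omega -> R) : compact K -> closed K ->
  K `<=` closed_strip T -> jointly_measurable T Y ->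
  measurable_fun (setT : set (mE * Omega)) (fun q => cut K Y q.1 q.2).
Proof.
move=> _ clK KS mY; have mK : measurable (K : set mE) by exact: closed_measurable_spacetime.
have mKO : measurable (K `*` setT : set (mE * Omega)) by exact: measurableX.
have mCO : measurable (closed_strip T `*` setT : set (mE * Omega)).
  by apply: measurableX => //; exact: measurable_closed_strip.
have : measurable_fun (K `*` setT : set (mE * Omega)) (fun q => Y q.1 q.2).
  by apply: (measurable_funS mCO _ mY) => -[z w] [/= zK _]; split => //=; exact: KS.
move=> /(measurable_restrictT _ mKO).1.
rewrite (_ : _ \_ _ = (fun q => cut K Y q.1 q.2))//.
apply/funext => -[z w]; rewrite patchE /cut/=.
case: ifPn => [/set_mem[/= zK _]|]; first by rewrite mem_set.
rewrite notin_setE => h; case: ifPn => // /set_mem zK; case: h; split => //.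
Qed.

Lemma cut_bounded (K : set E) (Y : E -> Omega -> R) : compact K ->
  K `<=` closed_strip T -> locally_ms_bounded T P Y ->
  exists2 C : R, 0 <= C & forall z, (\int[P]_w ((cut K Y z w) ^+ 2)%:E <= C%:E)%E.
Proof.
move=> cK KS /(_ K cK KS); set s := ereal_sup _ => soo.
have h z : K z -> (\int[P]_w ((Y z w) ^+ 2)%:E <= s)%E.
  move=> Kz; apply: ereal_sup_ubound; exists z => //; rewrite unlock.
  by under eq_integral do rewrite real_normK ?num_real//.
exists (Num.max (fine s) 0); first by rewrite le_max lexx orbT.
move=> z; rewrite /cut; case: (boolP (z \in K)) => [/set_mem Kz|_]; last first.
  by under eq_integral do rewrite expr0n/=; rewrite integral0 lee_fin le_max lexx orbT.
apply: (le_trans (h z Kz)).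
have s0 : (0 <= s)%E by apply: le_trans (h z Kz); apply: integral_ge0 => w _; rewrite lee_fin sqr_ge0.
rewrite -[leLHS]fineK ?ge0_fin_numE// lee_fin le_max lexx//.
Qed.

Lemma energy_scale (c : R) (f : E -> R) : measurable_fun (strip : set mE) f ->
  energy T H (fun w => c * f w) (fun w => c * f w) = ((c ^+ 2)%:E * energy T H f f)%E.
Proof.
move=> mf; rewrite /energy -ge0_integralZl//; last 3 first.
- exact: measurable_H_domain.
- apply: (measurableT_comp (@abse_measurable R setT)) => //; apply/measurable_EFinP.
  exact: measurable_H_kernel.
- by rewrite lee_fin sqr_ge0.
apply: eq_integral => w _; rewrite !abse_EFin -EFinM; congr EFin.
rewrite /H_kernel -[in RHS](ger0_norm (sqr_ge0 c)) -normrM; congr (`|_|); ring.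
Qed.

(** If a solution exists, then smearing the heat kernel over shrinking
neighbourhoods of its pole keeps its energy bounded, and by Fatou's lemma the
heat kernel itself has finite energy. *)
Lemma solution_necessary (Y : E -> Omega -> R) : solution_process T H F Y ->
  d%:R / 4 < H.
Proof.
move=> [mY bY rY]; rewrite ltNge; apply/negP => Hd.
have [t0 t0E] : exists t0, t0 = T / 2 by exists (T / 2).
have t00 : 0 < t0 <= T by rewrite t0E divr_gt0//= ler_pdivrMr// ler_peMr ?ler1n// ltW.
pose z0 : E := (t0, 0).
pose r (n : nat) : R := T / 4 * n.+1%:R^-1.
have r0 n : 0 < r n by rewrite /r mulr_gt0 ?divr_gt0// invr_gt0.
have rT n : r n <= T / 4.
  by rewrite /r ler_piMr//; [rewrite divr_ge0// ltW|rewrite invf_le1// ler1n].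
have rlim : r n @[n --> \oo] --> 0.
  by rewrite -(mulr0 (T / 4)); apply: cvgMl_tmp; exact: (@cvg_harmonic R).
pose l n := lower (d := d) t0 (r n); pose u n := upper (d := d) t0 (r n).
pose e n : E -> R := bump 0 (l n) (u n).
have te n : test_function strip (e n).
  by apply: test_function_bump; rewrite /l /u /lower /upper/= t0E; have := rT n; have := r0 n; lra.
have e0 n z : 0 <= e n z by exact: bump_ge0.
have me n : measurable_fun (setT : set mE) (e n) by exact: measurable_bump.
have eoo n : (\int[mu]_z `|e n z|%:E < +oo)%E by exact: test_function_integrable (te n).
have eabs n : (\int[mu]_z `|e n z|%:E = \int[mu]_z (e n z)%:E)%E.
  by apply: eq_integral => z _; rewrite ger0_norm.
pose m n : R := fine (\int[mu]_z (e n z)%:E)%E.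
have mE' n : (\int[mu]_z (e n z)%:E = (m n)%:E)%E.
  rewrite /m fineK// ge0_fin_numE; first by rewrite -eabs.
  by apply: integral_ge0 => z _; rewrite lee_fin.
have m0 n : 0 < m n by rewrite -lte_fin -mE'; exact: centered_bump_mass.
have se n : source T (e n) 1.
  have [_ [_ [_ [_ _ eout]]]] := test_function_bounded (te n).
  split => //; first by move=> z; rewrite ger0_norm// bump_le1.
pose K := closed_box (l 0%N) (u 0%N).
have cK : compact K by exact: closed_box_compact.
have clK : closed K by exact: closed_closed_box.
have KS : K `<=` closed_strip T.
  move=> z /(_ None); rewrite /l /u /lower /upper/= t0E => /andP[h1 h2]; have := rT 0%N; have := r0 0%N => h4 h3.
  by split => //=; rewrite in_itv/=; apply/andP; split; lra.
have eK n z : e n z != 0 -> K z.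
  move=> ez i; have bz : box (l n) (u n) z by apply: contrapT => nb; move: ez; rewrite /e bump_eq0// eqxx.
  have rn : r n <= r 0%N.
    by rewrite /r ler_pM2l ?divr_gt0// lef_pV2 ?posrE// ler_nat.
  have := bz i; rewrite /l /u /lower /upper => /andP[h1 h2].
  by apply/andP; split; lra.
pose Z := cut K Y.
have mZ := measurable_cut cK clK KS mY.
have [C C0 ZC] := cut_bounded cK KS bY.
pose h n := heat_conv (e n).
have h0 n w : 0 <= h n w.
  rewrite /h (heat_convE (se n)); apply: fine_ge0; apply: integral_ge0 => z _.
  by rewrite lee_fin mulr_ge0 ?heat_kernel_at_ge0.
have Hh n : H_finite T H (h n) := heat_conv_H_finite hH hT (se n).
have a0 := alphaH_gt0 hH; set a := H * (2 * H - 1) in a0.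
have bound n : (energy T H (h n) (h n) <= (C / a * (m n) ^+ 2)%:E)%E.
  have iX := dist_solutionP hT hH hF (te n); have [_ xY] := rY _ (te n).
  set X := dist_solution T H F (e n) in iX xY.
  have key : (H_inner T H (h n) (h n) <= C * (m n) ^+ 2).
    rewrite -(noise_integral_cov hH hF iX iX) -lee_fin cov_sqr; last exact: (noise_integral_L2 hF iX).
    apply: (@le_trans _ _ (C%:E * ((\int[mu]_z `|e n z|%:E) * (\int[mu]_z `|e n z|%:E)))%E); last first.
      by rewrite eabs mE' -!EFinM expr2.
    apply: le_trans (average_sqr_le mZ (me n) C0 ZC (eoo n)).
    have ma := measurable_average mu mZ (me n).
    have mX : measurable_fun setT X by exact: measurable_funPT.
    rewrite le_eqVlt; apply/orP; left; apply/eqP; apply: ae_eq_integral => //.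
    - by mfun.
    - by mfun.
    apply: filterS2 xY (average_EFin mZ (me n) C0 ZC (eoo n)) => w xw [_ aw] _.
    congr EFin; congr (_ ^+ 2); apply: EFin_inj; rewrite xw aw.
    apply: integral_closed_strip => z /eK Kz; split; first exact: KS.
    by rewrite /cut mem_set.
  have [_ fin] := (H_finiteP T H _).1 (Hh n).
  rewrite -[leLHS]fineK ?ge0_fin_numE ?energy_ge0// lee_fin.
  by rewrite mulrAC ler_pdivlMr// mulrC; move: key; rewrite H_inner_energy.
pose k n (w : E) : R := (m n)^-1 * h n w.
have k0 n w : 0 <= k n w by rewrite mulr_ge0// invr_ge0 ltW.
have mk n : measurable_fun (setT : set mE) (k n).
  by apply: measurable_funM => //; exact: measurable_heat_conv (se n).
have kbound n : (energy T H (k n) (k n) <= (C / a)%:E)%E.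
  rewrite energy_scale; last exact: (Hh n).1.
  apply: (@le_trans _ _ (((m n)^-1 ^+ 2)%:E * (C / a * (m n) ^+ 2)%:E)%E).
    by apply: lee_wpmul2l => //; rewrite lee_fin sqr_ge0.
  by rewrite -EFinM lee_fin mulrCA -exprMn mulVf ?gt_eqF// expr1n mulr1.
pose g := heat_kernel_at z0.
have mg : measurable_fun (setT : set mE) g by exact: measurable_heat_kernel_at_r.
have klim (w : E) : w.1 < t0 -> k n w @[n --> \oo] --> g w.
  move=> wt; apply/cvgrPdist_le => eps eps0.
  have /cvgrPdist_le/(_ _ eps0) := heat_kernel_at_continuous (z0 := z0) wt.
  move=> /(centered_box_nbhs rlim); apply: filterS => n hn.
  have il := heat_conv_integrable hT (se n) w.
  have ie : mu.-integrable setT (fun z => (e n z)%:E).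
    apply/integrableP; split; first by have := me n => men; mfun.
    by under eq_integral do rewrite abse_EFin; exact: eoo.
  rewrite /k mulrC -[X in `|X - _|](@mulfK _ (m n)) ?gt_eqF// -mulrBl normrM normfV (gtr0_norm (m0 n)).
  rewrite ler_pdivrMr// -lee_fin -abse_EFin.
  have -> : (g w * m n - h n w)%:E = (\int[mu]_z (e n z * (g w - heat_kernel_at z w))%:E)%E.
    rewrite EFinB EFinM -mE' /h (heat_conv_EFin hT (se n)) -integralZl// -integralB//; last exact: integrableZl.
    by apply: eq_integral => z _; rewrite -EFinM -EFinB; congr EFin; ring.
  apply: (le_trans (le_abse_integral mu measurableT _)).
    have mgw := measurable_heat_kernel_at_l w; have men := me n; mfun.
  rewrite EFinM -mE' -ge0_integralZl//; last 3 first.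
  - by have men := me n; mfun.
  - by move=> z _; rewrite lee_fin.
  - by rewrite lee_fin ltW.
  apply: ge0_le_integral => //.
  - have mgw := measurable_heat_kernel_at_l w; have men := me n.
    by apply: (measurableT_comp (@abse_measurable R setT)) => //; mfun.
  - by apply: measurable_funeM; have men := me n; mfun.
  move=> z _; rewrite abse_EFin -EFinM lee_fin normrM (ger0_norm (e0 n z)) mulrC.
  have [bz|nb] := pselect (box (l n) (u n) z); first by apply: ler_wpM2r => //; exact: hn.
  by rewrite /e bump_eq0// !mulr0.
have : (energy T H g g <= (C / a)%:E)%E.
  have mkS n : measurable_fun (strip : set mE) (k n) by exact: (measurable_funTS (mk n)).
  have mgS : measurable_fun (strip : set mE) g by exact: (measurable_funTS mg).
  pose G n w : \bar R := `|(H_kernel H (k n) (k n) w)%:E|%E.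
  have mG n : measurable_fun (H_domain T) (G n).
    apply: (measurableT_comp (@abse_measurable R setT)) => //; apply/measurable_EFinP.
    by apply: measurable_H_kernel; [exact: mkS|exact: mkS].
  have G0 n w : (0 <= G n w)%E by exact: abse_ge0.
  apply: (@le_trans _ _ (\int[time2space_measure R d]_(w in H_domain T) limn_einf (G ^~ w))%E).
    apply: ge0_le_integral.
    - exact: measurable_H_domain.
    - by move=> w _; exact: abse_ge0.
    - apply: (measurableT_comp (@abse_measurable R setT)) => //; apply/measurable_EFinP.
      by apply: measurable_H_kernel; exact: mgS.
    - apply: (measurableT_comp (@oppe_measurable R setT)) => //.
      by apply: measurable_fun_limn_esup => n; apply: (measurableT_comp (@oppe_measurable R setT)) => //; exact: mG.
    move=> w _.
    have inf0 : (0 <= limn_einf (G ^~ w))%E.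
      rewrite limn_einf_lim; apply: lime_ge; first exact: is_cvg_einfs.
      by apply: nearW => n; apply: le_ereal_inf_tmp => _ [j _ <-]; exact: G0.
    have g0 s y : t0 <= s -> g (s, y) = 0.
      by move=> ts; rewrite /g /heat_kernel_at /heat_kernel/= subr_gt0 ltNge ts.
    have [w1|w1] := ltP w.1.1 t0; last by rewrite /H_kernel g0// !mul0r abse0.
    have [w2|w2] := ltP w.1.2 t0; last by rewrite /H_kernel [g (w.1.2, _)]g0// mulr0 abse0.
    have lim : G n w @[n --> \oo] --> `|(H_kernel H g g w)%:E|%E.
      apply: cvg_abse; apply: cvg_EFin; first exact: nearW.
      rewrite /comp/= /H_kernel; apply: cvgM; last exact: klim.
      by apply: cvgM; [exact: klim|exact: cvg_cst].
    by rewrite is_cvg_limn_einfE; [rewrite (cvg_lim _ lim)|apply/cvg_ex; eexists; exact: lim].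
  apply: (le_trans (fatou _ (measurable_H_domain T) mG (fun n w _ => G0 n w))).
  by apply: limn_einf_le => n; exact: kbound.
by rewrite energy_heat_infty// leye_eq.
Qed.

End necessity.

(** * Uniqueness *)

Section uniqueness.
Context {R : realType} {d : nat} {dO : measure_display}
        {Omega : measurableType dO}.
Variables (T H : R) (P : probability Omega R).
Hypotheses (hT : 0 < T) (hH : 2^-1 < H < 1).
Local Notation E := (R * 'rV[R]_d)%type.
Local Notation mE := (measurableTypeR R * 'rV[R]_d)%type.
Local Notation mu := (spacetime_measure R d).
Local Notation strip := (@open_strip R d T).
Variable F : (E -> R) -> {RV P >-> R}.
Hypothesis hF : fractional_noise T H F.

(** Pairing f with f - q, where q approximates f, bounds the square norm of f by
the error of the approximation. *)
Lemma orthogonal_ae0 (l u : option 'I_d -> R) (f : mE -> R) : L2 mu f ->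
  (forall z, ~ box l u z -> f z = 0) ->
  (forall c : qcode, qcode_in l u c -> cov mu f (qcomb c) = 0) ->
  (forall c : @qcode d, qcode_in l u c -> L2 mu (qcomb c)) ->
  {ae mu, forall z, f z = 0}.
Proof.
move=> Lf f0 forth Lq; apply: (cov0_ae Lf).
have [mf foo] := Lf.
have ff0 : 0 <= cov mu f f by exact: (inner_ge0 (cov_semi_inner mu)).
apply/eqP; rewrite eq_le ff0 andbT; apply/ler_addgt0Pr => e e0; rewrite add0r.
have fB : (\int[mu]_(z in box l u) ((f z) ^+ 2)%:E < +oo)%E.
  apply: le_lt_trans foo; apply: ge0_subset_integral => //; first exact: measurable_box.
  - by mfun.
  - by move=> z _; rewrite lee_fin sqr_ge0.
have [_ /(_ e e0)[c cB hc]] := L2_approximable mf fB.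
have Lc := Lq c cB; have Ld := dom_sub (cov_semi_inner mu) Lf Lc.
have fE : cov mu f f = cov mu f (f \- qcomb c).
  by rewrite (inner_Br (cov_semi_inner mu))// forth// subr0.
have de : cov mu (f \- qcomb c) (f \- qcomb c) < e.
  rewrite -lte_fin -sqd_cov//; apply: le_lt_trans hc.
  rewrite /sqd [leRHS]integral_mkcond le_eqVlt; apply/orP; left; apply/eqP.
  apply: eq_integral => z _; rewrite patchE; case: ifPn => // /negP zB.
  have nB : ~ box l u z by move=> h; apply: zB; rewrite inE.
  by rewrite f0// (qcomb_out cB nB) subrr expr0n.
have := inner_CS (cov_semi_inner mu) Lf Ld; rewrite -fE expr2.
have [->|fn0] := eqVneq (cov mu f f) 0; first by move=> _; exact: ltW.
have fp : 0 < cov mu f f by rewrite lt_neqAle eq_sym fn0.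
by rewrite ler_pM2l// => /le_trans; apply; exact: ltW.
Qed.

Lemma qcomb_L2 (c : @qcode d) : strip_code T c -> L2 mu (qcomb c).
Proof.
move=> cS; have tc := test_function_qcomb cS; split; first exact: measurable_qcomb.
have := test_function_L2 tc; apply: le_lt_trans.
rewrite [leRHS]integral_mkcond le_eqVlt; apply/orP; left; apply/eqP.
apply: eq_integral => z _; rewrite patchE; case: ifPn => // /negP zS.
have [_ [_ [_ [_ _ out]]]] := test_function_bounded tc.
by rewrite out ?expr0n// => h; apply: zS; rewrite inE.
Qed.

Lemma measurable_section_ae0 (f : mE * Omega -> R) : measurable_fun setT f ->
  {ae P, forall w, {ae mu, forall z, f (z, w) = 0}} ->
  {ae mu, forall z, {ae P, forall w, f (z, w) = 0}}.
Proof.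
move=> mf h; pose q (p : mE * Omega) : \bar R := ((f p) ^+ 2)%:E.
have mq : measurable_fun setT q by rewrite /q; mfun.
have q0 p : (0 <= q p)%E by rewrite lee_fin sqr_ge0.
have mfw w : measurable_fun setT (fun z => f (z, w)) by exact: (measurableT_comp mf (measurable_pair2 w)).
have mfz z : measurable_fun setT (fun w => f (z, w)) by exact: (measurableT_comp mf (measurable_pair1 z)).
have mF : measurable_fun setT (fun z => \int[P]_w q (z, w))%E.
  exact: (measurable_fun_fubini_tonelli_F q mq).
have i0 : (\int[mu]_z `|\int[P]_w q (z, w)| = 0)%E.
  under eq_integral do rewrite gee0_abs ?integral_ge0//.
  rewrite (@fubini_tonelli _ _ _ _ R mu P q mq q0).
  transitivity (\int[P]_w cst 0%E w)%E; last by rewrite integral0.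
  apply: ae_eq_integral => //; first exact: (measurable_fun_fubini_tonelli_G q mq).
  apply: filterS h => w hw _; rewrite /cst.
  transitivity (\int[mu]_z cst 0%E z)%E; last by rewrite integral0.
  apply: ae_eq_integral => //; first by rewrite /q; have := mfw w => mw; mfun.
  by apply: filterS hw => z hz _; rewrite /q hz expr0n.
have := (ae_eq_integral_abs mu measurableT mF).1 i0; apply: filterS => z /(_ I)/= hz.
apply: (cov0_ae (P := P)).
  by split; [exact: mfz|rewrite (_ : (\int[P]_w _)%E = 0%E) ?ltry].
by rewrite /cov (_ : (\int[P]_w _)%E = 0%E)//; rewrite -hz; apply: eq_integral => w _; rewrite /q expr2.
Qed.

Let Kn n : set E := closed_box (strip_lower n) (strip_upper T n).
Let Bn n : set E := box (strip_lower n) (strip_upper T n).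

Let KnS n : Kn n `<=` closed_strip T.
Proof.
move=> z /(_ None)/andP[/= h1 h2]; split => //=; rewrite in_itv/=.
have : 0 < n.+1%:R^-1 :> R by rewrite invr_gt0.
by move: (n.+1%:R^-1) h1 h2 => w h1 h2 w0; apply/andP; split; lra.
Qed.

Let BnK n z : Bn n z -> Kn n z.
Proof. by move=> bz i; have /andP[h1 h2] := bz i; rewrite !ltW. Qed.

Let mBn n : measurable (Bn n : set mE). Proof. exact: measurable_box. Qed.

Section one_process.
Variable Y : E -> Omega -> R.
Hypothesis sY : solution_process T H F Y.
Variable n : nat.
Local Notation Z := (cut (Kn n) Y).
Local Notation I := (\1_(Bn n) : mE -> R).

Lemma measurable_cut_box : measurable_fun (setT : set (mE * Omega)) (fun q => Z q.1 q.2).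
Proof.
have [mY _ _] := sY; apply: (@measurable_cut _ _ _ _ T) => //.
- exact: closed_box_compact.
- exact: closed_closed_box.
Qed.

Lemma cut_box_ae_L2 : {ae P, forall w, L2 mu (fun z => Z z w * I z)}.
Proof.
have [mY bY _] := sY; have mZ := measurable_cut_box.
have [C C0 ZC] := cut_bounded (@closed_box_compact _ _ _ _) (@KnS n) bY.
have mI : measurable_fun setT I by exact: measurable_indic.
have Ioo : (\int[mu]_z `|I z|%:E < +oo)%E.
  under eq_integral do rewrite ger0_norm//.
  by rewrite integral_indic// setIT; exact: spacetime_box_fin.
have := process_ae_L2 mZ mI C0 ZC Ioo; apply: filterS => w h; split.
  by have mw : measurable_fun setT (fun z => Z z w) by [exact: (measurableT_comp mZ (measurable_pair2 w))]; mfun.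
move: h; congr (_ < _)%E; apply: eq_integral => z _; congr EFin.
by rewrite exprMn indicE; case: (_ \in _); rewrite ?normr1 ?normr0 ?expr1n ?expr0n.
Qed.

Lemma cut_box_cov : {ae P, forall w, forall c : @qcode d,
  qcode_in (strip_lower n) (strip_upper T n) c ->
  cov mu (fun z => Z z w * I z) (qcomb c) = dist_solution T H F (qcomb c) w}.
Proof.
have [_ _ rY] := sY.
have : {ae P, forall w, forall k, (dist_solution T H F (qcomb (code_enum T k) : E -> R) w)%:E =
    (\int[mu]_(z in closed_strip T) (Y z w * qcomb (code_enum T k) z)%:E)%E}.
  apply: ae_foralln => k; apply: (rY _ _).2.
  by apply: test_function_qcomb; exact: code_enum_strip.
apply: filterS => w h c cB; have [k kc] := code_enumP (strip_box_code cB).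
apply: EFin_inj; rewrite -kc h kc.
have qB z : qcomb c z != 0 :> R -> Bn n z.
  by move=> qz; apply: contrapT => nB; move: qz; rewrite (qcomb_out cB nB) eqxx.
rewrite (@integral_closed_strip _ _ T (fun z => Y z w) (fun z => Z z w * I z)); last first.
  move=> z /qB zB; split; first exact/KnS/BnK.
  by rewrite /cut (mem_set (BnK zB)) indicE (mem_set zB) mulr1.
rewrite /cov fineK//; have := h k; rewrite kc.
rewrite (@integral_closed_strip _ _ T (fun z => Y z w) (fun z => Z z w * I z)); first by move=> <-.
move=> z /qB zB; split; first exact/KnS/BnK.
by rewrite /cut (mem_set (BnK zB)) indicE (mem_set zB) mulr1.
Qed.

End one_process.

Lemma time_ae_neq (c : R) : {ae mu, forall z, z.1 != c}.
Proof.
exists ([set c] `*` setT : set mE); split.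
- by apply: measurableX => //; exact: measurable_set1.
- rewrite /spacetime_measure product_measure1E//.
  by rewrite [X in (X * _)%E]lebesgue_measure_set1 mul0e.
- by move=> z /= /negP/negPn/eqP ->.
Qed.

(** Two solutions have the same averages against every test function almost
surely, hence simultaneously against countably many of them; as these are dense
the solutions agree almost everywhere, and Fubini's theorem exchanges the
exceptional sets. *)
Lemma solution_unique (Y1 Y0 : E -> Omega -> R) :
  solution_process T H F Y1 -> solution_process T H F Y0 ->
  {ae mu, forall z, closed_strip T z -> {ae P, forall w, Y1 z w = Y0 z w}}.
Proof.
move=> s1 s0.
pose f n (p : mE * Omega) : R := (cut (Kn n) Y1 p.1 p.2 - cut (Kn n) Y0 p.1 p.2) * \1_(Bn n) p.1.
have f0 n : {ae mu, forall z, {ae P, forall w, f n (z, w) = 0}}.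
  have m1 := measurable_cut_box s1 n; have m0 := measurable_cut_box s0 n.
  apply: measurable_section_ae0.
    apply: measurable_funM; first exact: measurable_funB.
    by apply: (measurableT_comp _ measurable_fst); exact: measurable_indic.
  have a1 := cut_box_ae_L2 s1 n; have a0 := cut_box_ae_L2 s0 n.
  have c1 := cut_box_cov s1 n; have c0 := cut_box_cov s0 n.
  near=> w.
  have L1 : L2 mu (fun z => cut (Kn n) Y1 z w * \1_(Bn n) z) by near: w.
  have L0 : L2 mu (fun z => cut (Kn n) Y0 z w * \1_(Bn n) z) by near: w.
  have fE : (fun z => f n (z, w)) = (fun z => cut (Kn n) Y1 z w * \1_(Bn n) z) \- (fun z => cut (Kn n) Y0 z w * \1_(Bn n) z).
    by apply/funext => z; rewrite /f/= mulrBl.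
  apply: (@orthogonal_ae0 (strip_lower n) (strip_upper T n) (fun z => f n (z, w))).
  - by rewrite fE; exact: (dom_sub (cov_semi_inner mu)).
  - by move=> z nz; rewrite /f/= indicE memNset// mulr0.
  - move=> c cB; have Lc := qcomb_L2 (strip_box_code cB).
    rewrite fE (inner_Bl (cov_semi_inner mu))//; apply/eqP; rewrite subr_eq0; apply/eqP.
    transitivity (dist_solution T H F (qcomb c) w); last apply/esym.
      by move: c cB {Lc}; near: w.
    by move: c cB {Lc}; near: w.
  - by move=> c cB; exact: (qcomb_L2 (strip_box_code cB)).
have fall : {ae mu, forall z, forall n, {ae P, forall w, f n (z, w) = 0}} by exact: ae_foralln.
have t0 := time_ae_neq 0; have tT := time_ae_neq T.
have aeF : Filter (almost_everywhere mu) by exact: ae_filter_ringOfSetsType.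
apply: filterS3 t0 tT fall => z z0 zT fz [/=]; rewrite in_itv/= => /andP[h1 h2] _.
have zS : strip z by split => //=; rewrite in_itv/= !lt_neqAle eq_sym z0 h1 zT h2.
have [n _ /(_ n (leqnn n)) zB] := strip_exhaustion zS.
apply: filterS (fz n) => w /eqP; rewrite /f/= indicE (mem_set (zB : Bn n z)) mulr1 subr_eq0 => /eqP.
by rewrite /cut (mem_set (BnK zB)).
Unshelve. all: by end_near.
Qed.

End uniqueness.

Theorem theorem2p11 (R : realType) (d : nat) (hd : (1 <= d)%N)
    (T : R) (hT : 0 < T) (H : R) (hH : 2^-1 < H < 1)
    (dO : measure_display) (Omega : measurableType dO)
    (P : probability Omega R)
    (F : (R * 'rV[R]_d -> R) -> {RV P >-> R})
    (hF : fractional_noise T H F) :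
  ((exists Y : R * 'rV[R]_d -> Omega -> R, solution_process T H F Y) <->
     d%:R / 4 < H) /\
  (d%:R / 4 < H ->
     (exists2 Y : R * 'rV[R]_d -> Omega -> R,
        solution_process T H F Y & is_modification T H F Y) /\
     (forall Y : R * 'rV[R]_d -> Omega -> R,
        solution_process T H F Y -> is_ae_modification T H F Y)).
Proof.
split.
  split=> [[Y sY]|dH]; first exact: (solution_necessary hT hH hF sY).
  by have [Y sY _] := solution_exists hT hH hF dH; exists Y.
move=> dH; have [Y0 s0 m0] := solution_exists hT hH hF dH.
split; first by exists Y0.
move=> Y sY; have := solution_unique sY s0.
have aeF : Filter (almost_everywhere (spacetime_measure R d)) by exact: ae_filter_ringOfSetsType.
apply: filterS => z h zS; have [iH vz] := m0 z zS; split=> //.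
by apply: filterS2 (h zS) vz => w -> ->.
Qed.
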